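(* There exists an Adian extension that embeds into a weakly algebraically hyperbolic (weakly AH) group of type $\mathtt{F}$ if and only if there exists a weakly AH group of type $\mathtt{F}$ which is not algebraically hyperbolic (AH). In particular, if all Adian extensions have infinite cohomological dimension, then a group $G$ of type $\mathtt{F}$ is weakly AH if and only if it is AH.
   Context: A group is of type $\mathtt{F}$ if it has a finite classifying space. An Adian extension is a finitely generated torsion-free group which maps onto an infinite torsion group with cyclic kernel. A group is locally cyclic if each of its non-trivial finitely generated subgroups is isomorphic to $\mathbb{Z}$ (equivalently, it is isomorphic to a subgroup of $(\mathbb{Q},+)$). A group $G$ is commutative-transitive if for all $g,h,k\in G\smallsetminus\{1\}$, $[g,h]=1$ and $[h,k]=1$ imply $[g,k]=1$. A torsion-free group $G$ is algebraically hyperbolic (AH) if (a) $G$ is commutative-transitive, and (b) $G$ contains no subgroup of the form $H\rtimes\mathbb{Z}$ with $H$ non-trivial locally cyclic. A group $G$ is weakly algebraically hyperbolic (weakly AH) if it contains no subgroup isomorphic to $\mathbb{Z}^2$ and for every non-trivial $x\in G$ and all $m,n\in\mathbb{Z}$, if $x^m$ and $x^n$ are conjugate in $G$ then $|m|=|n|$. *)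

(* Defs.v *)
From HB Require Import structures.
From mathcomp Require Import all_boot all_order all_algebra.
From mathcomp Require Import all_classical all_reals all_analysis.
Set Implicit Arguments.
Unset Strict Implicit.
Unset Printing Implicit Defensive.
Import Order.TTheory GRing.Theory Num.Theory.
Import numFieldNormedType.Exports.
Local Open Scope classical_set_scope.
Local Open Scope ring_scope.

(* Groups are elements of groupType (not necessarily finite); subgroups are
   sets satisfying [subgroup]. *)

Definition expgz (G : groupType) (x : G) (m : int) : G :=
  match m with Posz n => (x ^+ n)%g | Negz n => (x ^- n.+1)%g end.

Definition subgroup (G : groupType) (H : set G) : Prop :=
  [/\ H 1%g, forall x y, H x -> H y -> H (x * y)%g & forall x, H x -> H x^-1%g].

Definition gen_by (G : groupType) (S : set G) : set G := smallest (@subgroup G) S.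

Definition trivial_sub (G : groupType) (H : set G) : Prop := H = [set 1%g].

(* The subgroup H is isomorphic to the additive group V. *)
Definition isog_add (V : zmodType) (G : groupType) (H : set G) : Prop :=
  exists f : V -> G,
    [/\ injective f, forall u v, f (u + v) = (f u * f v)%g & range f = H].

Definition embeds (A G : groupType) : Prop :=
  exists f : A -> G, injective f /\ {morph f : x y / (x * y)%g}.

Definition fin_gen (G : groupType) : Prop :=
  exists s : seq G, gen_by [set` s] = [set: G].

Definition torsion_free (G : groupType) : Prop :=
  forall (x : G) (n : nat), (0 < n)%N -> (x ^+ n)%g = 1%g -> x = 1%g.

Definition torsion (G : groupType) : Prop :=
  forall x : G, exists2 n : nat, (0 < n)%N & (x ^+ n)%g = 1%g.

Definition cyclic_sub (G : groupType) (H : set G) : Prop :=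
  exists c : G, H = gen_by [set c].

Definition Adian_extension (A : groupType) : Prop :=
  [/\ fin_gen A, torsion_free A &
    exists (T : groupType) (p : A -> T),
      [/\ {morph p : x y / (x * y)%g}, range p = [set: T],
          infinite_set [set: T], torsion T &
          cyclic_sub [set a | p a = 1%g]]].

Definition locally_cyclic (G : groupType) (H : set G) : Prop :=
  forall s : seq G, [set` s] `<=` H ->
    ~ trivial_sub (gen_by [set` s]) -> isog_add int (gen_by [set` s]).

Definition commutative_transitive (G : groupType) : Prop :=
  forall g h k : G, g <> 1%g -> h <> 1%g -> k <> 1%g ->
    [~ g, h]%g = 1%g -> [~ h, k]%g = 1%g -> [~ g, k]%g = 1%g.

(* S is the internal semidirect product of H by K, H being normalised by K. *)
Definition semidirect (G : groupType) (S H K : set G) : Prop :=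
  [/\ subgroup S, subgroup H, subgroup K,
      forall h k, H h -> K k -> H (h ^ k)%g &
      S = [set (h * k)%g | h in H & k in K] /\ H `&` K = [set 1%g]].

Definition AH (G : groupType) : Prop :=
  [/\ torsion_free G, commutative_transitive G &
    ~ exists S H K : set G,
      [/\ semidirect S H K, ~ trivial_sub H, locally_cyclic H &
          isog_add int K]].

Definition conj_elt (G : groupType) (x y : G) : Prop :=
  exists g : G, y = (x ^ g)%g.

Definition weakly_AH (G : groupType) : Prop :=
  (~ exists H : set G, subgroup H /\ isog_add (int * int)%type H) /\
  (forall x : G, x <> 1%g -> forall m n : int,
     conj_elt (expgz x m) (expgz x n) -> `|m| = `|n|).

(* Closed unit disk D^d, its interior and its boundary sphere.  The Euclidean
   norm is written out because the library norm on 'rV[R]_d is the sup norm. *)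
Section disk.
Variables (R : realType) (d : nat).
Definition sqnorm (v : 'rV[R]_d) : R := \sum_(i < d) (v 0 i) ^+ 2.
Definition disk : set 'rV[R]_d := [set v | sqnorm v <= 1].
Definition open_disk : set 'rV[R]_d := [set v | sqnorm v < 1].
Definition sphere : set 'rV[R]_d := [set v | sqnorm v = 1].
End disk.
Arguments disk : clear implicits.
Arguments open_disk : clear implicits.
Arguments sphere : clear implicits.

(* A finite CW complex, presented by characteristic maps [phi i] of its cells:
   X is Hausdorff and the disjoint union of the open cells, and the boundary of
   each cell lies in the cells of smaller dimension.  As there are finitely many
   cells, the weak topology condition, and the fact that each [phi i] is a
   homeomorphism from the open disk to the open cell, follow by compactness. *)
Definition finite_CW (R : realType) (X : topologicalType) : Prop :=
  hausdorff_space X /\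
  exists (I : finType) (dim : I -> nat) (phi : forall i, 'rV[R]_(dim i) -> X),
    [/\ forall i, {within disk R (dim i), continuous (phi i)},
        forall i, {in open_disk R (dim i) &, injective (phi i)},
        \bigcup_i (phi i @` open_disk R (dim i)) = [set: X],
        forall i j, i <> j ->
          (phi i @` open_disk R (dim i)) `&` (phi j @` open_disk R (dim j))
            = set0 &
        forall i, phi i @` sphere R (dim i) `<=`
          \bigcup_(j in [set j | (dim j < dim i)%N])
            (phi j @` open_disk R (dim j))].

Definition contractible (R : realType) (E : topologicalType) : Prop :=
  exists (e0 : E) (h : E * R -> E),
    [/\ {within [set: E] `*` `[0, 1], continuous h},
        forall e, h (e, 0) = e & forall e, h (e, 1) = e0].

Definition continuous_action (G : groupType) (E : topologicalType)
    (act : G -> E -> E) : Prop :=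
  [/\ forall e, act 1%g e = e,
      forall g h e, act (g * h)%g e = act g (act h e) &
      forall g, continuous (act g)].

Definition covering_action (G : groupType) (E : topologicalType)
    (act : G -> E -> E) : Prop :=
  forall e : E, exists V : set E,
    [/\ open V, V e & forall g, g <> 1%g -> (act g @` V) `&` V = set0].

(* [p] exhibits X as the orbit space E/G with the quotient topology. *)
Definition orbit_space (G : groupType) (E X : topologicalType)
    (act : G -> E -> E) (p : E -> X) : Prop :=
  [/\ range p = [set: X],
      forall e e', p e = p e' <-> exists g, act g e = e' &
      forall W : set X, open W <-> open (p @^-1` W)].

(* BG = EG/G with EG contractible and G acting on it by deck transformations
   (so EG is the universal cover of BG and G its fundamental group). *)
Definition classifying_space (R : realType) (G : groupType)
    (X : topologicalType) : Prop :=
  exists (E : topologicalType) (act : G -> E -> E) (p : E -> X),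
    [/\ contractible R E, continuous_action act, covering_action act &
        orbit_space act p].

Definition type_F (R : realType) (G : groupType) : Prop :=
  exists X : topologicalType, finite_CW R X /\ classifying_space R G X.

(* Left Z[G]-modules: abelian groups with an additive action of G. *)
Record gmodule (G : groupType) := GModule {
  gmod_car :> zmodType;
  gact : G -> gmod_car -> gmod_car;
  gactD : forall g, {morph gact g : x y / x + y};
  gact1 : forall x, gact 1%g x = x;
  gactM : forall g h x, gact (g * h)%g x = gact g (gact h x) }.

Definition trivial_gmodule (G : groupType) (V : zmodType) : gmodule G :=
  @GModule G V (fun _ x => x) (fun _ _ _ => erefl) (fun _ => erefl)
    (fun _ _ _ => erefl).

Definition ghom (G : groupType) (M N : gmodule G) (f : M -> N) : Prop :=
  {morph f : x y / x + y} /\ forall g x, f (gact g x) = gact g (f x).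

Definition projective (G : groupType) (P : gmodule G) : Prop :=
  forall (M N : gmodule G) (f : M -> N) (h : P -> N),
    ghom f -> range f = [set: N] -> ghom h ->
    exists k : P -> M, ghom k /\ forall x, f (k x) = h x.

Definition exact_at (U V W : zmodType) (f : U -> V) (g : V -> W) : Prop :=
  range f = [set v | g v = 0].

(* cd G <= n: the trivial Z[G]-module Z has a projective resolution
   0 -> P_n -> ... -> P_0 -> Z -> 0. *)
Definition cd_le (G : groupType) (n : nat) : Prop :=
  exists (P : nat -> gmodule G) (d : forall k, P k.+1 -> P k)
         (eps : P 0%N -> trivial_gmodule G int),
    [/\ (forall k, projective (P k)) /\
        (forall k, (n < k)%N -> forall x : P k, x = 0),
        (forall k, ghom (d k)) /\ ghom eps,
        range eps = [set: int],
        exact_at (d 0%N) eps &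
        forall k, exact_at (d k.+1) (d k)].

Definition infinite_cd (G : groupType) : Prop := forall n, ~ cd_le G n.

(* Main.v *)
Require Import Defs.
From HB Require Import structures.
From mathcomp Require Import all_boot all_order all_algebra.
From mathcomp Require Import all_classical all_reals all_analysis.
From mathcomp Require Import freeg.
From mathcomp Require Import zify ring lra.
Set Implicit Arguments.
Unset Strict Implicit.
Unset Printing Implicit Defensive.
Import Order.TTheory GRing.Theory Num.Theory.
Import numFieldNormedType.Exports.
Local Open Scope classical_set_scope.
Local Open Scope ring_scope.

(** Why the theorem is true.

    Weakly AH groups are torsion-free, since x^n = x^0 forces n = 0.  A weakly AH
    group contains no subgroup H x| Z with H locally cyclic: x and its conjugate
    by the generator k of Z lie in a common cyclic group, so the condition on
    conjugate powers gives x^k = x^{+1} or x^{-1}, and then x and k^2 generate Z^2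
    ([weakly_AH_no_semidirect]).  So a weakly AH group which is not AH has h <> 1
    commuting with g and k, while g and k do not commute.  In A = <g, h, k> the
    element h is central, and the absence of Z^2 makes A/<h> a torsion group; it is
    infinite, because otherwise the transfer A -> <h> would kill every commutator
    and be injective up to torsion, making A abelian
    ([finite_central_quotient_abelian]).  Hence A is an Adian extension
    ([not_CT_Adian]).  Conversely the cyclic kernel of an Adian extension is
    central, so a commutative-transitive Adian extension would be abelian and its
    finitely generated torsion quotient finite ([Adian_not_CT]).  That AH implies
    weakly AH holds because a conjugacy by g between x^m and x^n with |m| <> |n|
    would give a semidirect product H x| <g>, where H is the locally cyclic group
    of the elements commensurable with x in its centraliser ([AH_weakly_AH]).

    The second assertion then needs one fact: a torsion-free subgroup A of a group
    G of type F has finite cohomological dimension ([type_F_cd]).  Let G act on the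
    contractible space E with compact quotient X.  Finitely many evenly covered
    open sets cover X; their sheets give open sets W (j, a) of E, with j < N and
    a in A, which cover E, are permuted by A, and are disjoint in a for fixed j.
    So the nerve of this cover is a free A-complex of dimension at most N - 1.

    A free resolution of Z which maps to this nerve is built as follows.  Let Y be
    the convex cone of nonzero finitely supported functions A -> [0, oo).  As E is
    contractible, there is an equivariant map from Y to E, continuous on
    finite-dimensional faces ([eqv_map_act], [eqv_map_cont]).  A tuple of points of
    Y is small when its convex hull is mapped into one W (j, a).  Barycentric
    subdivision makes any tuple small after finitely many steps
    ([eventually_small]) and is chain homotopic to the identity through small
    chains, so the small tuples form an acyclic complex ([small_acyclic]) of free
    Z[A]-modules.  Sending a tuple to the partial function j |-> a of its labels,
    and repeating this on its barycentric subdivision, gives an equivariant chain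
    map to strict flags of partial functions, which have at most N terms
    ([nerve_map_spec], [flag_size]).  Composing with a chain map back
    gives an equivariant endomorphism of the small complex which vanishes in
    degree N and is homotopic to the identity; the homotopy splits off a projective
    kernel in degree N and truncates the resolution ([finite_resolution]). *)

(** * Integer powers and generated subgroups *)

Section IntegerPowers.
Variable G : groupType.
Implicit Types (x y g : G) (m n : int).

(** The two constructors of [int] hide the symmetry of exponents; writing an
    exponent as a difference of naturals removes the case analysis from
    [expgzD]. *)
Lemma expgz_sub x (a b : nat) : expgz x (a%:Z - b%:Z) = (x ^+ a * x ^- b)%g.
Proof.
have [ba|ab] := leqP b a; first by rewrite subzn //= expgnFr.
rewrite -opprB subzn ?(ltnW ab) //.
have -> : - (b - a)%N%:Z = Negz (b - a).-1 by rewrite NegzE prednK // subn_gt0.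
by rewrite /= prednK ?subn_gt0 // expgnFr ?(ltnW ab) // invgF.
Qed.

Lemma int_sub m : exists a b : nat, m = a%:Z - b%:Z.
Proof.
case: m => n; first by exists n, 0%N; rewrite subr0.
by exists 0%N, n.+1; rewrite NegzE sub0r.
Qed.

Lemma expgz0 x : expgz x 0 = 1%g. Proof. by []. Qed.
Lemma expgz1 x : expgz x 1 = x. Proof. by []. Qed.
Lemma expgz_nat x (n : nat) : expgz x n%:Z = (x ^+ n)%g. Proof. by []. Qed.

Lemma expgzD x m n : expgz x (m + n) = (expgz x m * expgz x n)%g.
Proof.
have [a [b ->]] := int_sub m; have [c [d ->]] := int_sub n.
have -> : a%:Z - b%:Z + (c%:Z - d%:Z) = (a + c)%N%:Z - (d + b)%N%:Z by lia.
rewrite !expgz_sub !expgnDr invgM -!mulgA; congr (_ * _)%g; rewrite !mulgA.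
congr (_ * _)%g; change (commute (x ^+ c)%g (x ^- b)%g).
by apply: commuteV; exact: commuteX2.
Qed.

Lemma expgzN x m : expgz x (- m) = (expgz x m)^-1%g.
Proof. by apply/esym/mulg1_eq; rewrite -expgzD subrr. Qed.

Lemma expgz1g m : expgz (1 : G)%g m = 1%g.
Proof. by case: m => n /=; rewrite expg1n ?invg1. Qed.

Lemma commute_expgz x y n : commute x y -> commute x (expgz y n).
Proof. by move=> xy; case: n => n /=; [|apply: commuteV]; exact: commuteX. Qed.

Lemma commute_expgz2 x y m n : commute x y -> commute (expgz x m) (expgz y n).
Proof. by move=> xy; apply/commute_expgz/commute_sym/commute_expgz. Qed.

Lemma expgzMn x y n : commute x y -> expgz (x * y)%g n = (expgz x n * expgz y n)%g.
Proof.
move=> xy; case: n => n /=; rewrite expgMn // invgM.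
have : commute (x ^- n.+1)%g (y ^- n.+1)%g.
  by apply/commuteV/commute_sym/commuteV/commuteX2.
by move=> ->.
Qed.

Lemma expgzV x n : expgz x^-1%g n = (expgz x n)^-1%g.
Proof. by case: n => n /=; rewrite expVgn. Qed.

Lemma expgzJ x g n : expgz (x ^ g)%g n = (expgz x n ^ g)%g.
Proof. by case: n => n /=; rewrite ?conjVg conjXg. Qed.

Lemma expgzM x m n : expgz x (m * n) = expgz (expgz x m) n.
Proof.
have nat_case (k : nat) p : expgz x (p * k%:Z) = (expgz x p ^+ k)%g.
  elim: k => [|k IH]; first by rewrite mulr0.
  by rewrite intS mulrDr mulr1 expgzD IH expgS.
case: n => n; first exact: nat_case.
by rewrite NegzE mulrN !expgzN nat_case.
Qed.

Lemma expgzC x m n : commute (expgz x m) (expgz x n).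
Proof. exact: commute_expgz2. Qed.

Lemma commute_conj x y g : commute x y -> commute (x ^ g)%g (y ^ g)%g.
Proof. by rewrite /commute -!conjMg => ->. Qed.

Lemma commute_conjg x g : commute x g -> (x ^ g)%g = x.
Proof. by move=> xg; rewrite conjgE xg mulKg. Qed.

Hypothesis tf : torsion_free G.

Lemma expgz_eq1 x n : n != 0 -> expgz x n = 1%g -> x = 1%g.
Proof.
case: n => [[|n]|n] //= _; first exact: tf.
by move=> h; apply: (tf (n := n.+1)) => //; apply: invg_inj; rewrite h invg1.
Qed.

Lemma expgz_inj x : x <> 1%g -> injective (expgz x).
Proof.
move=> x1 m n e; apply/eqP; rewrite -subr_eq0; apply/eqP; apply: contrapT => /eqP mn.
by apply: x1; apply: (expgz_eq1 mn); rewrite expgzD expgzN e mulgV.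
Qed.

(** Dividing m and n by their gcd is possible because there is no torsion; the
    Bezout combination of x and y for the coprime quotients is then a common
    root of both. *)
Lemma common_root x y m n : commute x y -> (m, n) <> (0, 0) ->
  expgz x m = expgz y n ->
  exists z, [/\ exists a, x = expgz z a, exists b, y = expgz z b &
    exists u v, z = (expgz x u * expgz y v)%g].
Proof.
move=> xy mn e; pose d := gcdz m n.
have d0 : d != 0.
  by rewrite gcdz_eq0; apply/negP => /andP[/eqP m0 /eqP n0]; apply: mn; rewrite m0 n0.
have [u [v uv]] := Bezoutz m n; rewrite -/d in uv.
have /dvdzP[m' em] := dvdz_gcdl m n; have /dvdzP[n' en] := dvdz_gcdr m n.
rewrite -/d in em en.
have uv1 : u * m' + v * n' = 1.
  apply: (mulIf d0); rewrite mul1r -[RHS]uv em en mulrDl !mulrA //.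
have e' : expgz x m' = expgz y n'.
  have c : commute (expgz x m') (expgz y (- n')) by exact: commute_expgz2.
  have : (expgz x m' * expgz y (- n'))%g = 1%g.
    apply: (expgz_eq1 d0); rewrite expgzMn // -!expgzM mulNr -em -en expgzN e.
    by rewrite mulgV.
  by rewrite expgzN => /divg1_eq.
pose z := (expgz x v * expgz y u)%g.
have cz : commute (expgz x v) (expgz y u) by exact: commute_expgz2.
exists z; split; last by exists v, u.
- exists n'; rewrite expgzMn // -!expgzM (mulrC u n') (expgzM y) -e' -expgzM -expgzD.
  by rewrite addrC (mulrC m') uv1.
exists m'; rewrite expgzMn // -!expgzM (mulrC v m') (expgzM x) e' -expgzM -expgzD.
by rewrite addrC (mulrC n') uv1.
Qed.
End IntegerPowers.

Section GeneratedSubgroups.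
Variable G : groupType.
Implicit Types (x y g : G) (S H K : set G).

Lemma gen_by_subgroup S : subgroup (gen_by S).
Proof.
split.
- by move=> H [[H1 _ _] _].
- by move=> x y hx hy H HS; have [[_ HM _] _] := HS; exact: HM (hx H HS) (hy H HS).
- by move=> x hx H HS; have [[_ _ HV] _] := HS; exact: HV (hx H HS).
Qed.
Lemma sub_gen_by S : S `<=` gen_by S.
Proof. by move=> x Sx H [_ SH]; exact: SH. Qed.
Lemma gen_by_min S H : subgroup H -> S `<=` H -> gen_by S `<=` H.
Proof. by move=> sH SH x; apply. Qed.

Lemma subgroupX H x (n : nat) : subgroup H -> H x -> H (x ^+ n)%g.
Proof.
move=> [H1 HM _] Hx; elim: n => [|n IH]; first by rewrite expg0.
by rewrite expgS; exact: HM.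
Qed.
Lemma subgroup_expgz H x n : subgroup H -> H x -> H (expgz x n).
Proof.
by move=> sH Hx; have [_ _ HV] := sH; case: n => n /=; [|apply: HV]; exact: subgroupX.
Qed.

Lemma cyclic_subgroup x : subgroup (range (expgz x)).
Proof.
split; first by exists 0.
- by move=> _ _ [m _ <-] [n _ <-]; exists (m + n) => //; rewrite expgzD.
- by move=> _ [m _ <-]; exists (- m) => //; rewrite expgzN.
Qed.

Lemma gen_by1 x : gen_by [set x] = range (expgz x).
Proof.
apply/seteqP; split.
  by apply: gen_by_min; [exact: cyclic_subgroup | move=> _ ->; exists 1].
move=> _ [n _ <-].
exact: (subgroup_expgz n (gen_by_subgroup [set x]) (sub_gen_by (erefl x))).
Qed.

Lemma centraliser_subgroup x : subgroup [set y | commute x y].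
Proof.
split=> /=; first exact: commute1.
- by move=> y z; exact: commuteM.
- by move=> y; exact: commuteV.
Qed.

Lemma cyclic_isog x : torsion_free G -> x <> 1%g -> isog_add int (range (expgz x)).
Proof.
by move=> tf x1; exists (expgz x); split=> //; [exact: expgz_inj | exact: expgzD].
Qed.

(** Allowing one of the two exponents to vanish makes every element
    commensurable with 1. *)
Definition commensurable_elts x y :=
  exists m n : int, (m, n) <> (0, 0) /\ expgz x m = expgz y n.

(** Induction on the generators: [common_root] merges each new generator with a
    generator of the cyclic group obtained so far. *)
Lemma rank1_locally_cyclic H : torsion_free G -> subgroup H ->
  (forall x y, H x -> H y -> commute x y) ->
  (forall x y, H x -> H y -> commensurable_elts x y) -> locally_cyclic H.
Proof.
move=> tf sH Hab Hcom s sub nt; have [H1 HM _] := sH.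
suff [c Hc gc] : exists2 c, H c & gen_by [set` s] = range (expgz c).
  rewrite gc; apply: cyclic_isog => // c1; apply: nt; rewrite gc c1.
  apply/seteqP; split=> [_ [n _ <-]|_ ->]; first by rewrite expgz1g.
  by exists 0.
elim: s sub {nt} => [_|x s IH sub].
  exists 1%g => //; apply/seteqP; split; last first.
    by move=> _ [n _ <-]; rewrite expgz1g; have [] := gen_by_subgroup [set` [::] : seq G].
  by apply: gen_by_min => //; exact: cyclic_subgroup.
have Hx : H x by apply: sub; rewrite /= mem_head.
have [c Hc gc] : exists2 c, H c & gen_by [set` s] = range (expgz c).
  by apply: IH => y /= ys; apply: sub; rewrite /= inE ys orbT.
have [m [n [mn e]]] := Hcom x c Hx Hc.
have [z [[a xa] [b cb] [u [v zuv]]]] := common_root tf (Hab x c Hx Hc) mn e.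
exists z; first by rewrite zuv; apply: HM; exact: subgroup_expgz.
have sg := gen_by_subgroup [set` x :: s].
apply/seteqP; split.
  apply: gen_by_min; first exact: cyclic_subgroup.
  move=> y /=; rewrite inE => /orP[/eqP ->|ys]; first by exists a.
  have : gen_by [set` s] y by exact: sub_gen_by.
  by rewrite gc => -[k _ <-]; exists (b * k) => //; rewrite expgzM -cb.
move=> _ [k _ <-]; apply: (subgroup_expgz k sg); rewrite zuv.
have [_ gM _] := sg; apply: gM; apply: (subgroup_expgz _ sg).
  by apply: sub_gen_by; rewrite /= mem_head.
have : range (expgz c) c by exists 1.
rewrite -gc; apply: (gen_by_min sg) => y ys; apply: sub_gen_by.
by move: ys; rewrite /= inE => ->; rewrite orbT.
Qed.

Lemma semidirect_product H K : subgroup H -> subgroup K ->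
  (forall h k, H h -> K k -> H (h ^ k)%g) -> H `&` K = [set 1%g] ->
  semidirect [set (h * k)%g | h in H & k in K] H K.
Proof.
move=> sH sK nHK HK; have [H1 HM HV] := sH; have [K1 KM KV] := sK.
split=> //; split.
- by exists 1%g => //; exists 1%g => //; rewrite mulg1.
- move=> _ _ [h Hh [k Kk <-]] [h' Hh' [k' Kk' <-]].
  exists (h * h' ^ k^-1)%g; first by apply: HM => //; apply: nHK => //; exact: KV.
  exists (k * k')%g; first exact: KM.
  by rewrite conjgE invgK !mulgA mulgVK.
- move=> _ [h Hh [k Kk <-]]; exists (h^-1 ^ k)%g; first by apply: nHK => //; exact: HV.
  by exists k^-1%g; [exact: KV | rewrite conjgE invgM mulgA mulgK].
Qed.
End GeneratedSubgroups.

(** * Weakly AH groups *)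

Section WeaklyAH.
Variable G : groupType.
Implicit Types (x y g h k : G) (H K S : set G).

Lemma weakly_AH_torsion_free : weakly_AH G -> torsion_free G.
Proof.
move=> [_ wAH] x n n0 xn; apply: contrapT => x1.
have := wAH x x1 n%:Z 0 _; rewrite normr0 => /(_ _)/eqP; rewrite normr_eq0 => h.
suff /h : conj_elt (expgz x n%:Z) (expgz x 0) by move=> /eqP[e]; rewrite e in n0.
by exists 1%g; rewrite expgz_nat xn conj1g.
Qed.

Definition no_Z2 := ~ exists H : set G, subgroup H /\ isog_add (int * int)%type H.

(** If x and y commute and have no common power, then (m, n) |-> x^m y^n embeds
    Z^2. *)
Lemma commensurable_of_no_Z2 : no_Z2 -> forall x y, commute x y -> commensurable_elts x y.
Proof.
move=> nZ2 x y xy; apply: contrapT => nc; apply: nZ2.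
pose f (u : int * int) := (expgz x u.1 * expgz y u.2)%g.
have fD u v : f (u + v) = (f u * f v)%g.
  rewrite /f /= !expgzD -!mulgA; congr (_ * _)%g; rewrite !mulgA; congr (_ * _)%g.
  exact: commute_expgz2.
have f0 : f 0 = 1%g by apply: (@mulgI _ (f 0)); rewrite -fD addr0 mulg1.
have fN u : f (- u) = (f u)^-1%g.
  by apply/esym/mulg1_eq; rewrite -fD subrr.
have finj : injective f.
  move=> u v e; apply/eqP; rewrite -subr_eq0; apply/eqP.
  have : f (u - v) = 1%g by rewrite fD fN e mulgV.
  case: (u - v) => m n; rewrite /f /= => fmn; apply: contrapT => mn; apply: nc.
  exists m, (- n); split; last by rewrite expgzN -(mulg1_eq fmn) invgK.
  by move=> [m0 n0]; apply: mn; rewrite m0 -[n]opprK n0 oppr0.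
exists (range f); split; last by exists f.
split; first by exists 0.
- by move=> _ _ [u _ <-] [v _ <-]; exists (u + v).
- by move=> _ [u _ <-]; exists (- u).
Qed.

Lemma norm_eqz (a b : int) : `|a| = `|b| -> b = a \/ b = - a.
Proof. by move=> /eqP; rewrite eq_sym eqr_norm2 => /orP[/eqP ->|/eqP ->]; [left|right]. Qed.

(** For x in H and k a generator of K, the elements x and x^k of the locally
    cyclic group H are powers of one element, of exponents a and b say.  Then
    x^b = (x^a)^k, so b = a or b = -a, and x commutes with k^2.  As H and K meet
    trivially, x and k^2 would generate Z^2. *)
Lemma weakly_AH_no_semidirect : weakly_AH G ->
  ~ exists S H K : set G,
      [/\ semidirect S H K, ~ trivial_sub H, locally_cyclic H & isog_add int K].
Proof.
move=> wG [S [H [K [[_ sH sK nHK [_ HK]] ntH lcH [f [finj fD fK]]]]]].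
have [nZ2 wAH] := wG; have tf := weakly_AH_torsion_free wG.
have [H1 HM HV] := sH.
pose k := f 1; have fE n : f n = expgz k n.
  have f0 : f 0 = 1%g by apply: (@mulgI _ (f 0)); rewrite -fD addr0 mulg1.
  have fN q : f (- q) = (f q)^-1%g by apply/esym/mulg1_eq; rewrite -fD subrr f0.
  have fnat (m : nat) : f m%:Z = (k ^+ m)%g.
    by elim: m => [|m IH]; rewrite ?f0 // intS fD IH expgS.
  by case: n => q; rewrite ?NegzE ?fN fnat ?expgzN.
have Kk n : K (expgz k n) by rewrite -fK -fE; exists n.
have [x Hx x1] : exists2 x, H x & x <> 1%g.
  apply: contrapT => nx; apply: ntH; apply/seteqP; split=> [x Hx|_ ->//].
  by apply: contrapT => x1; apply: nx; exists x.
pose y := (x ^ k)%g; have Hy : H y by apply: nHK => //; exact: (Kk 1).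
have sub : [set` [:: x; y]] `<=` H.
  by move=> z /=; rewrite !inE => /orP[/eqP ->|/eqP ->].
have gx : gen_by [set` [:: x; y]] x by apply: sub_gen_by; rewrite /= mem_head.
have gy : gen_by [set` [:: x; y]] y by apply: sub_gen_by; rewrite /= !inE eqxx orbT.
have [|phi [pinj pD pR]] := lcH _ sub.
  by move=> tr; move: gx; rewrite tr => /= /x1.
have p0 : phi 0 = 1%g by apply: (@mulgI _ (phi 0)); rewrite -pD addr0 mulg1.
have pE a n : expgz (phi a) n = phi (a * n).
  have pN m : phi (- m) = (phi m)^-1%g by apply/esym/mulg1_eq; rewrite -pD subrr p0.
  have pnat (m : nat) : (phi a ^+ m)%g = phi (a * m%:Z).
    by elim: m => [|m IH]; rewrite ?mulr0 ?p0 // intS mulrDr mulr1 pD -IH expgS.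
  case: n => q; first exact: pnat.
  by rewrite NegzE mulrN pN -pnat expgzN.
move: gx gy; rewrite -pR => -[a _ ax] [b _ by_].
have nab : `|a| = `|b|.
  apply: (wAH x x1); exists k; rewrite -expgzJ -/y -ax -by_ !pE.
  by rewrite mulrC.
have xk2 : (x ^ (k * k))%g = x.
  rewrite conjgM -/y; have [ba|ba] := norm_eqz nab.
    have yx : y = x by rewrite -by_ ba ax.
    by rewrite yx -/y yx.
  have yV : y = x^-1%g.
    by rewrite -by_ ba -ax; apply/esym/mulg1_eq; rewrite -pD subrr p0.
  by rewrite yV conjVg -/y yV invgK.
have ck : commute x (k * k)%g.
  by rewrite /commute conjgC xk2.
have [m [n [mn e]]] := commensurable_of_no_Z2 nZ2 ck.
have kk : (k * k)%g = expgz k 2 by [].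
have Hm : H (expgz x m) by exact: subgroup_expgz.
have xm1 : expgz x m = 1%g.
  have : (H `&` K) (expgz x m) by split=> //; rewrite e kk -expgzM; exact: Kk.
  by rewrite HK.
apply: mn; congr pair.
  by apply: (expgz_inj tf x1); rewrite xm1.
have : f (2 * n) = f 0 by rewrite fE expgzM -kk -e xm1 fE.
by move=> /finj; lia.
Qed.

Lemma weakly_AH_not_CT : weakly_AH G -> ~ AH G -> ~ commutative_transitive G.
Proof.
move=> wG nAH ct; apply: nAH; split=> //; first exact: weakly_AH_torsion_free.
exact: weakly_AH_no_semidirect.
Qed.

Lemma CT_commute : commutative_transitive G ->
  forall x y z, y <> 1%g -> commute x y -> commute y z -> commute x z.
Proof.
move=> ct x y z y1 xy yz.
have [->|x1] := eqVneq x 1%g; first exact/commute_sym/commute1.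
have [->|z1] := eqVneq z 1%g; first exact: commute1.
apply/commgP/eqP; apply: (ct x y z) => //; try exact/eqP.
  exact/eqP/commgP.
exact/eqP/commgP.
Qed.
End WeaklyAH.

(** * AH groups are weakly AH *)

Section AHtoWeaklyAH.
Variable G : groupType.
Hypothesis AHG : AH G.
Implicit Types (x y g : G).

Let tf : torsion_free G. Proof. by case: AHG. Qed.
Let ct : commutative_transitive G. Proof. by case: AHG. Qed.

Lemma AH_no_semidirect (H K : set G) : subgroup H -> subgroup K ->
  (forall h k, H h -> K k -> H (h ^ k)%g) -> H `&` K = [set 1%g] ->
  ~ trivial_sub H -> locally_cyclic H -> isog_add int K -> False.
Proof.
move=> sH sK nHK HK ntH lcH iK; have [_ _ nsd] := AHG; apply: nsd.
by exists [set (h * k)%g | h in H & k in K], H, K; split=> //; exact: semidirect_product.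
Qed.

(** Z^2 is the semidirect product Z x| Z with trivial action. *)
Lemma AH_no_Z2 : no_Z2 G.
Proof.
move=> [_ [_ [f [finj fD _]]]].
have f0 : f 0 = 1%g by apply: (@mulgI _ (f 0)); rewrite -fD addr0 mulg1.
have fN u : f (- u) = (f u)^-1%g by apply/esym/mulg1_eq; rewrite -fD subrr f0.
have fX u (n : nat) : (f u ^+ n)%g = f (u *+ n).
  by elim: n => [|n IH]; rewrite ?f0 // expgS IH mulrS fD.
have fZ u n : expgz (f u) n = f (u *~ n).
  case: n => n; first exact: fX.
  by rewrite NegzE mulrNz fN -fX expgzN.
have pairM (u : int * int) n : u *~ n = (u.1 *~ n, u.2 *~ n).
  have nat_case (q : nat) : u *+ q = (u.1 *+ q, u.2 *+ q).
    by elim: q => // q IH; rewrite !mulrS IH; case: (u).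
  by case: n => q; rewrite ?NegzE ?mulrNz -?pmulrn nat_case.
have fC u v : commute (f u) (f v) by rewrite /commute -!fD addrC.
pose H := range (expgz (f (1, 0))); pose K := range (expgz (f (0, 1))).
have f10 : f (1, 0) <> 1%g by rewrite -f0 => /finj.
have f01 : f (0, 1) <> 1%g by rewrite -f0 => /finj.
apply: (@AH_no_semidirect H K).
- exact: cyclic_subgroup.
- exact: cyclic_subgroup.
- move=> _ _ [m _ <-] [n _ <-]; rewrite commute_conjg; first by exists m.
  exact: commute_expgz2.
- apply/seteqP; split=> [z [[m _ <-] [n _]]|_ ->]; last by split; exists 0.
  rewrite !fZ => /finj; rewrite !pairM /= => -[e _].
  by rewrite -e !mul0rz.
- by move=> tr; have : H (f (1, 0)) by [exists 1]; rewrite tr.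
- apply: rank1_locally_cyclic => //; first exact: cyclic_subgroup.
    by move=> _ _ [m _ <-] [n _ <-]; exact: expgzC.
  move=> _ _ [m _ <-] [n _ <-]; have [[m0 n0]|mn] := pselect ((m, n) = (0, 0)).
    by exists 1, 1; rewrite m0 n0.
  exists n, m; split; first by move=> [n0 m0]; apply: mn; rewrite m0 n0.
  by rewrite -!expgzM mulrC.
- exact: cyclic_isog.
Qed.

(** Suppose that x^n is the conjugate of x^m by g with |m| <> |n|.  The elements of
    the centraliser of x which have a power in <x> form a group H: it is abelian
    by commutative transitivity, of rank one, hence locally cyclic.  Conjugation
    by g and its inverse preserves H, because x^g commutes with x^n, hence with x.
    No power g^k with k <> 0 lies in H: it would commute with x, whereas it
    conjugates x^(m^k) to x^(n^k).  So H x| <g> contradicts AH. *)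
Lemma AH_weakly_AH : weakly_AH G.
Proof.
split; first exact: AH_no_Z2.
move=> x x1 m n [g e].
have [m0|m0] := eqVneq m 0.
  have xn : expgz x n = 1%g by rewrite e m0 expgz0 conj1g.
  have [->|n0] := eqVneq n 0; first by rewrite m0.
  by have := expgz_eq1 tf n0 xn.
have [n0|n0] := eqVneq n 0.
  move: e; rewrite n0 expgz0 => /esym/eqP; rewrite conjg_eq1 => /eqP e.
  by have := expgz_eq1 tf m0 e.
apply: contrapT => mn.
have cj y z : commute x y -> y <> 1%g -> commute y z -> commute x z.
  by move=> xy y1 yz; exact: CT_commute xy yz.
pose H := [set y | commute x y /\ exists a b : int, b != 0 /\ expgz y b = expgz x a].
have stable (h : G) (p q : int) : p != 0 -> q != 0 -> expgz x q = (expgz x p ^ h)%g ->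
    forall y, H y -> H (y ^ h)%g.
  move=> p0 q0 eh y [xy [a [b [b0 eb]]]].
  have xh1 : (x ^ h)%g <> 1%g by move=> /eqP; rewrite conjg_eq1 => /eqP.
  have xq1 : expgz x q <> 1%g by move=> /(expgz_eq1 tf q0).
  have xxh : commute x (x ^ h)%g.
    apply: (cj (expgz x q)) => //; first exact/commute_expgz.
    by rewrite eh -expgzJ; apply/commute_sym/commute_expgz.
  split; first by apply: (cj (x ^ h)%g) => //; exact: commute_conj.
  exists (q * a), (b * p); split; first by rewrite mulf_neq0.
  rewrite (expgzM (y ^ h)%g) expgzJ eb expgzJ -expgzM (mulrC a) (expgzM x p).
  by rewrite -expgzJ -eh -expgzM.
have sH : subgroup H.
  split; first by split; [exact: commute1 | exists 0, 1].
  - move=> y z [xy [a [b [b0 eb]]]] [xz [c [d [d0 ed]]]]; split; first exact: commuteM.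
    have yz : commute y z by apply: (CT_commute ct x1) => //; exact: commute_sym.
    exists (a * d + c * b), (b * d); split; first by rewrite mulf_neq0.
    by rewrite expgzMn // expgzM eb (mulrC b) expgzM ed -!expgzM -expgzD.
  - move=> y [xy [a [b [b0 eb]]]]; split; first exact: commuteV.
    by exists (- a), b; split=> //; rewrite expgzV eb expgzN.
have g1 : g <> 1%g.
  by move=> g1; apply: mn; move: e; rewrite g1 conjg1 => /(expgz_inj tf x1) ->.
pose K := range (expgz g).
have stg : forall y, H y -> H (y ^ g)%g := stable g m n m0 n0 e.
have stgV : forall y, H y -> H (y ^ g^-1)%g.
  by apply: (stable g^-1%g n m) => //; rewrite e conjgK.
have nHK h k : H h -> K k -> H (h ^ k)%g.
  move=> Hh [i _ <-]; have st_nat u (j : nat) : (forall y, H y -> H (y ^ u)%g) -> H (h ^ (u ^+ j))%g.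
    move=> su; elim: j => [|j IH]; first by rewrite expg0 conjg1.
    by rewrite expgSr conjgM; exact: su.
  by case: i => j /=; rewrite -?expVgn; exact: st_nat.
have iter_conj (k : nat) : (expgz x (m ^+ k) ^ (g ^+ k))%g = expgz x (n ^+ k).
  elim: k => [|k IH]; first by rewrite expg0 conjg1.
  rewrite exprSr expgzM expgSr conjgM -expgzJ IH -expgzM mulrC expgzM -expgzJ.
  by rewrite -e -expgzM -exprS.
have HK1 (k : nat) : H (g ^+ k)%g -> k = 0%N.
  move=> [xg _]; have := iter_conj k; rewrite commute_conjg.
    move=> /(expgz_inj tf x1) /(congr1 Num.norm); rewrite !normrX => ek.
    case: k ek {xg} => // k ek; exfalso; apply: mn.
    by apply/eqP; rewrite -(eqrXn2 (n := k.+1)) // ek.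
  by apply/commute_sym/commute_expgz/commute_sym.
apply: (@AH_no_semidirect H K) => //.
- exact: cyclic_subgroup.
- apply/seteqP; split=> [z [Hg [k _ ek]]|_ ->]; last by have [H11 _ _] := sH; split=> //; exists 0.
  rewrite -ek in Hg *; case: k Hg {ek} => k /=; first by move=> /HK1 ->.
  move=> Hg; have [_ _ HV] := sH; have := HV _ Hg; rewrite invgK => /HK1 //.
- move=> tr; have : H x by split=> //; exists 1, 1.
  by rewrite tr.
- apply: rank1_locally_cyclic => //.
    by move=> y z [xy _] [xz _]; apply: (CT_commute ct x1) => //; exact: commute_sym.
  move=> y z [xy [a [b [b0 eb]]]] [xz [c [d [d0 ed]]]].
  have [a0|a0] := eqVneq a 0; last first.
    exists (b * c), (d * a); split; first by move=> [_ /eqP]; rewrite mulf_eq0 (negbTE d0) (negbTE a0).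
    by rewrite !expgzM eb ed -!expgzM mulrC.
  exists 1, 0; split=> //; rewrite expgz1 expgz0; apply: (expgz_eq1 tf b0).
  by rewrite eb a0.
- exact: cyclic_isog.
Qed.
End AHtoWeaklyAH.

(** * Quotient by a central cyclic subgroup, and the transfer *)

(** A subgroup bundled with its closure proof, so that the type of its elements
    can carry a canonical group structure. *)
Record subgrp (G : groupType) := SubGrp {
  subgrp_set :> G -> Prop;
  subgrpP : subgroup (subgrp_set : set G) }.

Section SubgroupType.
Variables (G : groupType) (H : subgrp G).
Definition subgrp_pred : {pred G} := [pred x | `[< H x >]].
Lemma subgrp_predP x : reflect (H x) (x \in subgrp_pred).
Proof. exact: asboolP. Qed.
Lemma subgrp_closed : group_closed subgrp_pred.
Proof.
have [H1 HM HV] := subgrpP H; split; first exact/subgrp_predP.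
by move=> x y /subgrp_predP hx /subgrp_predP hy; apply/subgrp_predP/HM => //; exact: HV.
Qed.
Record subgrpt := SubGrpElt { sgval : G; _ : sgval \in subgrp_pred }.
HB.instance Definition _ := [isSub for sgval].
HB.instance Definition _ := [Choice of subgrpt by <:].
HB.instance Definition _ := SubChoice_isSubGroup.Build G subgrp_pred subgrpt subgrp_closed.

Lemma sgvalP (x : subgrpt) : H (sgval x).
Proof. by case: x => x /= /subgrp_predP. Qed.
Definition tosubgrp (x : G) (h : H x) : subgrpt := SubGrpElt (introT (subgrp_predP x) h).
Lemma sgval_inj : injective sgval. Proof. exact: val_inj. Qed.
Lemma sgvalM : {morph sgval : x y / (x * y)%g}. Proof. exact: (valM (H := subgrpt)). Qed.
End SubgroupType.

Section CentralQuotient.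
Variables (A : groupType) (h : A).
(** The quotient by the central subgroup <h> is represented by one chosen element
    in each coset; [crep] is this choice. *)
Record coset_choice := CosetChoice {
  crep :> A -> A;
  crep_rel : forall a, exists n, a = (crep a * expgz h n)%g;
  crep_inv : forall a n, crep (a * expgz h n)%g = crep a;
  crep_central : forall a, commute h a }.

Variable c : coset_choice.
Record cquo := CQuo { qval : A; _ : c qval == qval }.
HB.instance Definition _ := [isSub for qval].
HB.instance Definition _ := [Choice of cquo by <:].

Lemma crep_idem a : c (c a) == c a.
Proof. by have [n e] := crep_rel c a; rewrite {2}e crep_inv. Qed.
Definition qproj a : cquo := CQuo (crep_idem a).
Lemma qvalK x : qproj (qval x) = x.
Proof. by apply: val_inj; case: x => a /= /eqP. Qed.

Lemma qproj_eq a b : qproj a = qproj b <-> exists n, a = (b * expgz h n)%g.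
Proof.
split=> [/(congr1 qval) /= e|[n ->]]; last by apply: val_inj; rewrite /= crep_inv.
have [n ea] := crep_rel c a; have [m eb] := crep_rel c b.
have eb' : c b = (b * expgz h (- m))%g by rewrite {2}eb -mulgA -expgzD subrr mulg1.
by exists (n - m); rewrite [LHS]ea e eb' -mulgA -expgzD addrC.
Qed.

Let hC a n : commute (expgz h n) a.
Proof. exact/commute_sym/commute_expgz/commute_sym/(crep_central c). Qed.

Definition qmul x y := qproj (qval x * qval y)%g.
Definition qinv x := qproj (qval x)^-1%g.

Lemma mul_mod_central u v n m :
  (u * expgz h n * (v * expgz h m))%g = (u * v * expgz h (n + m))%g.
Proof. by rewrite -!mulgA; congr (u * _)%g; rewrite mulgA hC -mulgA -expgzD. Qed.

Lemma qmulE a b : qmul (qproj a) (qproj b) = qproj (a * b)%g.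
Proof.
have [n ea] := crep_rel c a; have [m eb] := crep_rel c b.
apply/esym/qproj_eq; exists (n + m).
by rewrite /= -mul_mod_central -ea -eb.
Qed.

Lemma qinvE a : qinv (qproj a) = qproj a^-1%g.
Proof.
have [n ea] := crep_rel c a; apply/esym/qproj_eq; exists (- n).
by rewrite {1}ea invgM -expgzN hC.
Qed.

Lemma qmulA : associative qmul.
Proof.
move=> x y z; rewrite -(qvalK x) -(qvalK y) -(qvalK z).
by rewrite !qmulE mulgA.
Qed.
Lemma qmul1 : left_id (qproj 1%g) qmul.
Proof. by move=> x; rewrite -(qvalK x) qmulE mul1g. Qed.
Lemma qmul1r : right_id (qproj 1%g) qmul.
Proof. by move=> x; rewrite -(qvalK x) qmulE mulg1. Qed.
Lemma qmulV : left_inverse (qproj 1%g) qinv qmul.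
Proof. by move=> x; rewrite -(qvalK x) qinvE qmulE mulVg. Qed.
Lemma qmulVr : right_inverse (qproj 1%g) qinv qmul.
Proof. by move=> x; rewrite -(qvalK x) qinvE qmulE mulgV. Qed.
HB.instance Definition _ := isGroup.Build cquo qmulA qmul1 qmul1r qmulV qmulVr.

Lemma qprojM : {morph qproj : x y / (x * y)%g}.
Proof. by move=> x y; rewrite -qmulE. Qed.
Lemma qproj_surj : range qproj = [set: cquo].
Proof. by apply/seteqP; split=> // x _; exists (qval x) => //; exact: qvalK. Qed.
Lemma qproj1 a : qproj a = 1%g <-> exists n, a = expgz h n.
Proof.
split=> [/qproj_eq[n ->]|[n ->]]; first by exists n; rewrite mul1g.
by apply/qproj_eq; exists n; rewrite mul1g.
Qed.
Lemma qproj_kernel : [set a | qproj a = 1%g] = gen_by [set h].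
Proof.
rewrite gen_by1; apply/seteqP; split=> [a /qproj1[n ->]|_ [n _ <-]]; first by exists n.
by apply/qproj1; exists n.
Qed.
End CentralQuotient.

(** The choice depends only on the coset as a predicate, and the cosets of a and
    of a h^n are equal predicates by extensionality. *)
Lemma central_coset_choice (A : groupType) (h : A) :
  (forall a, commute h a) -> inhabited (coset_choice h).
Proof.
move=> hc; pose orb (a b : A) := exists n, b = (a * expgz h n)%g.
have orb_act a n : orb (a * expgz h n)%g = orb a.
  apply/funext => b; apply/propext; split=> [[m ->]|[m ->]].
    by exists (n + m); rewrite expgzD mulgA.
  by exists (m - n); rewrite -mulgA -expgzD addrC subrK.
pose rep a := if pselect (exists b, orb a b) is left e then projT1 (cid e) else a.
have orbP a : exists b, orb a b by exists a, 0; rewrite expgz0 mulg1.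
constructor; apply: (@CosetChoice A h rep) => //.
  move=> a; rewrite /rep; case: pselect => [e|[]]; last exact: orbP.
  case: (cid e) => b /= ob; have [n ->] := ob; exists (- n).
  by rewrite -mulgA -expgzD subrr mulg1.
move=> a n; rewrite /rep orb_act; case: pselect => // -[]; exact: orbP.
Qed.

(** Multiplying the chosen representative of a coset t by a gives the
    representative of a t times a power of h.  The sum V a over all t of these
    exponents is the transfer of a to <h>; it is a homomorphism to Z, so it
    vanishes on commutators, and V h is the index.  A commutator has a non-zero
    power h^n, of transfer n V h = 0, so n = 0 and the commutator is torsion. *)
Lemma finite_central_quotient_abelian (A : groupType) (h : A) (c : coset_choice h) :
  torsion_free A -> h <> 1%g -> finite_set [set: cquo c] ->
  (forall a, exists2 m, m != 0 & exists n, expgz a m = expgz h n) ->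
  forall a b : A, commute a b.
Proof.
move=> tf h1 /finite_seqP[s0 es0] hroot.
pose s := undup s0; have us : uniq s by exact: undup_uniq.
have sT t : t \in s.
  have : [set: cquo c] t by [].
  by rewrite es0 /= mem_undup.
have /choice[z0 z0P] : forall at_ : A * cquo c, exists n,
    (at_.1 * qval at_.2 = qval (qproj c at_.1 * at_.2)%g * expgz h n)%g.
  move=> [a t] /=; have : qproj c (a * qval t)%g = qproj c (qval (qproj c a * t)%g).
    by rewrite qvalK qprojM qvalK.
  by move=> /qproj_eq[n ->]; exists n.
pose z a t := z0 (a, t).
have zP a t : (a * qval t)%g = (qval (qproj c a * t)%g * expgz h (z a t))%g by exact: (z0P (a, t)).
have zM a b t : z (a * b)%g t = z a (qproj c b * t)%g + z b t.
  apply: (expgz_inj tf h1); apply: (@mulgI _ (qval (qproj c (a * b)%g * t)%g)).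
  rewrite -zP -mulgA zP mulgA zP -mulgA -expgzD qprojM mulgA //.
pose V a := \sum_(t <- s) z a t.
have VM a b : V (a * b)%g = V a + V b.
  rewrite /V (eq_bigr _ (fun t _ => zM a b t)) big_split /=; congr (_ + _).
  rewrite -(big_map (fun t => (qproj c b * t)%g) xpredT (z a)); apply: perm_big.
  apply: uniq_perm => //; first by rewrite map_inj_uniq //; exact: mulgI.
  move=> t; rewrite sT; apply/mapP; exists ((qproj c b)^-1 * t)%g => //.
  by rewrite mulgA mulgV mul1g.
have V1 : V 1%g = 0 by apply: (@addrI _ (V 1%g)); rewrite -VM mulg1 addr0.
have VV a : V a^-1%g = - V a.
  by apply/eqP; rewrite -subr_eq0 opprK addrC -VM mulgV V1.
have VX a n : V (expgz a n) = V a * n.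
  have nat_case (m : nat) : V (a ^+ m)%g = V a * m%:Z.
    by elim: m => [|m IH]; rewrite ?mulr0 // expgS VM IH intS mulrDr mulr1.
  by case: n => n; rewrite ?NegzE /= ?VV nat_case // mulrN.
have Vh : V h != 0.
  have zh t : z h t = 1.
    apply: (expgz_inj tf h1); apply: (@mulgI _ (qval (qproj c h * t)%g)).
    have -> : qproj c h = 1%g by apply/qproj1; exists 1.
    have := zP h t; have -> : qproj c h = 1%g by apply/qproj1; exists 1.
    by rewrite mul1g => <-; rewrite (crep_central c).
  rewrite /V (eq_bigr _ (fun t _ => zh t)) big_const_seq count_predT iter_addr_0.
  have : 1%g \in s by exact: sT.
  by case: (s) => //= t s' _; rewrite pnatr_eq0.
move=> a b; apply/commgP/eqP.
have VR : V [~ a, b]%g = 0 by rewrite /commg /conjg !VM !VV; lia.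
have [m m0 [n e]] := hroot [~ a, b]%g.
have : V (expgz [~ a, b]%g m) = 0 by rewrite VX VR mul0r.
rewrite e VX => /eqP; rewrite mulf_eq0 (negbTE Vh) /= => /eqP n0.
by apply: (expgz_eq1 tf m0); rewrite e n0.
Qed.

(** * Adian extensions and commutative transitivity *)

(** By commutativity every element is a product of a bounded power of the first
    generator and an element generated by the others. *)
Lemma fg_abelian_torsion_finite (T : groupType) (s : seq T) :
  (forall x y : T, commute x y) -> torsion T -> finite_set (gen_by [set` s]).
Proof.
move=> ab tor; elim: s => [|x s IH].
  apply: (@sub_finite_set _ _ [set 1%g]); last exact: finite_set1.
  apply: gen_by_min => //; split=> // [x y -> ->|x ->]; first by rewrite /= mulg1.
  by rewrite /= invg1.
have [n n0 xn] := tor x; have sg := gen_by_subgroup [set` s]; have [s1 sM sV] := sg.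
pose P := [set (y.1 * y.2)%g | y in [set (x ^+ i)%g | i in `I_n] `*` gen_by [set` s]].
have inP i y : gen_by [set` s] y -> P (x ^+ i * y)%g.
  move=> gy; exists ((x ^+ (i %% n))%g, y) => /=; last first.
    by rewrite {2}(divn_eq i n) expgnDr mulnC expgnA xn expg1n mul1g.
  by split=> //; exists (i %% n)%N => //=; rewrite ltn_mod.
apply: (@sub_finite_set _ _ P); last first.
  apply: finite_image; apply: finite_setX => //.
  by apply: finite_image; exact: finite_II.
apply: gen_by_min; last first.
  move=> y /=; rewrite inE => /orP[/eqP ->|ys].
    by rewrite -[x]mulg1 -{1}(expg1 x); exact: inP.
  by rewrite -[y]mul1g -(expg0 x); apply: inP; exact: sub_gen_by.
split.
- by rewrite -[1%g]mulg1 -{1}(expg0 x); exact: inP.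
- move=> _ _ [[_ y] [[i _ <-] /= gy] <-] [[_ z] [[j _ <-] /= gz] <-] /=.
  rewrite -mulgA (mulgA y) (ab y) -mulgA mulgA -expgnDr; apply: inP; exact: sM.
move=> _ [[_ y] [[i _ <-] /= gy] <-] /=; rewrite invgM (ab y^-1%g).
suff -> : (x ^- i = x ^+ (i * n.-1))%g by apply: inP; exact: sV.
by apply: mulg1_eq; rewrite -expgnDr -mulnS prednK // mulnC expgnA xn expg1n.
Qed.

(** The kernel <c> is normal, so conjugation by a maps c to c^m; as a power c^j
    of c with j <> 0 is also a power of a, it is fixed, whence m = 1 and c is
    central.  Commutative transitivity through c then makes A abelian, and the
    torsion quotient, being finitely generated abelian, is finite. *)
Lemma Adian_not_CT (A : groupType) : Adian_extension A -> ~ commutative_transitive A.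
Proof.
move=> [[s gs] tf [T [p [pM psurj Tinf Ttor [c kerc]]]]] ct.
have p1 : p 1%g = 1%g by apply: (@mulgI _ (p 1%g)); rewrite -pM !mulg1.
have pV x : p x^-1%g = (p x)^-1%g by apply/esym/mulg1_eq; rewrite -pM mulgV p1.
have pX x n : p (x ^+ n)%g = (p x ^+ n)%g.
  by elim: n => [|n IH]; rewrite ?p1 // !expgS pM IH.
have kerP a : p a = 1%g <-> exists n, a = expgz c n.
  split=> [pa|[n ->]].
    have : [set a | p a = 1%g] a by [].
    by rewrite kerc gen_by1 => -[n _ <-]; exists n.
  have : gen_by [set c] (expgz c n) by rewrite gen_by1; exists n.
  by rewrite -kerc.
have root a : exists2 n : nat, (0 < n)%N & exists m, (a ^+ n)%g = expgz c m.
  have [n n0 pn] := Ttor (p a); exists n => //.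
  by apply/kerP; rewrite pX.
have c1 : c <> 1%g.
  move=> c1; apply: Tinf; apply: (@sub_finite_set _ _ [set 1%g]); last exact: finite_set1.
  move=> t _; have : [set: T] t by []. rewrite -psurj => -[a _ <-] /=.
  have [n n0 [m]] := root a; rewrite c1 expgz1g => /(tf _ _ n0) ->; exact: p1.
have cC a : commute c a.
  have [->|/eqP a1] := eqVneq a 1%g; first exact: commute1.
  have [n n0 [j e]] := root a.
  have j0 : j != 0 by apply/eqP => j0; apply: a1; apply: (tf _ _ n0); rewrite e j0.
  have [m em] : exists m, (c ^ a)%g = expgz c m.
    apply/kerP; rewrite /conjg !pM pV.
    have -> : p c = 1%g by apply/kerP; exists 1.
    by rewrite mul1g mulVg.
  have : expgz c (m * j) = expgz c j.
    rewrite expgzM -em expgzJ -e commute_conjg //.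
    by apply/commute_sym/commuteX.
  move=> /(expgz_inj tf c1)/eqP; rewrite -[X in _ == X]mul1r => /eqP/(mulIf j0) m1.
  by rewrite /commute conjgC em m1.
have Aab (a b : A) : commute a b.
  by apply: (CT_commute ct c1); [exact/commute_sym/cC | exact: cC].
have Tab (x y : T) : commute x y.
  have [a pa] : exists a, p a = x by have : [set: T] x by []; rewrite -psurj => -[a _ <-]; exists a.
  have [b pb] : exists b, p b = y by have : [set: T] y by []; rewrite -psurj => -[b _ <-]; exists b.
  by rewrite -pa -pb /commute -!pM Aab.
apply: Tinf; have := fg_abelian_torsion_finite (map p s) Tab Ttor.
apply: sub_finite_set => t _; have : [set: T] t by [].
rewrite -psurj => -[a _ <-]; have [g1 gM gV] := gen_by_subgroup [set` map p s].
have : gen_by [set` s] a by rewrite gs.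
suff : gen_by [set` s] `<=` p @^-1` gen_by [set` map p s] by apply.
apply: gen_by_min; last by move=> b /= bs; apply: sub_gen_by; exact: map_f.
split=> /=; first by rewrite p1.
- by move=> x y hx hy; rewrite pM; exact: gM.
- by move=> x hx; rewrite pV; exact: gV.
Qed.

Lemma embeds_CT (A G : groupType) : embeds A G ->
  commutative_transitive G -> commutative_transitive A.
Proof.
move=> [f [finj fM]] ct x y z x1 y1 z1 /eqP/commgP xy /eqP/commgP yz.
have f1 : f 1%g = 1%g by apply: (@mulgI _ (f 1%g)); rewrite -fM !mulg1.
have fne a : a <> 1%g -> f a <> 1%g by move=> a1; rewrite -f1 => /finj.
apply/eqP/commgP/finj; rewrite !fM; apply: (CT_commute ct (fne _ y1)).
  by rewrite /commute -!fM xy.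
by rewrite /commute -!fM yz.
Qed.

(** A failure of commutative transitivity gives h <> 1 commuting with g and k,
    where g and k do not commute.  The Adian extension is <g, h, k>, and the
    kernel of its map to a torsion group is <h>. *)
Lemma not_CT_Adian (G : groupType) : torsion_free G -> no_Z2 G ->
  ~ commutative_transitive G -> exists A, Adian_extension A /\ embeds A G.
Proof.
move=> tf nZ2 nct.
have [[[g h] k] /= [h1 gh hk gk]] : exists t : G * G * G,
    [/\ t.1.2 <> 1%g, commute t.1.1 t.1.2, commute t.1.2 t.2 & ~ commute t.1.1 t.2].
  apply: contrapT => nt; apply: nct => g h k _ h1 _ /eqP/commgP gh /eqP/commgP hk.
  by apply/eqP/commgP; apply: contrapT => gk; apply: nt; exists (g, h, k).
pose s := [:: g; h; k]; pose H := SubGrp (gen_by_subgroup [set` s]).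
have Hs x : x \in s -> H x by move=> xs; exact: sub_gen_by.
pose A : groupType := subgrpt H.
have Hg : H g by apply: Hs; rewrite mem_head.
have Hh : H h by apply: Hs; rewrite !inE eqxx orbT.
have Hk : H k by apply: Hs; rewrite !inE eqxx !orbT.
pose g' : A := tosubgrp Hg; pose h' : A := tosubgrp Hh; pose k' : A := tosubgrp Hk.
have vM (x y : A) : sgval (x * y)%g = (sgval x * sgval y)%g by exact: sgvalM.
have v1 : sgval (1%g : A) = 1%g by apply: (@mulgI _ (sgval (1%g : A))); rewrite -vM !mulg1.
have vV (x : A) : sgval x^-1%g = (sgval x)^-1%g.
  by apply/esym/mulg1_eq; rewrite -vM mulgV.
have vX (x : A) n : sgval (x ^+ n)%g = (sgval x ^+ n)%g.
  by elim: n => [|n IH]; rewrite ?expg0 // !expgS vM IH.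
have vZ (x : A) n : sgval (expgz x n) = expgz (sgval x) n.
  by case: n => n /=; rewrite ?vV vX.
have vinj : injective (@sgval _ H) by exact: sgval_inj.
have tfA : torsion_free A.
  by move=> x n n0 e; apply: vinj; rewrite v1; apply: (tf _ _ n0); rewrite -vX e.
have hc (a : A) : commute h' a.
  apply: vinj; rewrite !vM /=; have := sgvalP a.
  suff : gen_by [set` s] `<=` [set y | commute h y] by apply.
  apply: gen_by_min; first exact: centraliser_subgroup.
  by move=> y; rewrite /= !inE => /or3P[] /eqP -> //; exact: commute_sym.
have h'1 : h' <> 1%g by move=> /(congr1 (@sgval _ _)); rewrite v1 => /h1.
have root (a : A) : exists2 m, m != 0 & exists n, expgz a m = expgz h' n.
  have [m [n [mn e]]] : commensurable_elts (sgval a) h.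
    apply: commensurable_of_no_Z2 => //.
    by have := congr1 (@sgval _ _) (hc a); rewrite !vM => /esym.
  exists m; last by exists n; apply: vinj; rewrite !vZ.
  apply/eqP => m0; apply: mn; rewrite m0; congr pair.
  by apply: (expgz_inj tf h1); rewrite -e m0.
have [c] := central_coset_choice hc.
exists A; split; last by exists (@sgval _ H); split.
split=> //.
- exists [:: g'; h'; k']; apply/seteqP; split=> // a _.
  have gP := gen_by_subgroup [set` [:: g'; h'; k']]; have [p1 pM pV] := gP.
  pose B := [set x : G | exists2 y : A, sgval y = x & gen_by [set` [:: g'; h'; k']] y].
  have [y /vinj <- //] : B (sgval a).
  have := sgvalP a; apply: gen_by_min.
    split; first by exists 1%g.
    - by move=> _ _ [x <- gx] [y <- gy]; exists (x * y)%g => //; exact: pM.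
    - by move=> _ [x <- gx]; exists x^-1%g => //; exact: pV.
  move=> y; rewrite /= !inE => /or3P[] /eqP ->.
  + by exists g' => //; apply: sub_gen_by; rewrite /= mem_head.
  + by exists h' => //; apply: sub_gen_by; rewrite /= !inE eqxx orbT.
  + by exists k' => //; apply: sub_gen_by; rewrite /= !inE eqxx !orbT.
exists (cquo c), (qproj c); split.
- exact: qprojM.
- exact: qproj_surj.
- move=> fin; apply: gk.
  have := finite_central_quotient_abelian tfA h'1 fin root g' k'.
  by move=> /(congr1 (@sgval _ _)); rewrite !vM.
- move=> x; rewrite -(qvalK x); have [m m0 [n e]] := root (qval x).
  have qX (y : cquo c) (i : nat) a : y = qproj c a -> (y ^+ i)%g = qproj c (a ^+ i)%g.
    by move=> ->; elim: i => [|i IH] //; rewrite !expgS IH qprojM.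
  case: m m0 e => [m|m] m0 /= e.
    exists m; first by case: (m) m0.
    by rewrite (qX _ _ (qval x)) //; apply/qproj1; exists n.
  exists m.+1 => //; rewrite (qX _ _ (qval x)) //; apply/qproj1; exists (- n).
  by rewrite expgzN -e invgK.
- by exists h'; exact: qproj_kernel.
Qed.

(** * Free abelian groups and augmented chains of tuples *)

Section FreeAbelian.
Variable X : choiceType.
Definition chain : zmodType := {freeg X / int}.
Definition gen (x : X) : chain := Freeg [:: (1, x)].
(** The linear extension to chains of a function on generators.  Free
    abelian groups are evaluated in modules, hence the detour through the Z-module
    underlying M. *)
Definition linext (M : zmodType) (f : X -> M) (z : chain) : M :=
  @fglift int (zmodule M) X f z.

Lemma ext_additive (M : zmodType) (f : X -> M) : additive (linext f).
Proof. exact: (@lift_is_additive int X (zmodule M) f). Qed.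
HB.instance Definition _ (M : zmodType) (f : X -> M) :=
  GRing.isAdditive.Build chain M (linext f) (ext_additive f).

Lemma ext_gen (M : zmodType) (f : X -> M) x : linext f (gen x) = f x.
Proof. by rewrite /linext /gen liftU scale1r. Qed.

(** The subgroup generated by the generators satisfying P.  Being inductive, it is
    used both for the supports of chains and as an induction principle. *)
Inductive gspan (P : X -> Prop) : chain -> Prop :=
| gspan0 : gspan P 0
| gspan_addgen z x : gspan P z -> P x -> gspan P (z + gen x)
| gspan_subgen z x : gspan P z -> P x -> gspan P (z - gen x).

Lemma gspanD P z w : gspan P z -> gspan P w -> gspan P (z + w).
Proof.
move=> hz; elim=> [|{}w x _ IH Px|{}w x _ IH Px]; first by rewrite addr0.
  by rewrite addrA; apply: gspan_addgen.
by rewrite addrA; apply: gspan_subgen.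
Qed.

Lemma gspanN P z : gspan P z -> gspan P (- z).
Proof.
elim=> [|{}z x _ IH Px|{}z x _ IH Px]; first by rewrite oppr0; apply: gspan0.
  by rewrite opprD; apply: gspan_subgen.
by rewrite opprB addrC; apply: gspan_addgen.
Qed.

Lemma gspanB P z w : gspan P z -> gspan P w -> gspan P (z - w).
Proof. by move=> hz hw; apply: gspanD => //; apply: gspanN. Qed.

Lemma gspan_gen (P : X -> Prop) x : P x -> gspan P (gen x).
Proof. by move=> Px; rewrite -[gen x]add0r; apply: gspan_addgen (gspan0 _) _. Qed.

Lemma gspan_closed (P : X -> Prop) (Q : chain -> Prop) :
  Q 0 -> (forall z w, Q z -> Q w -> Q (z - w)) ->
  (forall x, P x -> Q (gen x)) -> forall z, gspan P z -> Q z.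
Proof.
move=> Q0 QB Qg z; elim=> [//|{}z x _ IH Px|{}z x _ IH Px].
  by rewrite -[gen x]opprK -[- gen x]add0r; apply/QB/QB/Qg.
exact/QB/Qg.
Qed.

Lemma gspan_sub (P Q : X -> Prop) : (forall x, P x -> Q x) ->
  forall z, gspan P z -> gspan Q z.
Proof.
move=> PQ; apply: gspan_closed; first exact: gspan0.
- by move=> z w; exact: gspanB.
- by move=> x /PQ; exact: gspan_gen.
Qed.

Lemma gspanT z : gspan (fun=> True) z.
Proof.
rewrite -[z](freeg_sumE z); elim: (dom z) => [|x s IH].
  by rewrite big_nil; exact: gspan0.
rewrite big_cons; apply: gspanD => //.
have e (k : int) : Freeg [:: (k, x)] = gen x *~ k by rewrite freegU_mulz intz.
rewrite e; case: (coeff x z) => n.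
  rewrite -pmulrn; elim: n => [|n IHn]; first by rewrite mulr0n; exact: gspan0.
  by rewrite mulrSr; apply: gspan_addgen.
rewrite NegzE -nmulrn; apply: gspanN.
elim: n.+1 => [|k IHk]; first by rewrite mulr0n; exact: gspan0.
by rewrite mulrSr; apply: gspan_addgen.
Qed.

Lemma eq_ext_span (P : X -> Prop) (M : zmodType) (f g : {additive chain -> M}) :
  (forall x, P x -> f (gen x) = g (gen x)) ->
  forall z, gspan P z -> f z = g z.
Proof.
move=> fg; apply: gspan_closed => [|z w ez ew|x /fg //]; first by rewrite !raddf0.
by rewrite !raddfB ez ew.
Qed.

Lemma eq_additive (M : zmodType) (f g : {additive chain -> M}) :
  (forall x, f (gen x) = g (gen x)) -> f =1 g.
Proof. by move=> fg z; apply: (eq_ext_span (P := fun=> True)) (gspanT z). Qed.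

Lemma eq_ext (P : X -> Prop) (M : zmodType) (f g : X -> M) :
  (forall x, P x -> f x = g x) -> forall z, gspan P z -> linext f z = linext g z.
Proof. by move=> fg z; apply: eq_ext_span => x /fg; rewrite /= !ext_gen. Qed.
End FreeAbelian.

Lemma gspan_ext (X Y : choiceType) (P : X -> Prop) (Q : Y -> Prop)
    (f : {additive chain X -> chain Y}) :
  (forall x, P x -> gspan Q (f (gen x))) -> forall z, gspan P z -> gspan Q (f z).
Proof.
move=> PQ; apply: gspan_closed; first by rewrite raddf0; exact: gspan0.
  by move=> z w; rewrite raddfB; exact: gspanB.
by [].
Qed.

Section Boundary.
Variable X : choiceType.
Implicit Types (x : X) (s : seq X) (z : chain (seq X)).

Definition cone x : chain (seq X) -> chain (seq X) := linext (fun s => gen (x :: s)).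
HB.instance Definition _ x := GRing.Additive.on (cone x).

(** The alternating sum of faces, written recursively as
    d(x :: s) = s - x . d s.  The empty tuple is the generator in degree -1, so
    the complex is augmented and a tuple of size n has degree n - 1. *)
Fixpoint bd1 s : chain (seq X) :=
  if s is x :: s' then gen s' - cone x (bd1 s') else 0.
Definition bd : chain (seq X) -> chain (seq X) := linext bd1.
HB.instance Definition _ := GRing.Additive.on bd.

Lemma cone_gen x s : cone x (gen s) = gen (x :: s).
Proof. exact: ext_gen. Qed.

Lemma bd_nil : bd (gen [::]) = 0.
Proof. by rewrite /bd ext_gen. Qed.

Lemma bd_cons x s : bd (gen (x :: s)) = gen s - cone x (bd (gen s)).
Proof. by rewrite /bd !ext_gen. Qed.

Lemma bd_cone x z : bd (cone x z) = z - cone x (bd z).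
Proof.
pose f : {additive chain (seq X) -> chain (seq X)} := bd \o cone x.
pose g : {additive chain (seq X) -> chain (seq X)} := idfun \- (cone x \o bd).
apply: (eq_additive (f := f) (g := g)) => s; rewrite /f /g /=.
by rewrite cone_gen bd_cons.
Qed.

Lemma bd_bd z : bd (bd z) = 0.
Proof.
pose f : {additive chain (seq X) -> chain (seq X)} := bd \o bd.
pose g : {additive chain (seq X) -> chain (seq X)} := \0.
apply: (eq_additive (f := f) (g := g)) => s; rewrite /f /g /=.
elim: s => [|x s IH]; first by rewrite bd_nil raddf0.
by rewrite bd_cons raddfB /= bd_cone IH raddf0 subr0 subrr.
Qed.

End Boundary.
Arguments bd {X} _.

(** * Barycentric subdivision and acyclicity *)

Lemma bd_span (X : choiceType) (s : seq X) :
  gspan (fun t => subseq t s /\ size t = (size s).-1) (bd (gen s)).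
Proof.
elim: s => [|x s IH]; first by rewrite bd_nil; exact: gspan0.
rewrite bd_cons; apply: gspanB.
  by apply: gspan_gen; split => //; exact: subseq_cons.
case: s IH => [|y s] IH; first by rewrite bd_nil raddf0; exact: gspan0.
move: IH; apply: gspan_ext => t [st et]; rewrite /= cone_gen; apply: gspan_gen.
by split; [rewrite /= eqxx | rewrite /= et].
Qed.

Section Recursion.
Variables (X Y : choiceType) (init : chain (seq Y)).
Variable step : seq X -> chain (seq Y) -> chain (seq Y).

(** Recursion along faces: the value at s is computed from s and from the value
    of the linear extension on the boundary of s.  All chain maps and homotopies
    below are built in this way; [n] is fuel. *)
Fixpoint bd_recn n (s : seq X) : chain (seq Y) :=
  match n, s with
  | n'.+1, _ :: _ => step s (linext (bd_recn n') (bd (gen s)))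
  | _, _ => init
  end.
Definition bd_rec s := bd_recn (size s) s.

Lemma bd_rec_nil : bd_rec [::] = init. Proof. by []. Qed.

Lemma bd_rec_cons s : s <> [::] -> bd_rec s = step s (linext bd_rec (bd (gen s))).
Proof.
case: s => // x s _; rewrite /bd_rec /=; congr (step _ _).
apply: (eq_ext (P := fun t => subseq t (x :: s) /\ size t = size s)).
  by move=> t [_ ->].
exact: (bd_span (x :: s)).
Qed.
End Recursion.

Section Subdivision.
Variables (Y : choiceType) (b : seq Y -> Y).
Implicit Types (s t : seq Y) (z w : chain (seq Y)).

(** With b s a point such as the barycentre of s: the subdivision S is the cone
    b s . S(d s), and the homotopy T between S and the identity is
    b s . (s - T(d s)). *)
Definition sd : chain (seq Y) -> chain (seq Y) :=
  linext (bd_rec (gen [::]) (fun s w => cone (b s) w)).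
Definition sd_htpy : chain (seq Y) -> chain (seq Y) :=
  linext (bd_rec 0 (fun s w => cone (b s) (gen s - w))).
HB.instance Definition _ := GRing.Additive.on sd.
HB.instance Definition _ := GRing.Additive.on sd_htpy.

Lemma sd_nil : sd (gen [::]) = gen [::].
Proof. by rewrite /sd ext_gen bd_rec_nil. Qed.
Lemma sd_gen s : s <> [::] -> sd (gen s) = cone (b s) (sd (bd (gen s))).
Proof. by move=> s0; rewrite /sd ext_gen bd_rec_cons. Qed.
Lemma sd_htpy_nil : sd_htpy (gen [::]) = 0.
Proof. by rewrite /sd_htpy ext_gen bd_rec_nil. Qed.
Lemma sd_htpy_gen s : s <> [::] -> sd_htpy (gen s) = cone (b s) (gen s - sd_htpy (bd (gen s))).
Proof. by move=> s0; rewrite /sd_htpy ext_gen bd_rec_cons. Qed.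

(** Chain identities can be checked on a tuple assuming them on its boundary. *)
Lemma size_ind_additive (M : zmodType) (f g : {additive chain (seq Y) -> M}) :
  f (gen [::]) = g (gen [::]) ->
  (forall s, s <> [::] -> f (bd (gen s)) = g (bd (gen s)) ->
     f (gen s) = g (gen s)) ->
  f =1 g.
Proof.
move=> fg0 fgS z; have [n] : exists n, gspan (fun s => (size s <= n)%N) z.
  elim: (gspanT z) => [|{}z s _ [n hn] _|{}z s _ [n hn] _]; first by exists 0%N; exact: gspan0.
    exists (maxn n (size s)); apply: gspanD.
      by move: hn; apply: gspan_sub => t; lia.
    by apply: gspan_gen; lia.
  exists (maxn n (size s)); apply: gspanB.
    by move: hn; apply: gspan_sub => t; lia.
  by apply: gspan_gen; lia.
elim: n z => [|n IH] z; apply: eq_ext_span => s.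
  by case: s.
case: s => [//|x s] hs; apply: fgS => //; apply: IH.
by have := bd_span (x :: s); apply: gspan_sub => t [_ ->].
Qed.

Lemma bd_sd z : bd (sd z) = sd (bd z).
Proof.
pose f : {additive chain (seq Y) -> chain (seq Y)} := bd \o sd.
pose g : {additive chain (seq Y) -> chain (seq Y)} := sd \o bd.
apply: (size_ind_additive (f := f) (g := g)); rewrite /f /g /=.
  by rewrite sd_nil bd_nil raddf0.
move=> s s0 IH; rewrite sd_gen // bd_cone IH bd_bd.
by rewrite (raddf0 sd) (raddf0 (cone _)) subr0.
Qed.

Lemma bd_sd_htpy z : bd (sd_htpy z) = z - sd z - sd_htpy (bd z).
Proof.
pose f : {additive chain (seq Y) -> chain (seq Y)} := bd \o sd_htpy.
pose g : {additive chain (seq Y) -> chain (seq Y)} := (idfun \- sd) \- (sd_htpy \o bd).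
apply: (size_ind_additive (f := f) (g := g)); rewrite /f /g /=.
  by rewrite sd_htpy_nil sd_nil bd_nil (raddf0 bd) (raddf0 sd_htpy) subrr subr0.
move=> s s0 IH; rewrite sd_htpy_gen // bd_cone [bd (_ - _)]raddfB /= IH bd_bd raddf0 subr0.
by rewrite opprB addrCA subrr addr0 -sd_gen // addrAC.
Qed.

Variable C : seq Y -> Y -> Prop.
Hypothesis C_mem : forall s y, y \in s -> C s y.
Hypothesis C_center : forall s, s <> [::] -> C s (b s).
Hypothesis C_trans : forall s t y, (forall x, x \in t -> C s x) -> C t y -> C s y.

(** [C s y] stands for membership of y in the convex hull of s. *)
Definition inside s t := forall y, y \in t -> C s y.

Lemma sub_inside s t : {subset t <= s} -> inside s t.
Proof. by move=> ts y /ts; exact: C_mem. Qed.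

Lemma inside_trans s t u : inside s t -> inside t u -> inside s u.
Proof. by move=> st tu y /tu; exact: C_trans. Qed.

Lemma cone_inside s n z : s <> [::] ->
  gspan (fun t => size t = n /\ inside s t) z ->
  gspan (fun t => size t = n.+1 /\ inside s t) (cone (b s) z).
Proof.
move=> s0; apply: gspan_ext => t [<- st]; rewrite /= cone_gen; apply: gspan_gen.
split=> // y; rewrite inE => /orP[/eqP ->|/st //]; exact: C_center.
Qed.

Lemma sd_htpy_inside s :
  gspan (fun t => size t = size s /\ inside s t) (sd (gen s)) /\
  gspan (fun t => size t = (size s).+1 /\ inside s t) (sd_htpy (gen s)).
Proof.
have [n] := ubnP (size s); elim: n s => // n IH [_|x s /= sn].
  rewrite sd_nil sd_htpy_nil; split; last exact: gspan0.
  by apply: gspan_gen; split.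
set u := x :: s; have u0 : u <> [::] by [].
have [h1 h2] : gspan (fun t => size t = size s /\ inside u t) (sd (bd (gen u))) /\
    gspan (fun t => size t = (size s).+1 /\ inside u t) (sd_htpy (bd (gen u))).
  have hb := bd_span u; split; move: hb; apply: gspan_ext => t [tu /= et].
    have /IH [+ _] : (size t < n)%N by rewrite et; lia.
    apply: gspan_sub => v [-> tv]; split=> //; apply: inside_trans tv.
    exact/sub_inside/mem_subseq.
  have /IH [_] : (size t < n)%N by rewrite et; lia.
  apply: gspan_sub => v [-> tv]; rewrite et; split=> //; apply: inside_trans tv.
  exact/sub_inside/mem_subseq.
split; first by rewrite sd_gen //; exact: cone_inside.
rewrite sd_htpy_gen //; apply: (cone_inside u0); apply: gspanB => //.
by apply: gspan_gen; split=> //; apply: sub_inside.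
Qed.

Variable small : seq Y -> Prop.
Hypothesis small_inside : forall s t, inside s t -> small s -> small t.

Definition smalln n s := size s = n /\ small s.

Lemma sd_small n z : gspan (smalln n) z -> gspan (smalln n) (sd z).
Proof.
apply: gspan_ext => s [<- ss]; have [+ _] := sd_htpy_inside s.
by apply: gspan_sub => t [et it]; split=> //; exact: small_inside ss.
Qed.

Lemma sd_htpy_small n z : gspan (smalln n) z -> gspan (smalln n.+1) (sd_htpy z).
Proof.
apply: gspan_ext => s [<- ss]; have [_] := sd_htpy_inside s.
by apply: gspan_sub => t [et it]; split=> //; exact: small_inside ss.
Qed.

Lemma iter_sdD m z w : iter m sd (z + w) = iter m sd z + iter m sd w.
Proof. by elim: m => //= m ->; rewrite raddfD. Qed.
Lemma iter_sdN m z : iter m sd (- z) = - iter m sd z.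
Proof. by elim: m => //= m ->; rewrite raddfN. Qed.
(** Smallness survives further subdivision, so the finitely many terms of a chain
    can be subdivided the same number of times. *)
Lemma eventually_small_chain n z :
  gspan (fun s => exists m, gspan (smalln n) (iter m sd (gen s))) z ->
  exists m, gspan (smalln n) (iter m sd z).
Proof.
have up m k w : gspan (smalln n) (iter m sd w) ->
    gspan (smalln n) (iter (k + m) sd w).
  by move=> h; elim: k => //= k; exact: sd_small.
elim=> [|{}z s _ [m hm] [k hk]|{}z s _ [m hm] [k hk]].
- by exists 0%N; exact: gspan0.
- exists (m + k)%N; rewrite iter_sdD; apply: gspanD; last exact: up.
  by rewrite addnC; apply: up.
- exists (m + k)%N; rewrite iter_sdD iter_sdN; apply: gspanB; last exact: up.
  by rewrite addnC; apply: up.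
Qed.

Variable good : Y -> Prop.
Variable y0 : Y.
Hypothesis y0_good : good y0.
Hypothesis small_good : forall s y, small s -> y \in s -> good y.
Hypothesis eventually_small : forall s, (forall y, y \in s -> good y) ->
  exists m, gspan (smalln (size s)) (iter m sd (gen s)).

(** A small cycle z bounds the cone w = y0 . z, which need not be small, but some
    S^m w is.  The cycle S^m z = d(S^m w) therefore bounds a small chain, and
    so does z because z - S z = d(T z) with T z small. *)
Lemma small_acyclic n z : gspan (smalln n) z -> bd z = 0 ->
  exists2 w, gspan (smalln n.+1) w & bd w = z.
Proof.
move=> sz z0; have [m hm] : exists m, gspan (smalln n.+1) (iter m sd (cone y0 z)).
  apply: eventually_small_chain; move: sz; apply: gspan_ext => s [<- ss].
  rewrite /= cone_gen; apply: gspan_gen; rewrite -[(size s).+1]/(size (y0 :: s)).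
  by apply: eventually_small => y; rewrite inE => /orP[/eqP -> //|]; exact: small_good.
have ez : bd (cone y0 z) = z by rewrite bd_cone z0 raddf0 subr0.
move: (cone y0 z) ez hm => w; elim: m z sz z0 w => [|m IH] z sz z0 w ew hm.
  by exists w.
have [v sv ev] : exists2 v, gspan (smalln n.+1) v & bd v = sd z.
  apply: (IH _ (sd_small sz) _ (sd w)); last by rewrite -iterSr.
    by rewrite bd_sd z0 raddf0.
  by rewrite bd_sd ew.
exists (v + sd_htpy z); first by apply: gspanD => //; exact: sd_htpy_small.
by rewrite raddfD /= ev bd_sd_htpy z0 raddf0 subr0 addrC subrK.
Qed.
End Subdivision.

(** * Equivariant extension of chain maps and homotopies *)

Section TupleAction.
Variables (A : groupType) (X : choiceType) (ax : A -> X -> X).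
Hypothesis ax1 : forall x, ax 1%g x = x.
Hypothesis axM : forall a b x, ax (a * b)%g x = ax a (ax b x).

Definition tact (a : A) : chain (seq X) -> chain (seq X) :=
  linext (fun s => gen (map (ax a) s)).
HB.instance Definition _ a := GRing.Additive.on (tact a).

Lemma tact_gen a s : tact a (gen s) = gen (map (ax a) s).
Proof. exact: ext_gen. Qed.

Lemma tact1 z : tact 1%g z = z.
Proof.
apply: (eq_additive (f := tact 1%g) (g := idfun)) => s /=.
by rewrite tact_gen (eq_map ax1) map_id.
Qed.

Lemma tactM a b z : tact (a * b)%g z = tact a (tact b z).
Proof.
pose g : {additive chain (seq X) -> chain (seq X)} := tact a \o tact b.
apply: (eq_additive (f := tact (a * b)%g) (g := g)) => s; rewrite /g /=.
by rewrite !tact_gen -map_comp; congr gen; apply: eq_map => x /=; rewrite axM.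
Qed.

Lemma tact_cone a x z : tact a (cone x z) = cone (ax a x) (tact a z).
Proof.
pose f : {additive chain (seq X) -> chain (seq X)} := tact a \o cone x.
pose g : {additive chain (seq X) -> chain (seq X)} := cone (ax a x) \o tact a.
apply: (eq_additive (f := f) (g := g)) => s; rewrite /f /g /=.
by rewrite cone_gen !tact_gen cone_gen.
Qed.

Lemma bd_tact a z : bd (tact a z) = tact a (bd z).
Proof.
pose f : {additive chain (seq X) -> chain (seq X)} := bd \o tact a.
pose g : {additive chain (seq X) -> chain (seq X)} := tact a \o bd.
apply: (eq_additive (f := f) (g := g)) => s; rewrite /f /g /=.
elim: s => [|x s IH]; first by rewrite tact_gen !bd_nil raddf0.
rewrite tact_gen /= !bd_cons raddfB /= tact_cone tact_gen; congr (_ - cone _ _).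
by rewrite -IH tact_gen.
Qed.

Lemma tact_gspan (P : seq X -> Prop) a :
  (forall s, P s -> P (map (ax a) s)) ->
  forall z, gspan P z -> gspan P (tact a z).
Proof.
by move=> Pa; apply: gspan_ext => s /Pa; rewrite /= tact_gen; exact: gspan_gen.
Qed.

Lemma map_actM a b s : map (ax (a * b)%g) s = map (ax a) (map (ax b) s).
Proof. by rewrite -map_comp; apply: eq_map => x /=; rewrite axM. Qed.
End TupleAction.

(** A sign, so that chain maps (d H = H d) and homotopies (d H + H d = c) are
    instances of one statement. *)
Definition sgc (V : zmodType) (e : bool) (v : V) : V := if e then - v else v.

Lemma sgc_additive V e : additive (@sgc V e).
Proof. by case: e => u v /=; rewrite ?opprB ?opprK // addrC. Qed.
HB.instance Definition _ (V : zmodType) (e : bool) :=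
  GRing.isAdditive.Build V V (@sgc V e) (@sgc_additive V e).

(** [anchor] is an equivariant map to A, that is, a trivialisation of the free
    action on non-empty tuples: a choice made on anchor^{-1} . s and carried back
    by the anchor is equivariant. *)
Section EquivariantExtension.
Variables (A : groupType) (X Y : choiceType).
Variables (ax : A -> X -> X) (ay : A -> Y -> Y).
Hypothesis ay1 : forall x, ay 1%g x = x.
Hypothesis ayM : forall a b x, ay (a * b)%g x = ay a (ay b x).
Variables (DX : seq X -> Prop) (DY : nat -> seq Y -> Prop).
Hypothesis DX_sub : forall s t, subseq t s -> DX s -> DX t.
Hypothesis DY_act : forall a n s, DY n s -> DY n (map (ay a) s).
Hypothesis DY_acyclic : forall n z, gspan (DY n) z -> bd z = 0 ->
  exists2 w, gspan (DY n.+1) w & bd w = z.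
Variable anchor : seq X -> A.
Hypothesis anchor_act : forall a s, s <> [::] -> DX s ->
  anchor (map (ax a) s) = (a * anchor s)%g.

Variables (e : bool) (k : nat) (init : chain (seq Y)).
Variable c : seq X -> chain (seq Y).
Hypothesis init_span : gspan (DY k) init.
Hypothesis init_bd : bd init = c [::].
Hypothesis init_act : forall a, tact ay a init = init.
Hypothesis c_span : forall s, s <> [::] -> DX s -> gspan (DY (size s + k).-1) (c s).
Hypothesis c_bd : forall s, DX s -> bd (c s) = - sgc e (linext c (bd (gen s))).
Hypothesis c_act : forall a s, DX s -> c (map (ax a) s) = tact ay a (c s).

(** The acyclic-models argument: the right-hand side c s +- H(d s) is a cycle
    because d c = -+ c d, so acyclicity fills it.  Filling after translation by
    the inverse of the anchor makes H equivariant. *)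
Lemma equivariant_extension : exists H : seq X -> chain (seq Y),
  [/\ H [::] = init,
      forall s, DX s -> gspan (DY (size s + k)) (H s),
      forall s, DX s -> bd (H s) = c s + sgc e (linext H (bd (gen s))) &
      forall a s, DX s -> H (map (ax a) s) = tact ay a (H s)].
Proof.
have /choice[fill fillP] : forall nz : nat * chain (seq Y), exists w,
    gspan (DY nz.1) nz.2 -> bd nz.2 = 0 -> gspan (DY nz.1.+1) w /\ bd w = nz.2.
  move=> [n z]; have [[h1 h2]|nh] := pselect (gspan (DY n) z /\ bd z = 0).
    by have [w] := DY_acyclic h1 h2; exists w.
  by exists 0 => h1 h2; case: nh.
pose step s w := tact ay (anchor s)
   (fill ((size s + k).-1, tact ay (anchor s)^-1%g (c s + sgc e w))).
pose H := bd_rec init step; exists H.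
have face (s t : seq X) : DX s -> subseq t s /\ size t = (size s).-1 -> DX t.
  by move=> Ds [ts _]; exact: DX_sub ts Ds.
(* [w] is the cycle to be filled in order to define H at the tuple u. *)
have main n s : (size s < n)%N -> DX s ->
    gspan (DY (size s + k)) (H s) /\ bd (H s) = c s + sgc e (linext H (bd (gen s))).
  elim: n s => // n IH [_ _|x s sn Ds].
    by rewrite /H bd_rec_nil bd_nil !raddf0 addr0.
  set u := x :: s in sn Ds *; have u0 : u <> [::] by [].
  have IHf t : subseq t u /\ size t = (size u).-1 ->
    gspan (DY (size t + k)) (H t) /\ bd (H t) = c t + sgc e (linext H (bd (gen t))).
    by move=> ht; apply: IH; [case: ht => _ -> | exact: (face _ _ Ds ht)].
  pose w := c u + sgc e (linext H (bd (gen u))).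
  have bw : bd w = 0.
    have -> : bd w = bd (c u) + sgc e (bd (linext H (bd (gen u)))).
      by rewrite /w raddfD /=; congr (_ + _); rewrite /sgc; case: (e); rewrite ?raddfN.
    rewrite c_bd // addrC; apply/eqP; rewrite subr_eq0; apply/eqP; congr (sgc e _).
    pose f : {additive chain (seq X) -> chain (seq Y)} := bd \o linext H.
    pose g : {additive chain (seq X) -> chain (seq Y)} := linext c \+ (sgc e \o (linext H \o bd)).
    have := eq_ext_span (f := f) (g := g) _ (bd_span u); rewrite /f /g /= => ->.
      by rewrite bd_bd !raddf0 addr0.
    by move=> t /IHf [_]; rewrite !ext_gen.
  have sw : gspan (DY (size u + k).-1) w.
    apply: gspanD; first exact: c_span.
    have h : gspan (DY (size u + k).-1) (linext H (bd (gen u))).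
      move: (bd_span u); apply: gspan_ext => t ht; rewrite /= ext_gen.
      by have [+ _] := IHf t ht; case: ht => _ ->.
    by rewrite /sgc; case: (e) => //; exact: gspanN.
  have -> : H u = step u (linext H (bd (gen u))) by rewrite /H bd_rec_cons.
  have sw' : gspan (DY (size u + k).-1) (tact ay (anchor u)^-1%g w).
    by apply: tact_gspan sw => t; exact: DY_act.
  have [|h1 h2] := fillP ((size u + k).-1, tact ay (anchor u)^-1%g w) sw'.
    by rewrite /= bd_tact bw raddf0.
  split; first by apply: tact_gspan h1 => t; exact: DY_act.
  by rewrite /step bd_tact h2 /= -tactM // mulgV tact1.
split=> //.
- by move=> s Ds; have [] := main (size s).+1 s (ltnSn _) Ds.
- by move=> s Ds; have [] := main (size s).+1 s (ltnSn _) Ds.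
move=> a s; have [n] := ubnP (size s); elim: n s => // n IH [_ _|x s sn Ds].
  by rewrite /= /H bd_rec_nil init_act.
set u := x :: s in sn Ds *; have u0 : u <> [::] by [].
rewrite /H !bd_rec_cons // -/H /step anchor_act // size_map tactM // c_act //.
congr (tact _ _ (tact _ _ (fill (_, _)))).
have -> : linext H (bd (gen (map (ax a) u))) = tact ay a (linext H (bd (gen u))).
  rewrite -tact_gen bd_tact.
  pose f : {additive chain (seq X) -> chain (seq Y)} := linext H \o tact ax a.
  pose g : {additive chain (seq X) -> chain (seq Y)} := tact ay a \o linext H.
  apply: (eq_ext_span (f := f) (g := g) _ (bd_span u)); rewrite /f /g /= => t ht.
  rewrite tact_gen !ext_gen; apply: IH; last exact: (face _ _ Ds ht).
  by case: ht => _ ->.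
have -> : sgc e (tact ay a (linext H (bd (gen u)))) = tact ay a (sgc e (linext H (bd (gen u)))).
  by rewrite /sgc; case: (e); rewrite ?raddfN.
rewrite -raddfD /= -tactM //; congr (tact _ _ _).
have -> : (a * anchor u)^-1%g = ((anchor u)^-1 * a^-1)%g by rewrite invgM.
by rewrite -mulgA mulVg mulg1.
Qed.
End EquivariantExtension.

(** * Submodules of chains and projectivity *)

(** Membership is propositional, so that submodules of chains can be cut out by
    spans and by equations. *)
Record zsub (V : zmodType) := ZSub {
  zsub_mem :> V -> Prop;
  zsub0 : zsub_mem 0;
  zsubB : forall x y, zsub_mem x -> zsub_mem y -> zsub_mem (x - y) }.

Section ZSubType.
Variables (V : zmodType) (S : zsub V).
Definition zsub_pred : {pred V} := [pred x | `[< S x >]].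
Lemma zsub_predP x : reflect (S x) (x \in zsub_pred).
Proof. exact: asboolP. Qed.
Lemma zsub_closed : zmod_closed zsub_pred.
Proof.
split; first by apply/zsub_predP; exact: zsub0.
by move=> x y /zsub_predP hx /zsub_predP hy; apply/zsub_predP; exact: zsubB.
Qed.
HB.instance Definition _ := GRing.isZmodClosed.Build V zsub_pred zsub_closed.
Record zsubt := ZSubElt { zsval : V; _ : zsval \in zsub_pred }.
HB.instance Definition _ := [isSub for zsval].
HB.instance Definition _ := [Choice of zsubt by <:].
HB.instance Definition _ := [SubChoice_isSubZmodule of zsubt by <:].

Lemma zsvalP (x : zsubt) : S (zsval x).
Proof. by case: x => x /= /zsub_predP. Qed.
Definition tozsub (x : V) (h : S x) : zsubt := ZSubElt (introT (zsub_predP x) h).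
Lemma zsval_inj : injective zsval. Proof. exact: val_inj. Qed.
Lemma zsvalD x y : zsval (x + y) = zsval x + zsval y.
Proof. exact: (raddfD (val : zsubt -> V)). Qed.
Lemma zsvalB x y : zsval (x - y) = zsval x - zsval y.
Proof. exact: (raddfB (val : zsubt -> V)). Qed.
End ZSubType.
HB.instance Definition _ (V : zmodType) (S : zsub V) :=
  GRing.isAdditive.Build (zsubt S) V (@zsval V S) (@zsvalB V S).

Section SubGmodule.
Variables (A : groupType) (V : zmodType) (act : A -> {additive V -> V}).
Hypothesis act1 : forall v, act 1%g v = v.
Hypothesis actM : forall a b v, act (a * b)%g v = act a (act b v).
Variable S : zsub V.
Hypothesis S_act : forall a v, S v -> S (act a v).

Definition zsub_act (a : A) (x : zsubt S) : zsubt S :=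
  tozsub (S_act a (zsvalP x)).

Lemma zsub_actD a : {morph zsub_act a : x y / x + y}.
Proof.
move=> x y; apply: zsval_inj; rewrite zsvalD.
exact: etrans (congr1 (act a) (zsvalD x y)) (raddfD _ _ _).
Qed.
Lemma zsub_act1 x : zsub_act 1%g x = x.
Proof. by apply: zsval_inj; rewrite /= act1. Qed.
Lemma zsub_actM a b x : zsub_act (a * b)%g x = zsub_act a (zsub_act b x).
Proof. by apply: zsval_inj; rewrite /= actM. Qed.
Definition sub_gmodule : gmodule A := GModule zsub_actD zsub_act1 zsub_actM.
End SubGmodule.

Section Projectivity.
Variables (A : groupType) (Y : choiceType) (ay : A -> Y -> Y).
Hypothesis ayM : forall a b x, ay (a * b)%g x = ay a (ay b x).
Variable D : seq Y -> Prop.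
Variable anchor : seq Y -> A.
Hypothesis anchor_act : forall a s, D s -> anchor (map (ay a) s) = (a * anchor s)%g.

(** P is a retract, through i and q, of the chains spanned by D, on which A acts
    freely.  To lift h, preimages are chosen for the tuples of anchor 1 and
    transported by the action. *)
Lemma retract_projective (P : gmodule A) (i : P -> chain (seq Y)) (q : seq Y -> P) :
  (forall x y, i (x + y) = i x + i y) ->
  (forall a x, i (gact a x) = tact ay a (i x)) ->
  (forall x, gspan D (i x)) ->
  (forall a s, D s -> q (map (ay a) s) = gact a (q s)) ->
  (forall x, linext q (i x) = x) -> projective P.
Proof.
move=> iD iact iD' qact qi M N f h [fD fact] fsurj [hD hact].
have f_sub : {morph f : x y / x - y}.
  by move=> x y; apply/eqP; rewrite eq_sym subr_eq -fD subrK.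
have h_sub : {morph h : x y / x - y}.
  by move=> x y; apply/eqP; rewrite eq_sym subr_eq -hD subrK.
have /choice[m mP] : forall s, exists x, f x = h (q s).
  move=> s; have : [set: N] (h (q s)) by [].
  by rewrite -fsurj => -[x _ fx]; exists x.
pose g s := gact (anchor s) (m (map (ay (anchor s)^-1%g) s)).
have g_act a s : D s -> g (map (ay a) s) = gact a (g s).
  move=> Ds; rewrite /g anchor_act // gactM invgM -(map_actM ayM).
  by rewrite -mulgA mulVg mulg1.
have fg s : D s -> f (g s) = h (q s).
  move=> Ds; rewrite /g fact mP qact // hact -gactM mulgV gact1 //.
exists (linext g \o i); split; last first.
  move=> x; rewrite -{2}(qi x) /=.
  pose fA := GRing.isAdditive.Build M N f f_sub.
  pose hA := GRing.isAdditive.Build P N h h_sub.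
  pose f' : {additive M -> N} := HB.pack f fA.
  pose h' : {additive P -> N} := HB.pack h hA.
  pose u : {additive chain (seq Y) -> N} := f' \o linext g.
  pose v : {additive chain (seq Y) -> N} := h' \o linext q.
  apply: (eq_ext_span (f := u) (g := v) _ (iD' x)) => s Ds.
  by rewrite /u /v /= !ext_gen fg.
split; first by move=> x y /=; rewrite iD raddfD.
move=> a x /=; rewrite iact.
have act_sub : {morph @gact A M a : x y / x - y}.
  by move=> z y; apply/eqP; rewrite eq_sym subr_eq -gactD subrK.
pose aA := GRing.isAdditive.Build M M (@gact A M a) act_sub.
pose a' : {additive M -> M} := HB.pack (@gact A M a) aA.
pose u : {additive chain (seq Y) -> M} := linext g \o tact ay a.
pose v : {additive chain (seq Y) -> M} := a' \o linext g.
apply: (eq_ext_span (f := u) (g := v) _ (iD' x)) => s Ds.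
by rewrite /u /v /= tact_gen !ext_gen g_act.
Qed.
End Projectivity.

(** * Truncation of a free resolution *)

(** [small] tuples of Y form an acyclic complex of free modules, and [nu] is an
    equivariant chain map from it to a complex of tuples of X of size at most N. *)
Section FiniteResolution.
Variables (A : groupType) (X Y : choiceType).
Variables (ax : A -> X -> X) (ay : A -> Y -> Y).
Hypothesis ay1 : forall x, ay 1%g x = x.
Hypothesis ayM : forall a b x, ay (a * b)%g x = ay a (ay b x).

Variables (DX : seq X -> Prop) (small : seq Y -> Prop).
Hypothesis DX_sub : forall s t, subseq t s -> DX s -> DX t.
Hypothesis small_sub : forall s t, subseq t s -> small s -> small t.
Hypothesis small_act : forall a s, small s -> small (map (ay a) s).
Hypothesis small_nil : small [::].
Hypothesis small_acyclic : forall n z, gspan (smalln small n) z -> bd z = 0 ->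
  exists2 w, gspan (smalln small n.+1) w & bd w = z.
Variables (anchorX : seq X -> A) (anchorY : seq Y -> A).
Hypothesis anchorX_act : forall a s, s <> [::] -> DX s ->
  anchorX (map (ax a) s) = (a * anchorX s)%g.
Hypothesis anchorY_act : forall a s, s <> [::] -> small s ->
  anchorY (map (ay a) s) = (a * anchorY s)%g.
Variable N : nat.
Hypothesis DX_dim : forall s, DX s -> (size s <= N)%N.
Variable nu : seq Y -> chain (seq X).
Hypothesis nu_nil : nu [::] = gen [::].
Hypothesis nu_span : forall s, small s ->
  gspan (fun t => size t = size s /\ DX t) (nu s).
Hypothesis nu_bd : forall s, small s -> bd (nu s) = linext nu (bd (gen s)).
Hypothesis nu_act : forall a s, small s -> nu (map (ay a) s) = tact ax a (nu s).

Lemma smalln_act a n s : smalln small n s -> smalln small n (map (ay a) s).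
Proof. by case=> <- ss; split; [rewrite size_map | exact: small_act]. Qed.

(** Tuples in X are permuted freely and the small complex is acyclic, so there is a
    chain map backwards. *)
Lemma nu_back : exists r : seq X -> chain (seq Y),
  [/\ r [::] = gen [::],
      forall s, DX s -> gspan (smalln small (size s)) (r s),
      forall s, DX s -> bd (r s) = linext r (bd (gen s)) &
      forall a s, DX s -> r (map (ax a) s) = tact ay a (r s)].
Proof.
have ext0 z : linext (fun _ : seq X => 0 : chain (seq Y)) z = 0.
  by apply: (eq_additive (f := linext _) (g := \0)) => s; rewrite /= ext_gen.
have [||||||H [H1 H2 H3 H4]] := equivariant_extension ay1 ayM
  DX_sub smalln_act small_acyclic anchorX_act (e := false) (k := 0%N)
  (init := gen [::]) (c := fun=> 0).
- exact: gspan_gen.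
- exact: bd_nil.
- by move=> a; rewrite tact_gen.
- by move=> *; exact: gspan0.
- by move=> s _; rewrite ext0 raddf0 /= oppr0.
- by move=> a s _; rewrite raddf0.
exists H; split=> // s Ds; first by have := H2 s Ds; rewrite addn0.
by rewrite H3 // add0r.
Qed.

Lemma smalln_bd n z : gspan (smalln small n.+1) z -> gspan (smalln small n) (bd z).
Proof.
apply: gspan_ext => s [sn ss] /=; have := bd_span s.
by apply: gspan_sub => t [ts et]; split; [rewrite et sn | exact: small_sub ts ss].
Qed.

(** Going through X and back is homotopic to the identity, both being
    augmentation-preserving maps from a free complex to an acyclic one.  On tuples
    of size N + 1 the composite vanishes, which leaves d h + h d = id there. *)
Lemma homotopy_to_id : exists h : seq Y -> chain (seq Y),
  [/\ forall n z, gspan (smalln small n) z -> gspan (smalln small n.+1) (linext h z),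
      forall z, gspan (smalln small N.+1) z -> bd (linext h z) = z - linext h (bd z) &
      forall n a z, gspan (smalln small n) z -> linext h (tact ay a z) = tact ay a (linext h z)].
Proof.
have [r [r0 r_span r_bd r_act]] := nu_back.
pose c s := gen s - linext r (nu s).
have rnu s : small s -> gspan (smalln small (size s)) (linext r (nu s)).
  move=> ss; have := nu_span ss; apply: gspan_ext => t [<- Dt].
  by rewrite /= ext_gen; exact: r_span.
have extc z : linext c z = z - linext r (linext nu z).
  pose g : {additive chain (seq Y) -> chain (seq Y)} := idfun \- (linext r \o linext nu).
  by apply: (eq_additive (f := linext c) (g := g)) => s; rewrite /g /= !ext_gen.
have [||||||h [h0 h_span h_bd h_act]] := equivariant_extension ay1 ayM
  small_sub smalln_act small_acyclic anchorY_act (e := true) (k := 1%N)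
  (init := 0) (c := c).
- exact: gspan0.
- by rewrite /c nu_nil ext_gen r0 subrr raddf0.
- by move=> a; rewrite raddf0.
- move=> s s0 ss; rewrite addn1; apply: gspanB; last exact: rnu.
  by apply: gspan_gen.
- move=> s ss; rewrite /sgc opprK extc /c raddfB /=; congr (_ - _).
  rewrite -nu_bd //.
  pose f : {additive chain (seq X) -> chain (seq Y)} := bd \o linext r.
  pose g : {additive chain (seq X) -> chain (seq Y)} := linext r \o bd.
  apply: (eq_ext_span (f := f) (g := g) _ (nu_span ss)) => t [_ Dt].
  by rewrite /f /g /= ext_gen r_bd.
- move=> a s ss; rewrite /c nu_act // raddfB /= tact_gen; congr (_ - _).
  pose f : {additive chain (seq X) -> chain (seq Y)} := linext r \o tact ax a.
  pose g : {additive chain (seq X) -> chain (seq Y)} := tact ay a \o linext r.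
  apply: (eq_ext_span (f := f) (g := g) _ (nu_span ss)) => t [_ Dt].
  by rewrite /f /g /= tact_gen !ext_gen r_act.
exists h; split.
- move=> n; apply: gspan_ext => s [<- ss]; rewrite /= ext_gen.
  by have := h_span s ss; rewrite addn1.
- move=> z sz.
  pose f : {additive chain (seq Y) -> chain (seq Y)} := bd \o linext h.
  pose g : {additive chain (seq Y) -> chain (seq Y)} := idfun \- (linext h \o bd).
  apply: (eq_ext_span (f := f) (g := g) _ sz) => s [sN ss]; rewrite /f /g /=.
  rewrite ext_gen h_bd // /c.
  suff -> : nu s = 0 by rewrite raddf0 subr0.
  suff : gspan (fun=> False) (nu s).
    by move: (nu s); apply: gspan_closed => // u v -> ->; rewrite subr0.
  by have := nu_span ss; apply: gspan_sub => t [et /DX_dim]; rewrite et sN ltnn.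
- move=> n a z sz.
  pose f : {additive chain (seq Y) -> chain (seq Y)} := linext h \o tact ay a.
  pose g : {additive chain (seq Y) -> chain (seq Y)} := tact ay a \o linext h.
  apply: (eq_ext_span (f := f) (g := g) _ sz) => s [sN ss]; rewrite /f /g /=.
  by rewrite tact_gen !ext_gen h_act.
Qed.

(** In degree N the operator h d is idempotent, since d h d = d.  The resolution
    consists of all small chains below degree N, of the image of h d in degree N,
    on which d is injective, and of 0 above. *)
Lemma finite_resolution : cd_le A N.
Proof.
have [h [h_span h_bd h_act]] := homotopy_to_id.
(* the chains of degree k of the truncated resolution, with a projection [pr] *)
pose Q k z := [/\ gspan (smalln small k.+1) z,
   k = N -> linext h (bd z) = z & (N < k)%N -> z = 0].
have Q0 k : Q k 0 by split; rewrite ?raddf0 //; exact: gspan0.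
have QB k z w : Q k z -> Q k w -> Q k (z - w).
  move=> [z1 z2 z3] [w1 w2 w3]; split; first exact: gspanB.
    by move=> kN; rewrite !raddfB /= z2 ?w2.
  by move=> kN; rewrite z3 ?w3 ?subr0.
pose S k := ZSub (Q0 k) (@QB k).
have Q_act k a z : Q k z -> Q k (tact ay a z).
  move=> [z1 z2 z3]; split; first by apply: tact_gspan z1 => s; exact: smalln_act.
    move=> kN; rewrite bd_tact (h_act k) ?z2 //; exact: smalln_bd.
  by move=> kN; rewrite z3 // raddf0.
pose T a : {additive chain (seq Y) -> chain (seq Y)} := tact ay a.
have T1 z : T 1%g z = z by exact: tact1.
have TM a b z : T (a * b)%g z = T a (T b z) by exact: tactM.
pose P k := sub_gmodule (act := T) T1 TM (S := S k) (Q_act k).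
pose pr_lt : {additive chain (seq Y) -> chain (seq Y)} := idfun.
pose pr_eq : {additive chain (seq Y) -> chain (seq Y)} := linext h \o bd.
pose pr_gt : {additive chain (seq Y) -> chain (seq Y)} := \0.
pose pr k := if (k < N)%N then pr_lt else if k == N then pr_eq else pr_gt.
have bd_h_bd z : gspan (smalln small N.+1) z -> bd (linext h (bd z)) = bd z.
  move=> sz; have /(congr1 bd) := h_bd z sz.
  by rewrite bd_bd raddfB /= => /esym/eqP; rewrite subr_eq0 => /eqP.
have hbd z : gspan (smalln small N.+1) z -> linext h (bd (linext h (bd z))) = linext h (bd z).
  by move=> /bd_h_bd ->.
have prQ k z : gspan (smalln small k.+1) z -> Q k (pr k z).
  move=> sz; rewrite /pr; case: ltngtP => [kN|kN|kN] /=; split=> //; try by move: kN; lia.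
  - exact: gspan0.
  - by apply: h_span; exact: smalln_bd.
  - by rewrite hbd // -kN.
have prK k z : Q k z -> pr k z = z.
  move=> [z1 z2 z3]; rewrite /pr; case: ltngtP => [//|/z3 -> //|kN]; exact: z2 kN.
have pr_act k a z : gspan (smalln small k.+1) z -> pr k (tact ay a z) = tact ay a (pr k z).
  move=> sz; rewrite /pr; case: ltngtP => //= kN; first by rewrite raddf0.
  by rewrite bd_tact (h_act k) //; exact: smalln_bd.
have Pproj k : projective (P k).
  pose q (s : seq Y) : P k := if pselect (smalln small k.+1 s) is left ss
    then tozsub (S := S k) (prQ k (gen s) (gspan_gen ss)) else 0.
  have qE s : smalln small k.+1 s -> zsval (q s) = pr k (gen s).
    by move=> ss; rewrite /q; case: pselect.
  apply: (@retract_projective A Y ay ayM (smalln small k.+1) anchorY _ (P k)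
    (fun x : P k => zsval x) q).
  - by move=> a [|y s] [//] _; exact: anchorY_act.
  - by move=> x y; exact: zsvalD.
  - by [].
  - by move=> x; have [] := zsvalP x.
  - move=> a s ss; apply: zsval_inj; rewrite qE; last exact: smalln_act.
    by rewrite /= qE // -pr_act ?tact_gen //; exact: gspan_gen.
  - move=> x; apply: zsval_inj; have Qx := zsvalP x; rewrite -[RHS](prK k) //.
    pose f : {additive chain (seq Y) -> chain (seq Y)} := @zsval _ (S k) \o linext q.
    have [x1 _ _] := Qx; apply: (eq_ext_span (f := f) (g := pr k) _ x1) => s ss.
    by rewrite /f /= ext_gen qE.
have Qbd k z : Q k.+1 z -> Q k (bd z).
  move=> [z1 z2 z3]; split; first exact: smalln_bd.
    by move=> kN; rewrite bd_bd raddf0 z3 ?raddf0 // kN.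
  by move=> kN; rewrite z3 ?raddf0 //; lia.
pose d k (x : P k.+1) : P k := tozsub (S := S k) (Qbd k _ (zsvalP x)).
pose aug : {additive chain (seq Y) -> int} := linext (fun=> 1).
pose eps (x : P 0%N) : trivial_gmodule A int := aug (bd (zsval x)).
have augP z : gspan (smalln small 0) z -> z = gen [::] *~ aug z.
  move: z; apply: gspan_closed; first by rewrite raddf0 mulr0z.
    by move=> z w ez ew; rewrite raddfB mulrzBr -ez -ew.
  by move=> s [/size0nil -> _]; rewrite /aug /= ext_gen mulr1z.
have fill k z : (k <= N)%N -> gspan (smalln small k) z -> bd z = 0 ->
    exists2 w, Q k w & bd w = z.
  move=> kN sz z0; have [w sw ew] := small_acyclic sz z0.
  exists (pr k w); first exact: prQ.
  rewrite /pr; case: ltngtP kN => //= kN _.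
  by rewrite bd_h_bd -?kN // ew.
exists P, d, eps; split.
- split=> // k kN x; apply: zsval_inj; have [_ _] := zsvalP x; exact.
- split.
    move=> k; split=> [x y|a x]; apply: zsval_inj.
      apply: etrans (esym (@zsvalD _ (S k) _ _)).
      exact: etrans (congr1 bd (@zsvalD _ (S k.+1) x y)) (raddfD _ _ _).
    by rewrite /= /T bd_tact.
  split=> [x y|a x]; rewrite /eps.
    by rewrite -[RHS](raddfD aug) -raddfD.
  have -> : zsval (gact a x) = tact ay a (zsval x) by [].
  rewrite bd_tact.
  pose f : {additive chain (seq Y) -> int} := aug \o tact ay a.
  by apply: (eq_additive (f := f) (g := aug)) => s; rewrite /f /aug /= tact_gen !ext_gen.
- apply/seteqP; split=> // m _.
  have g0 : gspan (smalln small 0) (gen [::] : chain (seq Y)) by exact: gspan_gen.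
  have [||w Qw ew] := fill 0%N (gen [::] *~ m) isT.
  + case: m => n; rewrite ?NegzE -?nmulrn -?pmulrn; last apply: gspanN.
      by elim: n => [|n IH]; rewrite ?mulr0n ?mulrS; [exact: gspan0 | exact: gspanD].
    by elim: n.+1 => [|k IH]; rewrite ?mulr0n ?mulrS; [exact: gspan0 | exact: gspanD].
  + by rewrite raddfMz /= bd_nil mul0rz.
  exists (tozsub (S := S 0%N) Qw) => //; rewrite /eps /= ew raddfMz /= /aug ext_gen.
  by rewrite intz.
- apply/seteqP; split=> [_ [x _ <-]|x].
    by rewrite /= /eps /= bd_bd raddf0.
  rewrite /= /eps => ax0; have Qx := zsvalP x.
  have bx0 : bd (zsval x) = 0.
    by have [/smalln_bd/augP -> _ _] := Qx; rewrite ax0 mulr0z.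
  have [w Qw ew] : exists2 w, Q 1%N w & bd w = zsval x.
    have [x1 x2 x3] := Qx; have [N0|N0] := leqP 1 N; first exact: fill.
    have e : 0%N = N by lia.
    by exists 0; rewrite ?raddf0 // -(x2 e) bx0 raddf0.
  by exists (tozsub (S := S 1%N) Qw) => //; apply: zsval_inj.
move=> k; apply/seteqP; split=> [_ [x _ <-]|x].
  by apply: zsval_inj; rewrite /= bd_bd.
move=> dx0; have Qx := zsvalP x.
have bx0 : bd (zsval x) = 0 by have /(congr1 (@zsval _ _)) := dx0.
have [w Qw ew] : exists2 w, Q k.+2 w & bd w = zsval x.
  have [x1 x2 x3] := Qx; have [N0|N0] := leqP k.+2 N; first exact: fill.
  exists 0; rewrite ?raddf0 //; have [e|/x3 -> //] : k.+1 = N \/ (N < k.+1)%N by lia.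
  by rewrite -(x2 e) bx0 raddf0.
by exists (tozsub (S := S k.+2) Qw) => //; apply: zsval_inj.
Qed.
End FiniteResolution.

(** * Flags of partial labellings *)

Section Flags.
Variables (A : groupType) (N : nat).
(** A vertex of the nerve is a pair (j, a).  As W (j, a) and W (j, b) are disjoint
    for a <> b, a simplex of the nerve is a partial function from indices to A.
    Flags of simplices, rather than simplices, are used because they come with an
    order preserved by A. *)
Definition label := {ffun 'I_N -> option A}.
Implicit Types (p q r : label) (t : seq label) (w : chain (seq label)).

Definition lact (a : A) p : label := [ffun j => omap (fun b => (a * b)%g) (p j)].

Definition lab_le p q := [forall j, (p j == None) || (p j == q j)].
Definition lab_lt p q := lab_le p q && (p != q).
Definition lab_dom p : {set 'I_N} := finset (fun j => p j != None).

Lemma in_lab_dom p j : (j \in lab_dom p) = (p j != None).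
Proof. exact: finset.in_set. Qed.

Lemma lab_leP p q : reflect (forall j a, p j = Some a -> q j = Some a) (lab_le p q).
Proof.
apply: (iffP forallP) => [h j a pj|h j]; first by have := h j; rewrite pj => /eqP <-.
by case e: (p j) => [a|] //=; rewrite (h _ _ e).
Qed.

Lemma lab_le_trans : transitive lab_le.
Proof. by move=> q p r /lab_leP pq /lab_leP qr; apply/lab_leP => j a /pq/qr. Qed.

Lemma lab_le_anti p q : lab_le p q -> lab_le q p -> p = q.
Proof.
move=> /lab_leP pq /lab_leP qp; apply/ffunP => j.
case e: (p j) => [a|]; first by rewrite (pq _ _ e).
by case e': (q j) => [a|//]; rewrite (qp _ _ e') in e.
Qed.

Lemma lab_lt_trans : transitive lab_lt.
Proof.
move=> q p r /andP[pq pNq] /andP[qr qNr]; apply/andP; split; first exact: lab_le_trans pq qr.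
by apply: contra_neq pNq => e; apply: lab_le_anti; rewrite // e.
Qed.

Lemma lab_lt_dom p q : lab_lt p q -> (#|lab_dom p| < #|lab_dom q|)%N.
Proof.
move=> /andP[/lab_leP pq]; rewrite ltnNge; apply: contra_neqN => dqp.
have sub : lab_dom p \subset lab_dom q.
  by apply/fintype.subsetP => j; rewrite !in_lab_dom; case e: (p j) => [a|//]; rewrite (pq _ _ e).
have /eqP/finset.setP e : lab_dom p == lab_dom q by rewrite eqEcard sub.
apply/ffunP => j; have := e j; rewrite !in_lab_dom.
by case e1: (p j) => [a|]; [rewrite (pq _ _ e1) | case: (q j)].
Qed.

Definition flag t := sorted lab_lt t /\ all (fun p => (0 < #|lab_dom p|)%N) t.

Lemma flag_sub s t : subseq t s -> flag s -> flag t.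
Proof.
move=> ts [h1 h2]; split; first exact: subseq_sorted lab_lt_trans _ _ ts h1.
by apply/allP => p /(mem_subseq ts); move: p; apply/allP.
Qed.

(** Domains grow strictly along a flag, from a non-empty one. *)
Lemma flag_size t : flag t -> (size t <= N)%N.
Proof.
case: t => [//|p t] [/= pt /andP[p0 _]].
suff : (#|lab_dom p| + size t <= N)%N.
  by apply: leq_trans; rewrite /= -add1n leq_add2r.
elim: t p pt {p0} => [p _|q t IH p /= /andP[/lab_lt_dom pq /IH h]].
  by rewrite addn0 -[leqRHS]card_ord; exact: max_card.
by apply: leq_trans h; rewrite addnS -addSn leq_add2r.
Qed.

Lemma lact_inj a : injective (lact a).
Proof.
move=> p q /ffunP e; apply/ffunP => j; have := e j; rewrite !ffunE.
by case: (p j) (q j) => [x|] [y|] //= [/mulgI ->].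
Qed.

(** The value at the first index of the domain: translation by a multiplies it
    by a. *)
Definition lab_anchor p : A :=
  if [pick j | p j != None] is Some j then odflt 1%g (p j) else 1%g.

Lemma lab_anchor_act a p : (0 < #|lab_dom p|)%N ->
  lab_anchor (lact a p) = (a * lab_anchor p)%g.
Proof.
rewrite card_gt0 => /finset.set0Pn[i]; rewrite in_lab_dom => pi; rewrite /lab_anchor.
rewrite (eq_pick (Q := fun j => p j != None)); last first.
  by move=> j; rewrite ffunE; case: (p j).
case: pickP => [j pj|/(_ i)]; last by rewrite pi.
by rewrite ffunE; case: (p j) pj.
Qed.

Definition flag_anchor t := if t is p :: _ then lab_anchor p else 1%g.
Lemma flag_anchor_act a t : t <> [::] -> flag t ->
  flag_anchor (map (lact a) t) = (a * flag_anchor t)%g.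
Proof. by case: t => [//|p t] _ [_ /= /andP[p0 _]]; exact: lab_anchor_act. Qed.

(** The cone of the normalised complex, in which a tuple with a repeated
    consecutive entry is zero.  The default value p of [head] makes the empty
    tuple fall into the first case, where it is separated by the match. *)
Definition ncone1 p t : chain (seq label) :=
  if head p t == p then (if t is [::] then gen [:: p] else 0) else gen (p :: t).
Definition ncone p : chain (seq label) -> chain (seq label) := linext (ncone1 p).
HB.instance Definition _ p := GRing.Additive.on (ncone p).

Lemma ncone_nil p : ncone p (gen [::]) = gen [:: p].
Proof. by rewrite /ncone ext_gen /ncone1 /= eqxx. Qed.

Lemma ncone_eq p t : ncone p (gen (p :: t)) = 0.
Proof. by rewrite /ncone ext_gen /ncone1 /= eqxx. Qed.

Lemma ncone_neq p q t : q != p -> ncone p (gen (q :: t)) = cone p (gen (q :: t)).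
Proof. by move=> qp; rewrite /ncone ext_gen /ncone1 /= (negbTE qp) cone_gen. Qed.

Lemma ncone_cone_eq p w : ncone p (cone p w) = 0.
Proof.
pose f : {additive chain (seq label) -> chain (seq label)} := ncone p \o cone p.
apply: (eq_additive (f := f) (g := \0)) => t; rewrite /f /=.
by rewrite cone_gen ncone_eq.
Qed.

Lemma ncone_cone_neq p q w : q != p -> ncone p (cone q w) = cone p (cone q w).
Proof.
move=> qp.
pose f : {additive chain (seq label) -> chain (seq label)} := ncone p \o cone q.
pose g : {additive chain (seq label) -> chain (seq label)} := cone p \o cone q.
apply: (eq_additive (f := f) (g := g)) => t; rewrite /f /g /=.
by rewrite cone_gen ncone_neq.
Qed.

Lemma ncone_above p t : sorted lab_lt (p :: t) ->
  ncone p (gen t) = cone p (gen t).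
Proof.
case: t => [|q t] /=; first by rewrite ncone_nil cone_gen.
by move=> /andP[/andP[_ pq] _]; rewrite ncone_neq // eq_sym.
Qed.

Definition flag_above p t := flag t /\ all (lab_le p) t.

(** On flags above p, the entry p can occur in the first place only.  If
    w = p :: t', then p . w = 0 and p . d w = p . t' = w, so both sides are 0;
    otherwise the normalised cone is the plain one. *)
Lemma bd_ncone p w : gspan (flag_above p) w ->
  bd (ncone p w) = w - ncone p (bd w).
Proof.
move=> sw.
pose f : {additive chain (seq label) -> chain (seq label)} := bd \o ncone p.
pose g : {additive chain (seq label) -> chain (seq label)} := idfun \- (ncone p \o bd).
apply: (eq_ext_span (f := f) (g := g) _ sw) => -[_|q t [[/= ltt _] /= /andP[pq ple]]]; rewrite /f /g /=.
  by rewrite ncone_nil bd_nil raddf0 subr0 bd_cons bd_nil raddf0 subr0.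
have [e|qp] := eqVneq q p.
  rewrite e in ltt *; rewrite ncone_eq bd_cons raddfB /= ncone_cone_eq subr0.
  by rewrite ncone_above // cone_gen raddf0 subrr.
rewrite ncone_neq // bd_cone; congr (_ - _).
rewrite bd_cons [LHS]raddfB [RHS]raddfB /= ncone_cone_neq // ncone_above //=.
case: t ltt {ple sw} => //= r t /andP[qr rt]; rewrite rt andbT.
by apply: lab_lt_trans qr; rewrite /lab_lt pq eq_sym.
Qed.

Lemma ncone_span p n w : (0 < #|lab_dom p|)%N ->
  gspan (fun t => size t = n /\ flag_above p t) w ->
  gspan (fun t => size t = n.+1 /\ flag_above p t) (ncone p w).
Proof.
have le_refl : lab_le p p by apply/lab_leP.
move=> p0; apply: gspan_ext => -[[/= <- _]|q t [<- [[/= ltt h] /= /andP[pq ple]]]] /=.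
  by rewrite ncone_nil; apply: gspan_gen; rewrite /flag_above /flag /= p0 le_refl.
have [e|qp] := eqVneq q p; first by rewrite e ncone_eq; exact: gspan0.
rewrite ncone_neq // cone_gen; apply: gspan_gen; split=> //; split; last by rewrite /= le_refl pq.
by split; rewrite /= ?p0 // ltt andbT /lab_lt pq eq_sym.
Qed.

Lemma ncone_act a p w : tact lact a (ncone p w) = ncone (lact a p) (tact lact a w).
Proof.
pose f : {additive chain (seq label) -> chain (seq label)} := tact lact a \o ncone p.
pose g : {additive chain (seq label) -> chain (seq label)} := ncone (lact a p) \o tact lact a.
apply: (eq_additive (f := f) (g := g)) => -[|q t]; rewrite /f /g /=.
  by rewrite ncone_nil !tact_gen ncone_nil.
have [->|qp] := eqVneq q p; first by rewrite ncone_eq tact_gen ncone_eq raddf0.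
rewrite ncone_neq // !tact_gen /= ncone_neq ?(inj_eq (@lact_inj a)) //.
by rewrite cone_gen tact_gen cone_gen.
Qed.

Variables (Y : choiceType) (ay : A -> Y -> Y) (small : seq Y -> Prop).
Hypothesis small_sub : forall s t : seq Y, subseq t s -> small s -> small t.
Variable lab : seq Y -> label.
Hypothesis lab_dom_gt0 : forall s, s <> [::] -> small s -> (0 < #|lab_dom (lab s)|)%N.
Hypothesis lab_sub : forall s t : seq Y, subseq t s -> t <> [::] -> small s ->
  lab_le (lab s) (lab t).
Hypothesis lab_act : forall a s, s <> [::] -> small s ->
  lab (map (ay a) s) = lact a (lab s).

(** Each face of s carries the set of labels of the open sets containing its hull,
    which grows when the face shrinks; the barycentric subdivision of s thus maps
    to flags whose first entry is the label of s. *)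
Definition nerve_map (s : seq Y) : chain (seq label) :=
  bd_rec (gen [::]) (fun s w => ncone (lab s) w) s.

Lemma nerve_map_nil : nerve_map [::] = gen [::]. Proof. exact: bd_rec_nil. Qed.

Lemma nerve_map_spec s : small s ->
  [/\ gspan (fun t => size t = size s /\ (flag t /\ (s <> [::] -> all (lab_le (lab s)) t)))
        (nerve_map s),
      bd (nerve_map s) = linext nerve_map (bd (gen s)) &
      forall a, nerve_map (map (ay a) s) = tact lact a (nerve_map s)].
Proof.
have [n] := ubnP (size s); elim: n s => // n IH [_ _|x s sn su].
  rewrite nerve_map_nil !bd_nil; split; first by apply: gspan_gen; split=> //; split.
    by rewrite raddf0.
  by move=> a; rewrite tact_gen.
set u := x :: s in sn su *; have u0 : u <> [::] by [].
have IHf (t : seq Y) : subseq t u /\ size t = (size u).-1 ->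
  [/\ gspan (fun r : seq label => size r = size t /\ (flag r /\ (t <> [::] -> all (lab_le (lab t)) r)))
        (nerve_map t),
      bd (nerve_map t) = linext nerve_map (bd (gen t)) &
      forall a, nerve_map (map (ay a) t) = tact lact a (nerve_map t)].
  by move=> [tu et]; apply: IH; [rewrite et | exact: small_sub tu su].
have E : nerve_map u = ncone (lab u) (linext nerve_map (bd (gen u))) by exact: bd_rec_cons.
have sw : gspan (fun t => size t = size s /\ flag_above (lab u) t)
    (linext nerve_map (bd (gen u))).
  apply: gspan_ext (bd_span u) => t ht; rewrite /= ext_gen.
  have [+ _ _] := IHf t ht; apply: gspan_sub => r [er [fr ar]].
  case: ht => tu et; split; first by rewrite er et.
  split=> //; case: t tu et er ar => [|y t] tu et er ar.
    by case: r er {fr ar}.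
  have le_ut : lab_le (lab u) (lab (y :: t)) by exact: lab_sub.
  by apply: sub_all (ar _) => // p; exact: lab_le_trans.
have p0 : (0 < #|lab_dom (lab u)|)%N by exact: lab_dom_gt0.
split.
- rewrite E; have := ncone_span p0 sw.
  by apply: gspan_sub => t [-> [ft at']]; split=> //; split.
- rewrite E bd_ncone; last by move: sw; apply: gspan_sub => t [].
  pose f : {additive chain (seq Y) -> chain (seq label)} := bd \o linext nerve_map.
  pose g : {additive chain (seq Y) -> chain (seq label)} := linext nerve_map \o bd.
  have := eq_ext_span (f := f) (g := g) _ (bd_span u); rewrite /f /g /= => ->.
    by rewrite bd_bd (raddf0 (linext nerve_map)) (raddf0 (ncone _)) subr0.
  by move=> t /IHf [_ + _]; rewrite ext_gen.
move=> a; rewrite E.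
have -> : nerve_map (map (ay a) u) =
    ncone (lab (map (ay a) u)) (linext nerve_map (bd (gen (map (ay a) u)))).
  exact: bd_rec_cons.
rewrite ncone_act lab_act // -tact_gen bd_tact; congr (ncone _ _).
pose f : {additive chain (seq Y) -> chain (seq label)} := linext nerve_map \o tact ay a.
pose g : {additive chain (seq Y) -> chain (seq label)} := tact lact a \o linext nerve_map.
apply: (eq_ext_span (f := f) (g := g) _ (bd_span u)) => t /IHf [_ _ h].
by rewrite /f /g /= tact_gen !ext_gen h.
Qed.
End Flags.

(** * Convex hulls and the mesh of a subdivision *)

Section ConvexHull.
Variables (R : realType) (I : choiceType).
Notation pt := (I -> R).
Implicit Types (x y : pt) (s t : seq pt) (F : seq I).

Definition convex_pred (C : pt -> Prop) := forall x y (c : R),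
  0 <= c -> c <= 1 -> C x -> C y -> C (fun i => c * x i + (1 - c) * y i).

(** The impredicative form gives at once that hulls are monotone and transitive,
    and that a convex bound valid on s is valid on its hull. *)
Definition hull s y := forall C, convex_pred C -> (forall x, x \in s -> C x) -> C y.

Lemma hull_convex s : convex_pred (hull s).
Proof.
move=> x y c c0 c1 hx hy C CC Cs.
exact: (CC _ _ c c0 c1 (hx C CC Cs) (hy C CC Cs)).
Qed.

Lemma hull_mem s y : y \in s -> hull s y.
Proof. by move=> ys C _; exact. Qed.

Lemma hull_trans s t y : (forall x, x \in t -> hull s x) -> hull t y -> hull s y.
Proof. by move=> ts ty; apply: ty => //; exact: hull_convex. Qed.

Definition centre s : pt := fun i => (\sum_(x <- s) x i) / (size s)%:R.

(** The barycentre of x :: s is a convex combination of x and the barycentre of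
    s. *)
Lemma hull_centre s : s <> [::] -> hull s (centre s).
Proof.
case: s => // x s _; elim: s x => [|y s IH] x.
  move=> C CC; move=> /(_ x (mem_head _ _)); congr C.
  by apply/funext => i; rewrite /centre big_seq1 divr1.
have k0 : ((size s).+2%:R : R) != 0 by rewrite pnatr_eq0.
have k1 : ((size s).+1%:R : R) != 0 by rewrite pnatr_eq0.
have -> : centre [:: x, y & s] = fun i => (size s).+2%:R^-1 * x i
    + (1 - (size s).+2%:R^-1) * centre (y :: s) i.
  apply/funext => i; rewrite /centre big_cons /=.
  set S := \sum_(j <- (y :: s)) j i.
  have -> : ((size s).+2%:R : R) = (size s).+1%:R + 1 by rewrite natr1.
  have : ((size s).+1%:R + 1 : R) != 0 by rewrite natr1.
  move: ((size s).+1%:R : R) k1 => K K0 K1.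
  by field; rewrite K1 K0.
apply: hull_convex.
- by rewrite invr_ge0.
- by rewrite invf_le1 ?ltr0n // ler1n.
- by apply: hull_mem; rewrite mem_head.
- by move=> C CC Cs; apply: IH => // z zs; apply: Cs; rewrite inE zs orbT.
Qed.

Definition ball_pred y (r : R) x := forall i, `|x i - y i| <= r.

Lemma ball_convex y r : convex_pred (ball_pred y r).
Proof.
move=> x z c c0 c1 hx hz i; have c1' : 0 <= 1 - c by rewrite subr_ge0.
have -> : c * x i + (1 - c) * z i - y i = c * (x i - y i) + (1 - c) * (z i - y i) by ring.
apply: le_trans (ler_normD _ _) _; rewrite !normrM (ger0_norm c0) (ger0_norm c1').
have -> : r = c * r + (1 - c) * r by ring.
by apply: lerD; apply: ler_wpM2l.
Qed.

Definition diam_le (d : R) s := forall x y, x \in s -> y \in s -> ball_pred y d x.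

Lemma ball_predC x y r : ball_pred x r y -> ball_pred y r x.
Proof. by move=> h i; rewrite distrC. Qed.

Lemma hull_diam d s x y : diam_le d s -> hull s x -> y \in s -> ball_pred y d x.
Proof. by move=> ds hx ys; apply: hx; [exact: ball_convex | move=> z zs; exact: ds]. Qed.

(** Among the k = size s <= M terms y - x averaged by the barycentre, one is zero,
    so the distance is at most (k - 1) / k times the diameter. *)
Lemma centre_near (M : nat) d s x : 0 <= d -> diam_le d s -> (size s <= M)%N -> x \in s ->
  ball_pred (centre s) ((1 - M%:R^-1) * d) x.
Proof.
move=> d0 ds sM xs; apply: ball_predC => i.
have k0 : (0 < size s)%N by case: (s) xs.
have kR : 0 < ((size s)%:R : R) by rewrite ltr0n.
have -> : centre s i - x i = (\sum_(y <- s) (y i - x i)) / (size s)%:R.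
  rewrite /centre sumrB big_const_seq count_predT iter_addr_0 -mulr_natr.
  by field; rewrite gt_eqF.
rewrite normrM normfV (ger0_norm (ltW kR)) ler_pdivrMr //.
have /= ps := perm_to_rem xs; rewrite (perm_big _ ps) big_cons /= subrr add0r.
apply: le_trans (ler_norm_sum _ _ _) _.
apply: (@le_trans _ _ (\sum_(y <- rem x s) d)).
  rewrite !big_seq; apply: ler_sum => y ys; apply: ds => //; exact: mem_rem ys.
rewrite big_const_seq count_predT iter_addr_0 size_rem //.
have -> : d *+ (size s).-1 = ((size s)%:R - 1) * d.
  by rewrite -[LHS]mulr_natl -subn1 natrB.
rewrite mulrAC; apply: ler_wpM2r => //.
have M0 : 0 < (M%:R : R) by rewrite ltr0n; lia.
have : M%:R^-1 * (size s)%:R <= 1 :> R by rewrite mulrC ler_pdivrMr // mul1r ler_nat.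
by rewrite mulrBl mul1r; lra.
Qed.

(** The factor 1 - 1/M does not depend on the tuple, as long as its size is at most
    M; this is what makes the mesh of iterated subdivisions tend to 0. *)
Lemma sd_mesh (M : nat) d s : 0 <= d -> diam_le d s -> (size s <= M)%N ->
  gspan (fun t => [/\ size t = size s, inside hull s t & diam_le ((1 - M%:R^-1) * d) t])
    (sd centre (gen s)).
Proof.
move=> d0; have [n] := ubnP (size s); elim: n s => // n IH [_ _ _|x s /= sn ds sM].
  by rewrite sd_nil; apply: gspan_gen.
set u := x :: s in ds *; have u0 : u <> [::] by [].
rewrite sd_gen //.
have q0 : 0 <= (1 - M%:R^-1) * d.
  rewrite mulr_ge0 // subr_ge0 invf_le1 ?ler1n ?ltr0n; lia.
have h : gspan (fun t => [/\ size t = size s, inside hull u t & diam_le ((1 - M%:R^-1) * d) t])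
    (sd centre (bd (gen u))).
  apply: gspan_ext (bd_span u) => t [tu /= et].
  have tsub := mem_subseq tu.
  have := IH t; rewrite et => /(_ _ _ _)/gspan_sub; apply => //; last lia.
  - move=> v [ev iv dv]; split=> //.
    by apply: inside_trans iv; [exact: hull_trans | exact: (sub_inside hull_mem)].
  - by move=> y z /tsub yu /tsub zu; exact: ds.
apply: gspan_ext h => t [et it dt]; rewrite /= cone_gen; apply: gspan_gen; split.
- by rewrite /= et.
- by move=> y; rewrite inE => /orP[/eqP ->|/it //]; exact: hull_centre.
have near y : y \in t -> ball_pred (centre u) ((1 - M%:R^-1) * d) y.
  move=> /it; apply; first exact: ball_convex.
  by move=> z zu; apply: centre_near.
move=> y z; rewrite !inE => /orP[/eqP ->|yt] /orP[/eqP ->|zt].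
- by move=> i; rewrite subrr normr0.
- exact/ball_predC/near.
- exact: near.
- exact: dt.
Qed.

(** The lower bound m on the total mass makes this set of functions closed under
    coordinatewise limits and away from 0.  The list F may have repetitions. *)
Definition orthant F m x := [/\ forall i, 0 <= x i,
  forall i, i \notin F -> x i = 0 & m <= \sum_(i <- F) x i].

Lemma orthant_convex F m : convex_pred (orthant F m).
Proof.
move=> x y c c0 c1 [x0 xF xm] [y0 yF ym]; have c1' : 0 <= 1 - c by rewrite subr_ge0.
split.
- by move=> i; rewrite addr_ge0 // mulr_ge0.
- by move=> i iF; rewrite xF // yF // !mulr0 addr0.
rewrite big_split /= -!mulr_sumr.
have -> : m = c * m + (1 - c) * m by ring.
by apply: lerD; apply: ler_wpM2l.
Qed.

Definition facet F x := [/\ forall i, 0 <= x i,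
  forall i, i \notin F -> x i = 0 & exists i, 0 < x i].
Definition good x := exists F, facet F x.

Lemma orthant_facet F m x : 0 < m -> orthant F m x -> facet F x.
Proof.
move=> m0 [x0 xF xm]; split=> //; apply: contrapT => /forallNP nx.
have : \sum_(i <- F) x i <= 0.
  by rewrite big1 // => i _; apply/eqP; rewrite eq_le x0 andbT leNgt; apply/negP/nx.
by rewrite leNgt (lt_le_trans m0 xm).
Qed.

Lemma facet_orthant F x : facet F x -> exists2 m, 0 < m & orthant F m x.
Proof.
move=> [x0 xF [i xi]]; exists (\sum_(i <- F) x i); last by [].
have iF : i \in F by apply: contraT => /xF e; rewrite e ltxx in xi.
rewrite (big_rem i) //= ltr_pwDl // sumr_ge0 //.
Qed.

Lemma orthant_sub F F' m m' x : m' <= m -> orthant F m x -> orthant (F ++ F') m' x /\ orthant (F' ++ F) m' x.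
Proof.
move=> mm [x0 xF xm]; split; split=> //.
- by move=> i; rewrite mem_cat negb_or => /andP[/xF].
- rewrite big_cat /= (le_trans mm) // (le_trans xm) // lerDl sumr_ge0 //.
- by move=> i; rewrite mem_cat negb_or => /andP[_ /xF].
- rewrite big_cat /= (le_trans mm) // (le_trans xm) // lerDr sumr_ge0 //.
Qed.

Lemma good_seq s : (forall x, x \in s -> good x) ->
  exists F m, 0 < m /\ forall x, x \in s -> orthant F m x.
Proof.
elim: s => [_|x s IH h]; first by exists [::], 1; split.
have [F [m [m0 hs]]] : exists F m, 0 < m /\ forall x, x \in s -> orthant F m x.
  by apply: IH => y ys; apply: h; rewrite inE ys orbT.
have [F' /facet_orthant[m' m'0 hx]] := h x (mem_head _ _).
exists (F ++ F'), (Num.min m m'); split; first by rewrite lt_min m0.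
move=> y; rewrite inE => /orP[/eqP ->|/hs hy].
  by have [] := orthant_sub F (m' := Num.min m m') _ hx; rewrite ?ge_min ?lexx ?orbT.
by have [] := orthant_sub F' (m' := Num.min m m') _ hy; rewrite ?ge_min ?lexx ?orbT.
Qed.

Lemma good_diam s : (forall x, x \in s -> good x) ->
  exists2 d, 0 <= d & diam_le d s.
Proof.
move=> /good_seq[F [m [m0 h]]].
pose d := \sum_(x <- s) \sum_(i <- F) x i.
have pos x : x \in s -> forall i, 0 <= x i by move=> /h[].
have S0 x : x \in s -> 0 <= \sum_(i <- F) x i by move=> xs; apply: sumr_ge0 => i _; exact: pos.
have bound x i : x \in s -> x i <= d.
  move=> xs; rewrite /d (big_rem x) //=; have [iF|iF] := boolP (i \in F).
    rewrite (big_rem i iF) /= -addrA lerDl addr_ge0 //; first by apply: sumr_ge0 => j _; exact: pos.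
    by rewrite big_seq; apply: sumr_ge0 => y /mem_rem ys; exact: S0.
  have [_ -> // _] := h x xs; apply: addr_ge0; first exact: S0.
  by rewrite big_seq; apply: sumr_ge0 => y /mem_rem ys; exact: S0.
exists d; first by rewrite /d big_seq; apply: sumr_ge0 => x; exact: S0.
move=> x y xs ys i; rewrite ler_norml; apply/andP; split.
  by have := bound y i ys; have := pos x xs i; lra.
by have := bound x i xs; have := pos y ys i; lra.
Qed.
End ConvexHull.

(** * Iterated subdivisions become small *)

Section SmallSimplices.
Variables (R : realType) (I : choiceType) (L : Type).
Notation pt := (I -> R).
Implicit Types (x y : pt) (s t u : seq pt) (F : seq I).
Variables (l0 : L) (cov : L -> pt -> Prop).
Hypothesis cov_open : forall F x, facet F x -> exists l, exists2 d, 0 < d &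
  forall y, facet F y -> ball_pred x d y -> cov l y.

Definition small s := (forall y, y \in s -> good y) /\
  exists l, forall y, hull s y -> cov l y.

Lemma small_inside s t : inside (@hull R I) s t -> small s -> small t.
Proof.
move=> st [gs [l hl]]; split.
  move=> y /st hy; have [F [m [m0 h]]] := good_seq gs.
  exists F; apply: (orthant_facet m0); apply: hy h; exact: orthant_convex.
by exists l => y /(hull_trans st); exact: hl.
Qed.

Lemma geometric_small (q d e : R) : 0 <= q -> q < 1 -> 0 < e ->
  exists n, q ^+ n * d < e.
Proof.
move=> q0 q1 e0; have d1 : 0 < `|d| + 1 by rewrite ltr_wpDl.
have : `|q| < 1 by rewrite ger0_norm.
move=> /cvg_expr/cvgrPdist_lt/(_ (e / (`|d| + 1))); rewrite divr_gt0 // => /(_ isT).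
move=> [n _ /(_ n (leqnn n))] /=; rewrite sub0r normrN ltr_pdivlMr //.
rewrite ger0_norm ?exprn_ge0 // => h; exists n; apply: le_lt_trans h.
by apply: ler_wpM2l; [exact: exprn_ge0 | have := ler_norm d; lra].
Qed.

Let bad n u := size u = n /\
  forall m, ~ gspan (smalln small n) (iter m (sd (@centre R I)) (gen u)).

(** If all terms of the subdivision of u eventually became small, so would u. *)
Lemma bad_refine M d u : 0 <= d -> bad M u -> diam_le d u -> (0 < M)%N ->
  exists t, [/\ bad M t, inside (@hull R I) u t & diam_le ((1 - M%:R^-1) * d) t].
Proof.
move=> d0 [uM bu] du M0; apply: contrapT => nt.
have [|m hm] := @eventually_small_chain _ (@centre R I) (@hull R I) (@hull_mem R I) (@hull_centre R I)
  (@hull_trans R I) small small_inside M (sd (@centre R I) (gen u)).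
  have := sd_mesh d0 du; rewrite uM => /(_ M (leqnn M)).
  apply: gspan_sub => t [tM it dt]; apply: contrapT => /forallNP bt; apply: nt.
  by exists t; split.
by apply: (bu m.+1); rewrite iterSr.
Qed.

(** A nested-simplices argument: a tuple that never becomes small contains a term of
    its subdivision with the same defect, and so on.  The resulting sequence
    shrinks to a point z, some neighbourhood of which lies in one set of the
    cover; a late member of the sequence is contained in it. *)
Lemma eventually_small s : (forall y, y \in s -> good y) ->
  exists m, gspan (smalln small (size s)) (iter m (sd (@centre R I)) (gen s)).
Proof.
move=> gs; apply: contrapT => /forallNP bs.
set M := size s in bs; have M0 : (0 < M)%N.
  rewrite lt0n; apply/eqP => /size0nil s0; apply: (bs 0%N) => /=.
  apply: gspan_gen; split=> //; split=> //.
  by exists l0 => y; rewrite s0 => /(_ (fun=> False)) h; exfalso; apply: h.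
have [d d0 ds] := good_diam gs; have [F [m [m0 hF]]] := good_seq gs.
set q := 1 - M%:R^-1 : R.
have q0 : 0 <= q by rewrite subr_ge0 invf_le1 ?ler1n ?ltr0n.
have q1 : q < 1 by rewrite ltrBlDr ltrDl invr_gt0 ltr0n.
pose St n u := [/\ bad M u, inside (@hull R I) s u & diam_le (q ^+ n * d) u].
have qd0 n : 0 <= q ^+ n * d by rewrite mulr_ge0 // exprn_ge0.
have /choice[nxt nxtP] : forall nu : nat * seq pt, exists t,
    St nu.1 nu.2 -> St nu.1.+1 t /\ inside (@hull R I) nu.2 t.
  move=> [n u]; have [[bu iu du]|h] := pselect (St n u); last by exists [::].
  have [t [bt it dt]] := bad_refine (qd0 n) bu du M0.
  exists t => _; split=> //; split=> //; first exact: (inside_trans (@hull_trans R I) iu it).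
  by rewrite exprS -mulrA.
pose u := nat_rect (fun=> seq pt) s (fun n v => nxt (n, v)).
have uS n : St n (u n).
  elim: n => [|n /(nxtP (n, u n))[] //]; split=> //; last by rewrite expr0 mul1r.
  exact: (sub_inside (@hull_mem R I)).
have uin n k : inside (@hull R I) (u n) (u (n + k)%N).
  elim: k => [|k IH]; first by rewrite addn0; exact: (sub_inside (@hull_mem R I)).
  rewrite addnS; apply: (inside_trans (@hull_trans R I) IH).
  by have [] := nxtP (n + k, u (n + k))%N (uS _).
pose x n := head (fun=> 0) (u n).
have xu n : x n \in u n.
  have : (0 < size (u n))%N by have [[-> _] _ _] := uS n.
  by rewrite /x; case: (u n) => [//|v w] _; exact: mem_head.
have xd n k : ball_pred (x n) (q ^+ n * d) (x (n + k)%N).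
  have [_ _ dn] := uS n; apply: (hull_diam dn); last exact: xu.
  exact: (uin n k _ (xu _)).
have xF n : orthant F m (x n).
  have [_ iu _] := uS n; apply: (iu _ (xu n)) hF; exact: orthant_convex.
(* The i-th coordinate of the limit is the supremum of the lower bounds, one for
   each n, which it has to satisfy. *)
pose E i := [set x n i - q ^+ n * d | n in setT].
pose z i := sup (E i).
have ub i n : ubound (E i) (x n i + q ^+ n * d).
  move=> _ [k _ <-]; have [nk|kn] := leqP n k.
    have := xd n (k - n)%N i; rewrite subnKC // => /ler_normlP[_].
    by have := qd0 k; lra.
  have := xd k (n - k)%N i; rewrite subnKC ?(ltnW kn) // => /ler_normlP[].
  by have := qd0 n; lra.
have zx n : ball_pred (x n) (q ^+ n * d) z.
  move=> i; apply/ler_normlP; split.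
    suff : x n i - q ^+ n * d <= z i by lra.
    by apply: ub_le_sup; [exists (x 0%N i + q ^+ 0 * d); exact: ub | exists n].
  suff : z i <= x n i + q ^+ n * d by lra.
  by apply: ge_sup; [exists (x 0%N i - q ^+ 0 * d); exists 0%N | exact: ub].
have arch c r : (forall n, r <= q ^+ n * c) -> r <= 0.
  move=> h; rewrite leNgt; apply/negP => r0.
  by have [n] := geometric_small c q0 q1 r0; rewrite ltNge h.
have zF : orthant F m z.
  split.
  - move=> i; rewrite -oppr_le0; apply: (arch d) => n.
    by have /ler_normlP[] := zx n i; have [/(_ i) x0 _ _] := xF n; lra.
  - move=> i iF; apply/eqP; rewrite -normr_le0; apply: (arch d) => n.
    by have := zx n i; have [_ /(_ i iF) -> _] := xF n; rewrite subr0.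
  rewrite -subr_le0; apply: (arch ((size F)%:R * d)) => n.
  have [_ _ xm] := xF n.
  have : \sum_(i <- F) x n i <= \sum_(i <- F) (z i + q ^+ n * d).
    by apply: ler_sum => i _; have /ler_normlP[] := zx n i; lra.
  rewrite big_split /= big_const_seq count_predT iter_addr_0 -mulr_natl mulrCA.
  by lra.
have [l [e e0 he]] := cov_open (orthant_facet m0 zF).
have [n hn] : exists n, q ^+ n * (2 * d) < e by exact: geometric_small.
have [[uM bu] iu du] := uS n; apply: (bu 0%N) => /=; apply: gspan_gen; split=> //.
have oF y : hull (u n) y -> orthant F m y.
  by move=> hy; apply: hy; [exact: orthant_convex | move=> v /iu; apply; [exact: orthant_convex | exact: hF]].
split.
  by move=> y yu; exists F; apply: (orthant_facet m0); apply: oF; exact: hull_mem.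
exists l => y hy; apply: he; first exact: (orthant_facet m0 (oF _ hy)).
move=> i; apply: le_trans (ltW hn).
have := hull_diam du hy (xu n) i => /ler_normlP[h1 h2].
have /ler_normlP[h3 h4] := zx n i.
by apply/ler_normlP; split; lra.
Qed.
End SmallSimplices.

(** * Anchors and extremal coordinates *)

(** A representative is chosen in each orbit; by freeness a point is reached from
    its representative by exactly one group element. *)
Lemma free_anchor (A : groupType) (X : Type) (ax : A -> X -> X) (D : X -> Prop) :
  (forall x, ax 1%g x = x) -> (forall a b x, ax (a * b)%g x = ax a (ax b x)) ->
  (forall a x, D x -> D (ax a x)) -> (forall a x, D x -> ax a x = x -> a = 1%g) ->
  exists r : X -> A, forall a x, D x -> r (ax a x) = (a * r x)%g.
Proof.
move=> ax1 axM aD afree.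
have axK a x : ax a^-1%g (ax a x) = x by rewrite -axM mulVg ax1.
pose orb x y := exists a, y = ax a x.
have orb_act a x : orb (ax a x) = orb x.
  apply/funext => y; apply/propext; split=> [[b ->]|[b ->]].
    by exists (b * a)%g; rewrite axM.
  by exists (b * a^-1)%g; rewrite -axM mulgVK.
pose rep x := if pselect (exists y, orb x y) is left e then projT1 (cid e) else x.
have repP x : exists a, x = ax a (rep x).
  rewrite /rep; case: pselect => [e|[]]; last by exists x, 1%g; rewrite ax1.
  by case: (cid e) => y /= oy; have [a ->] := oy; exists a^-1%g; rewrite axK.
have rep_act a x : rep (ax a x) = rep x.
  rewrite /rep orb_act; case: pselect => // -[]; by exists x, 1%g; rewrite ax1.
have [r rP] := choice repP; exists r => a x Dx.
have Drep : D (rep x) by rewrite -(axK (r x) (rep x)) -rP; exact: aD.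
have : ax ((a * r x)^-1 * r (ax a x))%g (rep x) = rep x.
  have e1 : ax (r (ax a x)) (rep x) = ax a x by rewrite -(rep_act a x) -rP.
  have e2 : ax (a * r x)%g (rep x) = ax a x by rewrite axM -rP.
  by rewrite axM e1 -e2 axK.
by move=> /(afree _ _ Drep)/mulg1_eq; rewrite invgK.
Qed.

(** Translates of a point of S by powers of the stabilising element remain in the
    finite set S, so two of them coincide. *)
Lemma torsion_free_stab (A : groupType) (S : set A) (F : seq A) (a : A) :
  torsion_free A -> S !=set0 -> (forall b, S b -> b \in F) ->
  (fun b => S (a^-1 * b)%g) = S -> a = 1%g.
Proof.
move=> tf [b Sb] SF aS.
have Sn n : S ((a^-1 ^+ n) * b)%g.
  elim: n => [|n IH]; first by rewrite expg0 mul1g.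
  rewrite expgS -mulgA.
  by have := congr1 (fun T : set A => T ((a^-1 ^+ n) * b)%g) aS => /= ->.
pose f n := (a^-1 ^+ n * b)%g.
have /uniqPn : ~~ uniq [seq f n | n <- iota 0 (size F).+1].
  apply/negP => us; have : (size [seq f n | n <- iota 0 (size F).+1] <= size F)%N.
    by apply: uniq_leq_size => // _ /mapP[n _ ->]; exact/SF/Sn.
  by rewrite size_map size_iota ltnn.
move=> /(_ 1%g)[i [j [ij]]]; rewrite size_map size_iota => jF.
rewrite !(nth_map 0%N) ?size_iota ?(ltn_trans ij) // !nth_iota ?(ltn_trans ij) // !add0n.
rewrite /f => /mulIg e; apply: invg_inj; rewrite invg1.
apply: (tf _ (j - i)%N); first by rewrite subn_gt0.
by rewrite expgnFr ?(ltnW ij) // e mulgV.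
Qed.

Section MinMax.
Variables (R : realType) (I : choiceType).
Implicit Types (x y : I -> R) (F : seq I).

Fixpoint max_on F x : R := if F is i :: F' then Num.max (x i) (max_on F' x) else 0.
Fixpoint min_from (c : R) F x : R := if F is i :: F' then Num.min (x i) (min_from c F' x) else c.
(** Starting from the maximum gives the true minimum on non-empty lists. *)
Definition min_on F x := min_from (max_on F x) F x.

Lemma mx_ge F x i : i \in F -> x i <= max_on F x.
Proof.
elim: F => //= j F IH; rewrite inE => /orP[/eqP ->|/IH h]; rewrite le_max ?lexx //.
by rewrite h orbT.
Qed.
Lemma mx_le F x c : 0 <= c -> (forall i, i \in F -> x i <= c) -> max_on F x <= c.
Proof.
move=> c0; elim: F => //= j F IH h; rewrite ge_max h ?mem_head //= IH // => i iF.
by apply: h; rewrite inE iF orbT.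
Qed.
Lemma mx_ge0 F x : 0 <= max_on F x.
Proof. by elim: F => //= i F IH; rewrite le_max IH orbT. Qed.
Lemma mn_le_mx c F x : min_from c F x <= c.
Proof. by elim: F => //= i F IH; rewrite ge_min IH orbT. Qed.
Lemma mn_le c F x i : i \in F -> min_from c F x <= x i.
Proof.
elim: F => //= j F IH; rewrite inE => /orP[/eqP ->|/IH h]; rewrite ge_min ?lexx //.
by rewrite h orbT.
Qed.
Lemma mn_ge c d F x : d <= c -> (forall i, i \in F -> d <= x i) -> d <= min_from c F x.
Proof.
move=> dc; elim: F => //= j F IH h; rewrite le_min h ?mem_head //= IH // => i iF.
by apply: h; rewrite inE iF orbT.
Qed.
Lemma mu_le F x i : i \in F -> min_on F x <= x i. Proof. exact: mn_le. Qed.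
Lemma mu_le_mx F x : min_on F x <= max_on F x. Proof. exact: mn_le_mx. Qed.
Lemma mu_ge F x d : d <= max_on F x -> (forall i, i \in F -> d <= x i) -> d <= min_on F x.
Proof. exact: mn_ge. Qed.
Lemma mu_ge0 F x : (forall i, 0 <= x i) -> 0 <= min_on F x.
Proof. by move=> x0; apply: mu_ge => //; exact: mx_ge0. Qed.

Lemma mu_attained F x : F <> [::] -> exists2 i, i \in F & x i = min_on F x.
Proof.
move=> F0; have [i iF ile] : exists2 i, i \in F & x i <= min_from (max_on F x) F x.
  have : (exists2 i, i \in F & x i <= min_from (max_on F x) F x) \/ max_on F x <= min_from (max_on F x) F x.
    move: (max_on F x) => c; elim: {F0}F => [|j F [[i iF h]|h]] /=; first by right.
      have [le|lt] := leP (x j) (min_from c F x).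
        by left; exists j; rewrite ?mem_head.
      by left; exists i; rewrite ?inE ?iF ?orbT.
    have [le|lt] := leP (x j) (min_from c F x).
      by left; exists j; rewrite ?mem_head.
    by right.
  case=> // h; case: F F0 h => // j F _ h; exists j; first exact: mem_head.
  by apply: le_trans h; apply: mx_ge; exact: mem_head.
by exists i => //; apply/eqP; rewrite eq_le ile mu_le.
Qed.

Lemma mx_eq F F' x : F =i F' -> max_on F x = max_on F' x.
Proof.
move=> e; apply/eqP; rewrite eq_le; apply/andP; split; apply: mx_le => [|i].
- exact: mx_ge0.
- by rewrite e; exact: mx_ge.
- exact: mx_ge0.
- by rewrite -e; exact: mx_ge.
Qed.
Lemma mu_eq F F' x : F =i F' -> min_on F x = min_on F' x.
Proof.
move=> e; apply/eqP; rewrite eq_le; apply/andP; split; apply: mu_ge => [|i].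
- by rewrite -(mx_eq _ e) mu_le_mx.
- by rewrite -e; exact: mu_le.
- by rewrite (mx_eq _ e) mu_le_mx.
- by rewrite e; exact: mu_le.
Qed.
Lemma mx_map (f : I -> I) F x : max_on (map f F) x = max_on F (x \o f).
Proof. by elim: F => //= i F ->. Qed.
Lemma mu_map (f : I -> I) F x : min_on (map f F) x = min_on F (x \o f).
Proof.
by rewrite /min_on mx_map; move: (max_on F _) => c; elim: F => //= i F ->.
Qed.

Lemma mx_lip F x y d : 0 <= d -> ball_pred x d y -> max_on F y <= max_on F x + d.
Proof.
move=> d0 h; apply: mx_le; first by rewrite addr_ge0 // mx_ge0.
by move=> i iF; have /ler_normlP[_] := h i; have := mx_ge x iF; lra.
Qed.
Lemma mu_lip F x y d : 0 <= d -> ball_pred x d y -> min_on F x - d <= min_on F y.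
Proof.
move=> d0 h; apply: mu_ge.
  have := mx_lip F d0 (ball_predC h); have := mu_le_mx F x; lra.
by move=> i iF; have /ler_normlP[+ _] := h i; have := mu_le x iF; lra.
Qed.
End MinMax.

(** * An equivariant map from a cone of functions *)

(** [h] contracts E to e0, and [h_cont] is its joint continuity on E x [0, 1].  [r]
    is an equivariant choice of an element of A for each finite non-empty
    subset. *)
Section EquivariantMap.
Variables (R : realType) (A : groupType) (E : topologicalType).
Hypothesis tfA : torsion_free A.
Variable act : A -> E -> E.
Hypothesis act_cont : continuous_action act.
Variables (e0 : E) (h : E -> R -> E).
Hypothesis h0 : forall e, h e 0 = e.
Hypothesis h1 : forall e, h e 1 = e0.
Hypothesis h_cont : forall e t, 0 <= t -> t <= 1 -> forall O : set E, open O -> O (h e t) ->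
  exists B : set E, [/\ open B, B e & exists2 d, 0 < d &
    forall e' t', B e' -> 0 <= t' -> t' <= 1 -> `|t' - t| <= d -> O (h e' t')].
Notation pt := (A -> R).
Implicit Types (x y : pt) (F : seq A) (a b : A).

Let act1 e : act 1%g e = e. Proof. by case: act_cont. Qed.
Let actM a b e : act (a * b)%g e = act a (act b e). Proof. by case: act_cont. Qed.
Let act_c a : continuous (act a). Proof. by case: act_cont. Qed.
Let actK a e : act a^-1%g (act a e) = e. Proof. by rewrite -actM mulVg. Qed.
Let actKV a e : act a (act a^-1%g e) = e. Proof. by rewrite -actM mulgV. Qed.

Definition pact a x : pt := fun b => x (a^-1 * b)%g.
Lemma pact1 x : pact 1%g x = x.
Proof. by apply/funext => b; rewrite /pact invg1 mul1g. Qed.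
Lemma pactM a b x : pact (a * b)%g x = pact a (pact b x).
Proof. by apply/funext => c; rewrite /pact invgM mulgA. Qed.

Definition supp x : set A := [set b | x b != 0].
Definition listed (S : set A) F := uniq F /\ forall b, (b \in F) <-> S b.
Definition enum_set (S : set A) : seq A :=
  if pselect (exists F, listed S F) is left e then projT1 (cid e) else [::].

Lemma enum_setP S F : (forall b, S b -> b \in F) -> listed S (enum_set S).
Proof.
move=> SF; rewrite /enum_set; case: pselect => [e|ne]; first by case: (cid e).
exfalso; apply: ne; exists [seq b <- undup F | `[< S b >]]; split.
  by rewrite filter_uniq // undup_uniq.
move=> b; rewrite mem_filter mem_undup; split=> [/andP[/asboolP]//|Sb].
by rewrite SF // andbT; apply/asboolP.
Qed.

Lemma supp_listed F x : facet F x -> listed (supp x) (enum_set (supp x)).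
Proof.
move=> [_ xF _]; apply: (@enum_setP _ F) => b; rewrite /supp /= => xb.
by apply: contraNT xb => /xF ->.
Qed.

Variable r : set A -> A.
Definition translate a (S : set A) : set A := fun b => S (a^-1 * b)%g.
Hypothesis r_act : forall a S, S !=set0 /\ (exists F : seq A, forall b, S b -> b \in F) ->
  r (translate a S) = (a * r S)%g.

(** The central projection of x, from the constant function on F to the boundary of
    the cone over F; [param] measures the closeness to the constant function, and
    is 1 on a neighbourhood of it. *)
Definition lower F x : pt := fun a => if a \in F then x a - min_on F x else 0.
Definition param F x : R := Num.min 1 (2 * min_on F x / max_on F x).

(** The face spanned by the support of x is viewed as the cone on its boundary: on
    the ray through x the boundary value at [lower F x] is moved by the
    contraction h up to time [param F x].  Conjugating by r (supp x) makes the
    contraction, which is not equivariant, independent of translations. *)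
Fixpoint eqv_mapn n x : E :=
  if n is n'.+1 then
    let F := enum_set (supp x) in
    act (r (supp x)) (h (act (r (supp x))^-1%g (eqv_mapn n' (lower F x))) (param F x))
  else e0.
Definition card x := size (enum_set (supp x)).
Definition eqv_map x := eqv_mapn (card x) x.

Lemma good_supp F x : facet F x ->
  supp x !=set0 /\ (exists F : seq A, forall b, supp x b -> b \in F).
Proof.
move=> [x0 xF [b xb]]; split; first by exists b; rewrite /supp /= gt_eqF.
by exists F => c; rewrite /supp /=; apply: contraNT => /xF ->.
Qed.

Lemma mx_gt0 F x : facet F x -> 0 < max_on F x.
Proof.
move=> [x0 xF [b xb]]; apply: (lt_le_trans xb); apply: mx_ge.
by apply: contraT => /xF e; rewrite e ltxx in xb.
Qed.

Lemma facet_self F x : facet F x -> facet (enum_set (supp x)) x.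
Proof.
move=> fx; have [_ lx] := supp_listed fx; case: fx => x0 xF ex; split=> // b bF.
by apply/eqP; apply: contraNT bF => xb; apply/lx.
Qed.

Lemma card_gt0 F x : facet F x -> (0 < card x)%N.
Proof.
move=> fx; have [_ lx] := supp_listed fx; have [[b /lx bx] _] := good_supp fx.
by rewrite /card; move: bx; case: (enum_set (supp x)) => [|c F'].
Qed.

Lemma lower_facet F x : facet F x -> min_on F x < max_on F x ->
  facet F (lower F x) /\ exists2 b, b \in F & lower F x b = 0.
Proof.
move=> fx lt; have [x0 xF _] := fx; have F0 : F <> [::] by move=> e; rewrite e /min_on /= ltxx in lt.
split; last by have [b bF e] := mu_attained x F0; exists b => //; rewrite /lower bF e subrr.
split.
- by move=> b; rewrite /lower; case: ifP => // bF; rewrite subr_ge0 mu_le.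
- by move=> b /negbTE bF; rewrite /lower bF.
apply: contrapT => /forallNP nx; suff : max_on F x <= min_on F x by rewrite leNgt lt.
apply: mx_le; first exact: mu_ge0.
by move=> b bF; have /negP := nx b; rewrite /lower bF -leNgt subr_le0.
Qed.

Lemma param_ge0 F x : (forall b, 0 <= x b) -> 0 <= param F x.
Proof. by move=> x0; rewrite le_min ler01 divr_ge0 ?mulr_ge0 ?mu_ge0 ?mx_ge0. Qed.
Lemma param_le1 F x : param F x <= 1.
Proof. by rewrite ge_min lexx. Qed.

Lemma param_eq1 F x : facet F x -> max_on F x <= 2 * min_on F x -> param F x = 1.
Proof.
move=> fx le; apply/eqP; rewrite eq_le param_le1 le_min lexx /=.
by rewrite ler_pdivlMr ?mx_gt0 // mul1r.
Qed.

Lemma lower_card x : (exists F, facet F x) -> let F := enum_set (supp x) in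
  min_on F x < max_on F x -> (card (lower F x) < card x)%N.
Proof.
move=> [F fx] G lt; have fG := facet_self fx.
have [fl [b bG lb]] := lower_facet fG lt.
have [ul ll] := supp_listed fl; have [uG lG] := supp_listed fx.
have : (size (b :: enum_set (supp (lower G x))) <= size G)%N.
  apply: uniq_leq_size => [|c]; first by rewrite /= ul andbT; apply/negP => /ll; rewrite /supp /= lb eqxx.
  rewrite inE => /orP[/eqP -> //|/ll]; rewrite /supp /= /lower; case: ifP => //.
  by rewrite eqxx.
by [].
Qed.

(** Each step loses a coordinate of the support, unless the parameter is 1, when h
    is constant and the recursive value is irrelevant. *)
Lemma eqv_mapn_stable N n m x : (n <= N)%N -> (m <= N)%N -> (card x <= n)%N -> (card x <= m)%N ->
  (exists F, facet F x) -> eqv_mapn n x = eqv_mapn m x.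
Proof.
elim: N n m x => [|N IH] n m x nN mN cn cm fx; have [F fF] := fx.
  by have := card_gt0 fF; lia.
have c0 := card_gt0 fF.
case: n nN cn => [|n] nN cn; first lia.
case: m mN cm => [|m] mN cm; first lia.
rewrite /=; set G := enum_set _; have fG : facet G x by exact: facet_self fF.
have [le|lt] := leP (max_on G x) (2 * min_on G x).
  by rewrite param_eq1 // !h1.
have lt' : min_on G x < max_on G x.
  by have [x0 _ _] := fG; have := mu_ge0 G x0; lra.
have cl : (card (lower G x) < card x)%N by exact: lower_card.
rewrite (IH n m) //; try lia.
by exists G; have [] := lower_facet fG lt'.
Qed.

Lemma eqv_mapE F x : facet F x -> let G := enum_set (supp x) in
  eqv_map x = act (r (supp x)) (h (act (r (supp x))^-1%g (eqv_map (lower G x))) (param G x)).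
Proof.
move=> fF G; have fG : facet G x by exact: facet_self fF.
rewrite /eqv_map; have := card_gt0 fF; case e: (card x) => [//|n] _; rewrite [LHS]/= -/G.
have [le|lt] := leP (max_on G x) (2 * min_on G x).
  by rewrite param_eq1 // !h1.
have lt' : min_on G x < max_on G x.
  by have [x0 _ _] := fG; have := mu_ge0 G x0; lra.
have cl : (card (lower G x) < card x)%N by apply: lower_card => //; exists F.
congr (act _ (h (act _ _) _)); apply: (@eqv_mapn_stable n) => //; try lia.
by exists G; have [] := lower_facet fG lt'.
Qed.

Lemma facet_pact a F x : facet F x -> facet (map (fun b => a * b)%g F) (pact a x).
Proof.
move=> [x0 xF [b xb]]; split.
- by move=> c; exact: x0.
- move=> c cF; apply: xF; apply: contra cF => cF; apply/mapP; exists (a^-1 * c)%g => //.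
  by rewrite mulgA mulgV mul1g.
- by exists (a * b)%g; rewrite /pact mulgA mulVg mul1g.
Qed.

Lemma supp_pact a x : supp (pact a x) = translate a (supp x).
Proof. by []. Qed.

Lemma eqv_map_act F a x : facet F x -> eqv_map (pact a x) = act a (eqv_map x).
Proof.
have [n] := ubnP (card x); elim: n F x => // n IH F x cn fx.
have fG := facet_self fx; have fax := facet_pact a fx.
rewrite (eqv_mapE fx) (eqv_mapE fax) supp_pact r_act; last exact: good_supp fx.
set G := enum_set (supp x) in fG *; set G' := enum_set (translate a (supp x)).
have e : G' =i map (fun b => a * b)%g G.
  have [_ lx] := supp_listed fx; have [_ lax] := supp_listed fax.
  move=> b; apply/idP/mapP => [/lax bs|[c /lx cs ->]].
    by exists (a^-1 * b)%g; [apply/lx | rewrite mulgA mulgV mul1g].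
  by apply/lax; rewrite /supp /= /pact mulgA mulVg mul1g.
have px : pact a x \o (fun b => a * b)%g = x.
  by apply/funext => b; rewrite /= /pact mulgA mulVg mul1g.
have em : min_on G' (pact a x) = min_on G x by rewrite (mu_eq _ e) mu_map px.
have eM : max_on G' (pact a x) = max_on G x by rewrite (mx_eq _ e) mx_map px.
have el : lower G' (pact a x) = pact a (lower G x).
  apply/funext => b; rewrite /lower em /pact e.
  suff -> : (b \in map (fun b => a * b)%g G) = ((a^-1 * b)%g \in G) by [].
  apply/mapP/idP => [[c cG ->]|bG]; first by rewrite mulgA mulVg mul1g.
  by exists (a^-1 * b)%g => //; rewrite mulgA mulgV mul1g.
rewrite el /param em eM -/(param G x) actM; congr (act a (act _ _)).
have [le|lt] := leP (max_on G x) (2 * min_on G x); first by rewrite param_eq1 // !h1.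
have lt' : min_on G x < max_on G x.
  by have [x0 _ _] := fG; have := mu_ge0 G x0; lra.
have cl : (card (lower G x) < card x)%N by apply: lower_card => //; exists F.
have [fl _] := lower_facet fG lt'.
congr (h _ _); rewrite (IH G) //; last lia.
by rewrite -actM invgM -mulgA mulVg mulg1.
Qed.

Definition cont_on (P : pt -> Prop) := forall x, P x -> forall O : set E, open O ->
  O (eqv_map x) -> exists2 d, 0 < d & forall y, P y -> ball_pred x d y -> O (eqv_map y).

Lemma facet_remove F b x : facet F x -> x b = 0 -> facet [seq c <- F | c != b] x.
Proof.
move=> [x0 xF ex] xb; split=> // c; rewrite mem_filter negb_and negbK.
by move=> /orP[/eqP ->|/xF].
Qed.

Lemma finite_min (I : eqType) (s : seq I) (P : I -> R -> Prop) :
  (forall i c d, c <= d -> P i d -> P i c) ->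
  (forall i, i \in s -> exists2 d, 0 < d & P i d) ->
  exists2 d, 0 < d & forall i, i \in s -> P i d.
Proof.
move=> mono; elim: s => [_|i s IH hs]; first by exists 1.
have [|d d0 hd] := IH; first by move=> j js; apply: hs; rewrite inE js orbT.
have [c c0 hc] := hs i (mem_head _ _).
exists (Num.min c d); first by rewrite lt_min c0.
move=> j; rewrite inE => /orP[/eqP ->|/hd]; first by apply: mono hc; rewrite ge_min lexx.
by apply: mono; rewrite ge_min lexx orbT.
Qed.

Lemma ball_mono x (c d : R) y : c <= d -> ball_pred x c y -> ball_pred x d y.
Proof. by move=> cd xy i; exact: le_trans cd. Qed.

(** The boundary of a face is the union of its facets x b = 0.  Near x, only those
    facets matter that contain x. *)
Lemma eqv_map_boundary F :
  (forall b, b \in F -> cont_on (facet [seq c <- F | c != b])) ->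
  cont_on (fun x => facet F x /\ exists2 b, b \in F & x b = 0).
Proof.
move=> IH x [fx _] O oO Ox.
have [b c d cd hd y fy yb bc|b bF|d d0 hd] := @finite_min _ F
   (fun b d => forall y, facet F y -> y b = 0 -> ball_pred x d y -> O (eqv_map y)).
- by apply: hd => //; exact: ball_mono bc.
- have [xb|xb] := eqVneq (x b) 0.
    have [d d0 hd] := IH b bF x (facet_remove fx xb) O oO Ox.
    by exists d => // y fy yb; apply: hd; exact: facet_remove.
  have xb0 : 0 < x b by rewrite lt_def xb; have [x0 _ _] := fx; exact: x0.
  exists (x b / 2); first lra.
  by move=> y fy yb /(_ b) /ler_normlP[]; rewrite yb; lra.
by exists d => // y [fy [b bF yb]]; exact: hd bF y fy yb.
Qed.

(** The coning formula holds on the whole closed face, and not only for points of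
    full support: on the boundary the minimum is 0, so the parameter is 0, where h
    is the identity. *)
Lemma eqv_map_cone F x : facet F x ->
  let S := [set b | b \in F] in
  eqv_map x = act (r S) (h (act (r S)^-1%g (eqv_map (lower F x))) (param F x)).
Proof.
move=> fx S; have [x0 xF _] := fx; have [_ lx] := supp_listed fx.
have [[b bF xb]|full] := pselect (exists2 b, b \in F & x b = 0).
  have mu0 : min_on F x = 0 by apply/eqP; rewrite eq_le mu_ge0 // -xb mu_le.
  have -> : lower F x = x.
    apply/funext => c; rewrite /lower mu0 subr0; case: ifPn => // /xF //.
  have -> : param F x = 0 by rewrite /param mu0 mulr0 mul0r; apply/min_idPr; exact: ler01.
  by rewrite h0 actKV.
have eS : supp x = S.
  apply/funext => b; apply/propext; split; rewrite /supp /S /=.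
    by apply: contraNT => /xF ->.
  by move=> bF; apply/eqP => xb; apply: full; exists b.
have eF : enum_set (supp x) =i F.
  by move=> b; apply/idP/idP => [/lx|bF]; [rewrite eS | apply/lx; rewrite eS].
rewrite (eqv_mapE fx) eS; rewrite eS in eF.
have -> : param (enum_set S) x = param F x by rewrite /param (mu_eq _ eF) (mx_eq _ eF).
suff -> : lower (enum_set S) x = lower F x by [].
by apply/funext => b; rewrite /lower (mu_eq _ eF) eF.
Qed.

Lemma min1_lip (u v : R) : `|Num.min 1 u - Num.min 1 v| <= `|u - v|.
Proof.
have := ler_norm (u - v); have := ler_norm (v - u); rewrite (distrC v u).
by case: (leP 1 u) => hu; case: (leP 1 v) => hv h1' h2'; apply/ler_normlP; split; lra.
Qed.

(** Near the constant function the parameter is 1, so that the map is constant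
    there; elsewhere the coning formula is a composite of continuous functions. *)
Lemma eqv_map_interior F :
  cont_on (fun x => facet F x /\ exists2 b, b \in F & x b = 0) -> cont_on (facet F).
Proof.
move=> bd x fx O oO; have M0 := mx_gt0 fx; set M := max_on F x in M0.
have [x0 xF _] := fx; have m0 : 0 <= min_on F x by exact: mu_ge0.
rewrite (eqv_map_cone fx); set S := [set b | b \in F].
have [lt|ge] := ltP M (2 * min_on F x).
  rewrite (param_eq1 fx (ltW lt)) h1 => Oe; exists ((2 * min_on F x - M) / 4); first lra.
  move=> y fy hy; rewrite (eqv_map_cone fy) param_eq1 ?h1 //.
  have d0 : 0 <= (2 * min_on F x - M) / 4 by lra.
  by have := mx_lip F d0 hy; have := mu_lip F d0 hy; rewrite -/M; lra.
set t := param F x => Ot.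
have t0 : 0 <= t by exact: param_ge0.
have lt' : min_on F x < M by lra.
have [fl zl] := lower_facet fx lt'.
have oO' : open (act (r S) @^-1` O) by move: oO; apply: (continuousP _).1.
have [B [oB Be [d d0 hB]]] := h_cont t0 (param_le1 F x) oO' Ot.
have oB' : open (act (r S)^-1%g @^-1` B) by move: oB; apply: (continuousP _).1.
have [c c0 hc] := bd _ (conj fl zl) _ oB' Be.
have [b lb] : exists b, 0 < lower F x b by case: fl.
pose e := Num.min (Num.min (c / 2) (lower F x b / 4)) (Num.min (M / 2) (d * M / 8)).
have e0' : 0 < e by rewrite !lt_min !divr_gt0 // mulr_gt0.
have [e1 e2 e3 e4] : [/\ e <= c / 2, e <= lower F x b / 4, e <= M / 2 & e <= d * M / 8].
  by split; rewrite !ge_min lexx ?orbT.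
exists e => // y fy hy; have [y0 yF _] := fy.
have e0'' := ltW e0'.
have hM := mx_lip F e0'' hy; have hM' := mx_lip F e0'' (ball_predC hy).
have hm := mu_lip F e0'' hy; have hm' := mu_lip F e0'' (ball_predC hy).
rewrite -/M in hM hM'.
have hl : ball_pred (lower F x) c (lower F y).
  move=> i; rewrite /lower; case: ifP => _; last by rewrite subrr normr0 ltW.
  by have /ler_normlP[? ?] := hy i; apply/ler_normlP; split; lra.
have My : 0 < max_on F y by lra.
rewrite (eqv_map_cone fy); apply: hB.
- apply: hc => //; split; last first.
    have F0 : F <> [::] by move=> e'; rewrite /M e' /= ltxx in M0.
    by have [i iF ei] := mu_attained y F0; exists i => //; rewrite /lower iF ei subrr.
  split.
  + by move=> i; rewrite /lower; case: ifP => // iF; rewrite subr_ge0 mu_le.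
  + by move=> i /negbTE iF; rewrite /lower iF.
  exists b; have bF : b \in F by apply: contraT => /negbTE bF; rewrite /lower bF ltxx in lb.
  move: lb e2; rewrite /lower bF => lb e2.
  by have /ler_normlP[? ?] := hy b; lra.
- exact: param_ge0.
- exact: param_le1.
have q : `|2 * min_on F y / max_on F y - 2 * min_on F x / M| <= d.
  have -> : 2 * min_on F y / max_on F y - 2 * min_on F x / M =
     2 * ((min_on F y - min_on F x) * M - min_on F x * (max_on F y - M)) / (max_on F y * M).
    by field; rewrite !gt_eqF.
  rewrite normrM normfV (gtr0_norm (mulr_gt0 My M0)) ler_pdivrMr ?mulr_gt0 // normrM.
  rewrite (ger0_norm (ler0n _ 2)).
  have h1' : `|(min_on F y - min_on F x) * M - min_on F x * (max_on F y - M)| <= e * M + M * e.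
    apply: le_trans (ler_normB _ _) _; rewrite !normrM (gtr0_norm M0) (ger0_norm m0).
    apply: lerD; first by apply: ler_wpM2r; [exact: ltW | apply/ler_normlP; split; lra].
    apply: ler_pM => //; first exact: ltW.
    by apply/ler_normlP; split; lra.
  have h2' : 8 * e <= d * M by lra.
  have h3' : M <= 2 * max_on F y by lra.
  have h4' : d * M * M <= d * M * (2 * max_on F y) by apply: ler_wpM2l => //; rewrite mulr_ge0 ?ltW.
  have h5' : 8 * e * M <= d * M * M by apply: ler_wpM2r => //; exact: ltW.
  by lra.
apply: le_trans q; rewrite /t /param -/M.
exact: min1_lip.
Qed.

Lemma eqv_map_cont F : cont_on (facet F).
Proof.
have [n] := ubnP (size F); elim: n F => // n IH F sF.
apply/eqv_map_interior/eqv_map_boundary => b bF; apply: IH.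
rewrite ltnS in sF; rewrite size_filter; apply: (leq_trans _ sF).
by rewrite -(count_predC (pred1 b) F) -[ltnLHS]add0n ltn_add2r -has_count has_pred1.
Qed.
End EquivariantMap.

(** * Compactness of finite CW complexes *)

Section TypeFCompact.
Variable R : realType.

Lemma disk_compact (d : nat) : compact (disk R d).
Proof.
apply: bounded_closed_compact.
  exists 1; split; first exact: num_real.
  move=> M M1 v; rewrite /disk /= => hv; apply: le_trans (ltW M1).
  rewrite /Num.norm /= mx_normrE; apply: bigmax_le => // -[i j] _ /=.
  rewrite -(@ler_pXn2r _ 2) ?nnegrE // expr1n -normrX ger0_norm ?sqr_ge0 //.
  apply: le_trans hv; rewrite /sqnorm (bigD1 j) //= (ord1 i) lerDl.
  by apply: sumr_ge0 => k _; exact: sqr_ge0.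
have -> : disk R d = (@sqnorm R d) @^-1` [set x | x <= 1] by [].
apply: closed_comp; last exact: closed_le.
move=> v _; rewrite /sqnorm; apply: continuous_big.
  by move=> w; exact: add_continuous.
move=> i _ w.
have c : {for w, continuous (fun w : 'rV[R]_d => w 0 i)} by exact: coord_continuous.
have -> : (fun w : 'rV[R]_d => w 0 i ^+ 2) = (fun w => w 0 i * w 0 i).
  by apply/funext => u; rewrite expr2.
by apply: continuousM; exact: c.
Qed.

Lemma finite_CW_compact (X : topologicalType) : finite_CW R X -> compact [set: X].
Proof.
move=> [_ [I [dim [phi [phic _ cover _ _]]]]].
have -> : [set: X] = \big[setU/set0]_(i : I) (phi i @` disk R (dim i)).
  apply/seteqP; split=> // x _; have : [set: X] x by [].
  rewrite -cover => -[i _ [v vd <-]]; rewrite (bigD1 i) //=; left; exists v => //.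
  exact: ltW vd.
by apply: bigsetU_compact => i _; apply: continuous_compact; [exact: phic | exact: disk_compact].
Qed.
End TypeFCompact.

(** * Cohomological dimension from a covered action *)

Lemma contraction_data (R : realType) (E : topologicalType) : contractible R E ->
  exists (e0 : E) (h : E -> R -> E), [/\ forall e, h e 0 = e, forall e, h e 1 = e0 &
    forall e t, 0 <= t -> t <= 1 -> forall O : set E, open O -> O (h e t) ->
  exists B : set E, [/\ open B, B e & exists2 d, 0 < d &
    forall e' t', B e' -> 0 <= t' -> t' <= 1 -> `|t' - t| <= d -> O (h e' t')]].
Proof.
move=> [e0 [h [hc h0 h1]]]; exists e0, (fun e t => h (e, t)); split=> // e t t0 t1 O oO Oe.
have /subspace_continuousP/(_ (e, t)) := hc.
have et : ([set: E] `*` `[0, 1]%classic) (e, t) by split=> //=; rewrite in_itv /= t0.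
move=> /(_ et O (open_nbhs_nbhs (conj oO Oe))) [[B T] /= [nB nT] BT].
have /nbhs_ballP[d /= d0 dT] := nT.
exists B^°; split; [exact: open_interior | exact: nB |].
exists (d / 2); first lra.
move=> e' t' Be t'0 t'1 tt; apply: (BT (e', t')).
  split=> /=; first exact: interior_subset.
  by apply: dT; rewrite /ball /= distrC; lra.
by split=> //=; rewrite in_itv /= t'0.
Qed.

Section CoveredAction.
Variables (R : realType) (A : groupType) (E : topologicalType).
Hypothesis tfA : torsion_free A.
Variable act : A -> E -> E.
Hypothesis act_cont : continuous_action act.
Hypothesis contrE : contractible R E.
Variables (N : nat) (W : 'I_N * A -> set E).
Hypothesis W_open : forall l, open (W l).
Hypothesis W_cover : forall e, exists l, W l e.
Hypothesis W_disj : forall j a b e, W (j, a) e -> W (j, b) e -> a = b.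
Hypothesis W_act : forall j a b e, W (j, a) e -> W (j, b * a)%g (act b e).

(** The small tuples are those whose hull is mapped by the equivariant map of the
    previous sections into one W (j, a); the label of a small tuple is the partial
    function of all such pairs (j, a).  These data feed [finite_resolution]. *)
Lemma cd_le_of_covering : cd_le A N.
Proof.
have [e0 [h [h0 h1 hc]]] := contraction_data contrE.
pose D (S : set A) := S !=set0 /\ exists F : seq A, forall b, S b -> b \in F.
have [r rP] : exists r : set A -> A, forall a S, D S -> r (translate a S) = (a * r S)%g.
  apply: (@free_anchor A (set A) (@translate A) D).
  - by move=> S; apply/funext => b; rewrite /translate invg1 mul1g.
  - by move=> a b S; apply/funext => c; rewrite /translate invgM mulgA.
  - move=> a S [[b Sb] [F SF]]; split.
      by exists (a * b)%g; rewrite /translate mulgA mulVg mul1g.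
    exists (map (fun c => a * c)%g F) => c /SF cF; apply/mapP; exists (a^-1 * c)%g => //.
    by rewrite mulgA mulgV mul1g.
  - by move=> a S [S0 [F SF]]; exact: torsion_free_stab tfA S0 SF.
pose P := eqv_map act e0 h r.
have Pact F a x : facet F x -> P (pact a x) = act a (P x).
  exact: (eqv_map_act act_cont h1 rP).
pose cov l (x : A -> R) := W l (P x).
have cov_open F x : facet F x -> exists l, exists2 d, 0 < d &
    forall y, facet F y -> ball_pred x d y -> cov l y.
  move=> fx; have [l Wl] := W_cover (P x); exists l.
  exact: (eqv_map_cont act_cont h0 h1 hc fx (W_open l) Wl).
have [l0 _] := W_cover e0.
pose sm := small (R := R) cov.
pose ay := @pact R A.
have ay1 x : ay 1%g x = x by exact: pact1.
have ayM a b x : ay (a * b)%g x = ay a (ay b x) by exact: pactM.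
have sm_inside s t : inside (@hull R A) s t -> sm s -> sm t by exact: small_inside.
have sm_sub s t : subseq t s -> sm s -> sm t.
  by move=> /mem_subseq ts; apply: sm_inside; exact: (sub_inside (@hull_mem R A)).
have hull_good s y : sm s -> hull s y -> good y.
  move=> ss hy; have : inside (@hull R A) s [:: y] by move=> z; rewrite inE => /eqP ->.
  by move=> /sm_inside/(_ ss)[+ _]; apply; exact: mem_head.
have hull_pact a s y : hull (map (ay a) s) y -> hull s (ay a^-1%g y).
  move=> hy C CC Cs; pose C' z := C (ay a^-1%g z).
  suff : C' y by [].
  apply: hy => [x z c c0 c1 hx hz|_ /mapP[x xs ->]]; first exact: (CC _ _ c c0 c1 hx hz).
  by rewrite /C' -ayM mulVg ay1; exact: Cs.
have cov_act j a b y : good y -> cov (j, b) y -> cov (j, (a * b)%g) (ay a y).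
  by move=> [F fy]; rewrite /cov (Pact F) //; exact: W_act.
have good_act a y : good y -> good (ay a y).
  by move=> [F fy]; exists (map (fun b => a * b)%g F); exact: facet_pact.
have ayK a y : ay a (ay a^-1%g y) = y by rewrite -ayM mulgV ay1.
have sm_act a s : sm s -> sm (map (ay a) s).
  move=> ss; have [gs [[j b] hb]] := ss; split.
    by move=> _ /mapP[y /gs gy ->]; exact: good_act.
  exists (j, (a * b)%g) => y /hull_pact hy; rewrite -(ayK a y); apply: cov_act.
    exact: hull_good ss hy.
  exact: hb.
pose labels s j b := forall y, hull s y -> cov (j, b) y.
pose lab (s : seq (A -> R)) : label A N := [ffun j =>
  if pselect (exists b, labels s j b) is left e then Some (projT1 (cid e)) else None].
have labP s j b : s <> [::] -> lab s j = Some b <-> labels s j b.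
  case: s => // x s _; rewrite ffunE; case: pselect => [e|ne]; last first.
    by split=> // lb; case: ne; exists b.
  case: (cid e) => c lc /=; split=> [[<-] //|lb]; congr Some.
  have hx : hull (x :: s) x by apply: hull_mem; exact: mem_head.
  exact: W_disj (lc x hx) (lb x hx).
have lab_dom_gt0 s : s <> [::] -> sm s -> (0 < #|lab_dom (lab s)|)%N.
  move=> s0 [_ [[j b] /(labP s j b s0) e]].
  by apply/card_gt0P; exists j; rewrite in_lab_dom e.
have lab_sub s t : subseq t s -> t <> [::] -> sm s -> lab_le (lab s) (lab t).
  move=> ts t0 ss; have s0 : s <> [::] by move=> e; move: ts; rewrite e subseq0 => /eqP.
  apply/lab_leP => j b /(labP _ _ _ s0) lb; apply/(labP _ _ _ t0) => y hy; apply: lb.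
  by apply: hull_trans hy; exact: (sub_inside (@hull_mem R A) (mem_subseq ts)).
have map_nil a (s : seq (A -> R)) : s <> [::] -> map (ay a) s <> [::] by case: s.
have lab_act1 a s j b : s <> [::] -> sm s -> lab s j = Some b ->
    lab (map (ay a) s) j = Some (a * b)%g.
  move=> s0 ss /(labP _ _ _ s0) lb; apply/labP; first exact: map_nil.
  move=> y /hull_pact hy; rewrite -(ayK a y); apply: cov_act; last exact: lb.
  exact: hull_good ss hy.
have lab_act a s : s <> [::] -> sm s -> lab (map (ay a) s) = lact a (lab s).
  move=> s0 ss; apply/ffunP => j; rewrite [RHS]ffunE.
  case e: (lab s j) => [b|] /=; first exact: lab_act1.
  case e': (lab _ j) => [b|//]; exfalso.
  have := lab_act1 a^-1%g _ _ _ (map_nil a _ s0) (sm_act a _ ss) e'.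
  by rewrite -(map_actM ayM) mulVg (eq_map ay1) map_id e.
have y0_good : good (fun b : A => (b == 1%g)%:R : R).
  exists [:: 1%g]; split.
  - by move=> b; exact: ler0n.
  - by move=> b; rewrite inE => /negbTE ->.
  - by exists 1%g; rewrite eqxx ltr01.
have spec := nerve_map_spec sm_sub lab_dom_gt0 lab_sub lab_act.
apply: (@finite_resolution A (label A N) (A -> R) (@lact A N) ay ay1 ayM
  (@flag A N) sm (@flag_sub A N) sm_sub sm_act _ _ (@flag_anchor A N)
  (fun s => lab_anchor (lab s)) (@flag_anchor_act A N) _ N (@flag_size A N)
  (nerve_map lab)).
- by split=> //; exists l0 => y /(_ (fun=> False)) f; exfalso; apply: f.
- move=> n z sz bz.
  have sgood (s : seq (A -> R)) y : sm s -> y \in s -> good y by move=> [+ _]; apply.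
  have sev s := @eventually_small R A _ l0 cov cov_open s.
  exact: (@small_acyclic _ (@centre R A) (@hull R A) (@hull_mem R A)
    (@hull_centre R A) (@hull_trans R A) sm sm_inside (@good R A) _ y0_good sgood sev n z sz bz).
- by move=> a s s0 ss; rewrite lab_act // lab_anchor_act // lab_dom_gt0.
- exact: nerve_map_nil.
- by move=> s /spec[+ _ _]; apply: gspan_sub => t [-> []].
- by move=> s /spec[].
- by move=> a s /spec[].
Qed.
End CoveredAction.

(** * Subgroups of groups of type F *)

(** Near-covering compactness, applied to the filter of the finite lists that
    contain a given list. *)
Lemma compact_finite_cover (X : topologicalType) (I : eqType) (U : I -> set X) :
  compact [set: X] -> (forall i, open (U i)) -> (forall x, exists i, U i x) ->
  exists s : seq I, forall x, exists2 i, i \in s & U i x.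
Proof.
move=> /compact_near_coveringP cX oU cU.
pose F : set_system (seq I) := fun T => exists s : seq I, forall s' : seq I, {subset s <= s'} -> T s'.
have FF : Filter F.
  split.
  - by exists [::].
  - move=> P Q [s hs] [t ht]; exists (s ++ t) => u st; split.
      by apply: hs => i is_; apply: st; rewrite mem_cat is_.
    by apply: ht => i it; apply: st; rewrite mem_cat it orbT.
  - by move=> P Q PQ [s hs]; exists s => t /hs /PQ.
have [|s hs] := cX (seq I) F (fun s x => exists2 i, i \in s & U i x) FF.
  move=> x _; have [i Uix] := cU x.
  exists (U i, [set s : seq I | i \in s]) => /=; first split.
  - exact: open_nbhs_nbhs (conj (oU i) Uix).
  - by exists [:: i] => t; apply; exact: mem_head.
  by move=> [y s] /= [Uiy ist]; exists i.
by exists s => x; apply: (hs s).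
Qed.

Section TypeFCd.
Variables (R : realType) (G A : groupType).

(** The translates of an evenly covered open set V e are disjoint, and finitely
    many sets p (V e) cover the compact quotient.  The sheets are indexed by G;
    grouping them along an A-equivariant map rho : G -> A indexes them by A. *)
Lemma type_F_cd : type_F R G -> embeds A G -> torsion_free A -> exists n, cd_le A n.
Proof.
move=> [X [/finite_CW_compact cX [E [actG [p [contrE actc cov orb]]]]]] [f [finj fM]] tfA.
have [act1 actM actct] := actc; have [psurj porb popen] := orb.
have f1 : f 1%g = 1%g by apply: (@mulgI _ (f 1%g)); rewrite -fM !mulg1.
have actK g e : actG g^-1%g (actG g e) = e by rewrite -actM mulVg act1.
have actKV g e : actG g (actG g^-1%g e) = e by rewrite -actM mulgV act1.
have /choice[V VP] := cov.
have img g U : actG g @` U = actG g^-1%g @^-1` U.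
  apply/seteqP; split=> [_ [e Ue <-]|e Ue] /=; first by rewrite actK.
  by exists (actG g^-1%g e) => //; rewrite actKV.
have oimg g U : open U -> open (actG g @` U).
  by move=> oU; rewrite img; move: oU; apply: (continuousP _).1; exact: actct.
have [|x|s sP] := @compact_finite_cover X E (fun e => p @` V e) cX.
- move=> e; apply/popen; have [oV _ _] := VP e.
  have -> : p @^-1` (p @` V e) = \bigcup_g (actG g @` V e).
    apply/seteqP; split=> [y [v Vv /porb[g <-]]|y [g _ [v Vv <-]]].
      by exists g => //; exists v.
    by exists v => //; apply/porb; exists g.
  by apply: bigcup_open => g _; exact: oimg.
- have : [set: X] x by []. rewrite -psurj => -[e _ <-]; exists e; exists e => //.
  by have [] := VP e.
have [e0 _] := contrE.
pose N := size s; pose Vj (j : 'I_N) := V (nth e0 s j).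
have [rho rhoP] : exists rho : G -> A, forall a g, True -> rho (f a * g)%g = (a * rho g)%g.
  apply: (@free_anchor A G (fun a g => f a * g)%g (fun=> True)) => //.
  - by move=> g; rewrite f1 mul1g.
  - by move=> a b g; rewrite fM mulgA.
  - move=> a g _ e; apply: finj; rewrite f1.
    by apply: (@mulIg _ g); rewrite mul1g.
pose W (l : 'I_N * A) := \bigcup_(g in [set g | rho g = l.2]) (actG g @` Vj l.1).
exists N; apply: (@cd_le_of_covering R A E tfA (fun a => actG (f a)) _ contrE N W).
- split=> [e|a b e|a]; rewrite ?f1 ?fM //.
- by move=> l; apply: bigcup_open => g _; apply: oimg; have [] := VP (nth e0 s l.1).
- move=> e; have [e1 e1s [v Vv /porb[g gv]]] := sP (p e).
  have js : (index e1 s < N)%N by rewrite index_mem.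
  exists (Ordinal js, rho g); exists g => //=; exists v => //.
  by rewrite /Vj /= nth_index.
- move=> j a b e [g /= <- [v Vv <-]] [g' /= <- [v' Vv' e']].
  have [_ _ disj] := VP (nth e0 s j).
  have [->//|gg'] := eqVneq g g'; exfalso.
  have ne : (g'^-1 * g)%g <> 1%g.
    by move=> /mulg1_eq; rewrite invgK => gE; rewrite gE eqxx in gg'.
  have : ((actG (g'^-1 * g)%g @` V (nth e0 s j)) `&` V (nth e0 s j)) v'.
    by split=> //; exists v => //; rewrite actM -e' actK.
  by rewrite disj.
- move=> j a b e [g /= gg [v Vv <-]]; exists (f b * g)%g; first by rewrite /= rhoP // gg.
  by exists v => //; rewrite actM.
Qed.
End TypeFCd.

(** * The theorem *)

Theorem corollary5p8 (R : realType) :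
  ((exists A : groupType, Adian_extension A /\
      exists G : groupType, [/\ weakly_AH G, type_F R G & embeds A G])
   <->
   (exists G : groupType, [/\ weakly_AH G, type_F R G & ~ AH G]))
  /\
  ((forall A : groupType, Adian_extension A -> infinite_cd A) ->
   forall G : groupType, type_F R G -> (weakly_AH G <-> AH G)).
Proof.
have adian G : weakly_AH G -> ~ AH G ->
    exists A, Adian_extension A /\ embeds A G.
  move=> wG nAH; have [nZ2 _] := wG.
  exact: not_CT_Adian (weakly_AH_torsion_free wG) nZ2 (weakly_AH_not_CT wG nAH).
split; first split.
- move=> [A [adA [G [wG FG AG]]]]; exists G; split=> // -[_ ct _].
  exact: (Adian_not_CT adA) (embeds_CT AG ct).
- move=> [G [wG FG nAH]]; have [A [adA AG]] := adian G wG nAH.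
  by exists A; split=> //; exists G.
move=> inf G FG; split; last exact: AH_weakly_AH.
move=> wG; apply: contrapT => nAH; have [A [adA AG]] := adian G wG nAH.
have [_ tfA _] := adA; have [n] := type_F_cd FG AG tfA.
exact: inf.
Qed.
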